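(* Let $\mathbf{u}=(u,v,w)$ (with pressure $p$) be a type I weak solution of the hydrostatic Euler equations on $\mathbb{T}^3\times(0,T)$ and assume that $u,v\in L^4((0,T);B^\alpha_{4,\infty}(\mathbb{T}^3))$ with $\alpha>\frac12$. Then $D(\mathbf{u})=0$, and (as a consequence) the weak solution conserves energy, that is, $$\lVert u(t_1,\cdot)\rVert_{L^2}^2+\lVert v(t_1,\cdot)\rVert_{L^2}^2=\lVert u(t_2,\cdot)\rVert_{L^2}^2+\lVert v(t_2,\cdot)\rVert_{L^2}^2\quad\text{for a.e. } t_1,t_2\in(0,T).$$
   Context: $\mathbb{T}^3$ is the flat unit torus with coordinates $(x,y,z)$ (in integrals over $\mathbb{T}^3$ the spatial variable is also written $x$), $T>0$, and $\Omega\in\mathbb{R}$ is the Coriolis parameter. $\mathcal{D}(\mathbb{T}^3\times(0,T))$ denotes smooth real functions compactly supported in time in $(0,T)$. The hydrostatic Euler equations are $\partial_t u+\nabla\cdot(u\mathbf{u})-\Omega v+\partial_x p=0$, $\partial_t v+\nabla\cdot(v\mathbf{u})+\Omega u+\partial_y p=0$, $\partial_z p=0$, $\nabla\cdot\mathbf{u}=0$, considered on the torus under the symmetry conditions that $u,v,p$ are even in $z$ and $w$ is odd in $z$. Type I weak solution: $\mathbf{u}=(u,v,w):\mathbb{T}^3\times(0,T)\to\mathbb{R}^3$ and $p:\mathbb{T}^3\times(0,T)\to\mathbb{R}$ such that (i) $\mathbf{u}\in L^2(\mathbb{T}^3\times(0,T))$, $u,v\in L^\infty((0,T);L^2(\mathbb{T}^3))$,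 $p\in L^\infty((0,T);L^1(\mathbb{T}^3))$; (ii) for all $\phi_1,\phi_2,\phi_3,\phi_4\in\mathcal{D}(\mathbb{T}^3\times(0,T))$: $\int_0^T\int_{\mathbb{T}^3}[u\partial_t\phi_1+u\mathbf{u}\cdot\nabla\phi_1+\Omega v\phi_1+p\partial_x\phi_1]\,dx\,dt=0$, $\int_0^T\int_{\mathbb{T}^3}[v\partial_t\phi_2+v\mathbf{u}\cdot\nabla\phi_2-\Omega u\phi_2+p\partial_y\phi_2]\,dx\,dt=0$, $\int_0^T\int_{\mathbb{T}^3}p\,\partial_z\phi_3\,dx\,dt=0$, $\int_0^T\int_{\mathbb{T}^3}\mathbf{u}\cdot\nabla\phi_4\,dx\,dt=0$; (iii) $w(x,y,0,t)=w(x,y,1,t)=0$ (in the trace sense) for almost all $(x,y)\in\mathbb{T}^2$, $t\in(0,T)$. Defect term: let $\varphi\in C_c^\infty(\mathbb{R}^3;\mathbb{R})$ be a radial standard mollifier with $\int\varphi=1$, $\varphi_\epsilon(x)=\epsilon^{-3}\varphi(x/\epsilon)$, and $\delta f(\xi;x,t)=f(x+\xi,t)-f(x,t)$. Then $$D(\mathbf{u})(x,t)=\lim_{\epsilon\to0}\int_{\mathbb{R}^3}\nabla\varphi_\epsilon(\xi)\cdot\delta\mathbf{u}(\xi;x,t)\big(|\delta u(\xi;x,t)|^2+|\delta v(\xi;x,t)|^2\big)\,d\xi,$$ the limit being taken in the sense of distributions on $\mathbb{T}^3\times(0,T)$. Besov space: for $s>0$, $1\le p\le\infty$, $B^s_{p,\infty}(\mathbb{T}^n)$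 has norm $\lVert f\rVert_{L^p}+\sup_{h\in\mathbb{R}^n\setminus\{0\}}|h|^{-s}\lVert\Delta_h^{\lfloor s\rfloor+1}f\rVert_{L^p}$, where $\Delta_h^1f(x)=f(x+h)-f(x)$ and $\Delta_h^mf=\Delta_h(\Delta_h^{m-1}f)$. *)

(* Defs.v *)
From HB Require Import structures.
From mathcomp Require Import all_boot all_order all_algebra.
From mathcomp Require Import all_classical all_reals all_analysis.

Set Implicit Arguments.
Unset Strict Implicit.
Unset Printing Implicit Defensive.

Import Order.TTheory GRing.Theory Num.Theory.
Import numFieldNormedType.Exports.

Local Open Scope classical_set_scope.
Local Open Scope ring_scope.

(* A function on the unit torus T^3 is a function on R^3 that is 1-periodic in
   each variable; integrals over T^3 are integrals over the unit cube.  A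
   function on T^3 x (0,T) is a function of (x, y, z, t) in R^4 whose values at
   times t outside (0,T) are irrelevant. *)

Lemma product_sigma_finite d1 d2 (T1 : measurableType d1)
    (T2 : measurableType d2) (R : realType)
    (m1 : {sigma_finite_measure set T1 -> \bar R})
    (m2 : {sigma_finite_measure set T2 -> \bar R}) :
  sigma_finite setT (m1 \x m2)%E.
Proof.
have /sigma_finiteP[F [TF ndF Foo]] := sigma_finiteT m1.
have /sigma_finiteP[G [TG ndG Goo]] := sigma_finiteT m2.
exists (fun n => F n `*` G n).
  rewrite -setXTT TF TG predeqE => -[x y]; split.
    move=> [/= [n _ Fnx] [k _ Gky]]; exists (maxn n k) => //; split.
      by move: x Fnx; exact/subsetPset/ndF/leq_maxl.
    by move: y Gky; exact/subsetPset/ndG/leq_maxr.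
  by move=> [n _ []/= ? ?]; split; exists n.
move=> k; have [? ?] := Foo k; have [? ?] := Goo k.
split; first exact: measurableX.
by rewrite product_measure1E// lte_mul_pinfty// ge0_fin_numE.
Qed.

Section Hydrostatic.
Context {R : realType}.

(* [measurableTypeR R] is R with the Borel sigma-algebra on which
   [lebesgue_measure] is defined. *)
Local Notation B := (measurableTypeR R).
Local Notation R3 := (R * R * R)%type.
Local Notation R4 := (R * R * R * R)%type.
Local Notation leb := (@lebesgue_measure R).

Definition leb2 : set (B * B) -> \bar R := (leb \x leb)%E.
HB.instance Definition _ := Measure.on leb2.
HB.instance Definition _ := Measure_isSigmaFinite.Build _ _ _ leb2
  (product_sigma_finite leb leb).

Definition leb3 : set (B * B * B) -> \bar R := (leb2 \x leb)%E.
HB.instance Definition _ := Measure.on leb3.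
HB.instance Definition _ := Measure_isSigmaFinite.Build _ _ _ leb3
  (product_sigma_finite leb2 leb).

Definition leb4 : set (B * B * B * B) -> \bar R := (leb3 \x leb)%E.
HB.instance Definition _ := Measure.on leb4.
HB.instance Definition _ := Measure_isSigmaFinite.Build _ _ _ leb4
  (product_sigma_finite leb3 leb).

Definition cube : set R3 := `[0, 1] `*` `[0, 1] `*` `[0, 1].
Definition cylinder (T : R) : set R4 := cube `*` `]0, T[.

Definition periodic_xy (f : R4 -> R) : Prop :=
  forall x y z t,
    f (x + 1, y, z, t) = f (x, y, z, t) /\ f (x, y + 1, z, t) = f (x, y, z, t).

Definition periodic_z (f : R4 -> R) : Prop :=
  forall x y z t, f (x, y, z + 1, t) = f (x, y, z, t).

Definition torus_function (f : R4 -> R) : Prop := periodic_xy f /\ periodic_z f.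

Definition measurable_on (T : R) (f : R4 -> R) : Prop :=
  measurable_fun ([set: B * B * B] `*` (`]0, T[ : set B)) f.

(* For a finite-dimensional V this is membership in C^oo(V). *)
Definition smooth (V : normedModType R) (f : V -> R) : Prop :=
  forall (s : seq V) (x : V), differentiable (foldr (fun v g => 'D_v g) f s) x.

Definition compact_time_support (T : R) (f : R4 -> R) : Prop :=
  exists a b : R,
    [/\ 0 < a, b < T & forall q : R4, f q != 0 -> a <= q.2 <= b].

Definition test_function (T : R) (f : R4 -> R) : Prop :=
  [/\ smooth f, torus_function f & compact_time_support T f].

(* Restrictions to 0 <= z <= 1 of these functions are the test functions on the
   closed slab T^2 x [0,1] x (0,T): no condition is put at z = 0 and z = 1. *)
Definition slab_test_function (T : R) (f : R4 -> R) : Prop :=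
  [/\ smooth f, periodic_xy f & compact_time_support T f].

Definition dx (f : R4 -> R) : R4 -> R := 'D_((1, 0, 0, 0) : R4) f.
Definition dy (f : R4 -> R) : R4 -> R := 'D_((0, 1, 0, 0) : R4) f.
Definition dz (f : R4 -> R) : R4 -> R := 'D_((0, 0, 1, 0) : R4) f.
Definition dt (f : R4 -> R) : R4 -> R := 'D_((0, 0, 0, 1) : R4) f.

Definition slice (f : R4 -> R) (t : R) : R3 -> R := fun x => f (x, t).

Definition torus_norm (p : \bar R) (f : R3 -> R) : \bar R :=
  'N[leb3]_p[(EFin \o f) \_ cube]%E.

Definition cylinder_norm (T : R) (p : \bar R) (f : R4 -> R) : \bar R :=
  'N[leb4]_p[(EFin \o f) \_ (cylinder T)]%E.

(* The norm of L^q((0,T); X), where [N] is the norm of X.  Membership is joint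
   measurability plus finiteness of this norm; Bochner measurability into X
   (which may be nonseparable, as for Besov spaces) is not demanded. *)
Definition bochner_norm (T : R) (q : \bar R) (N : (R3 -> R) -> \bar R)
    (f : R4 -> R) : \bar R :=
  'N[leb]_q[(fun t => N (slice f t)) \_ `]0%R, T[]%E.

(* The canonical norm on a product type is the sup norm. *)
Definition enorm (x : R3) : R :=
  Num.sqrt (x.1.1 ^+ 2 + x.1.2 ^+ 2 + x.2 ^+ 2).

Definition finite_difference (h : R3) (f : R3 -> R) : R3 -> R :=
  fun x => f (x + h) - f x.

(* The norm of B^s_{p,oo}(T^3), for s > 0; [Num.truncn s] is the floor of s. *)
Definition besov_norm (s : R) (p : \bar R) (f : R3 -> R) : \bar R :=
  (torus_norm p f +
   ereal_sup [set (enorm h `^ (- s))%R%:E *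
                  torus_norm p (iter (Num.truncn s).+1 (finite_difference h) f)
             | h in [set h : R3 | h != 0%R]])%E.

Definition base (T : R) : set R3 := `[0, 1] `*` `[0, 1] `*` `]0, T[.

(* For a divergence-free square-integrable field (u,v,w), the traces of w at
   z = 0 and z = 1 are its normal traces on the boundary of the slab
   T^2 x (0,1), which are defined by Green's formula.  Here [g0] and [g1] are
   functions of (x, y, t). *)
Definition vertical_traces (T : R) (u v w : R4 -> R) (g0 g1 : R3 -> R) : Prop :=
  [/\ leb3.-integrable (base T) (EFin \o g0),
      leb3.-integrable (base T) (EFin \o g1) &
      forall f, slab_test_function T f ->
        \int[leb4]_(q in cylinder T) (u q * dx f q + v q * dy f q + w q * dz f q)
        = \int[leb3]_(s in base T) (g1 s * f (s.1.1, s.1.2, 1, s.2)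
                                    - g0 s * f (s.1.1, s.1.2, 0, s.2))].

Record type_I_weak_solution (Omega T : R) (u v w p : R4 -> R) : Prop := {
  sol_periodic : [/\ torus_function u, torus_function v, torus_function w
                   & torus_function p] ;
  sol_measurable : [/\ measurable_on T u, measurable_on T v, measurable_on T w
                     & measurable_on T p] ;
  sol_L2 : [/\ (cylinder_norm T 2%:E u < +oo)%E,
               (cylinder_norm T 2%:E v < +oo)%E
             & (cylinder_norm T 2%:E w < +oo)%E] ;
  sol_LooL2 : (bochner_norm T +oo (torus_norm 2%:E) u < +oo)%E /\
              (bochner_norm T +oo (torus_norm 2%:E) v < +oo)%E ;
  sol_LooL1 : (bochner_norm T +oo (torus_norm 1%:E) p < +oo)%E ;
  sol_momentum_x : forall f, test_function T f ->
    \int[leb4]_(q in cylinder T)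
      (u q * dt f q
       + u q * (u q * dx f q + v q * dy f q + w q * dz f q)
       + Omega * v q * f q + p q * dx f q) = 0 ;
  sol_momentum_y : forall f, test_function T f ->
    \int[leb4]_(q in cylinder T)
      (v q * dt f q
       + v q * (u q * dx f q + v q * dy f q + w q * dz f q)
       - Omega * u q * f q + p q * dy f q) = 0 ;
  sol_momentum_z : forall f, test_function T f ->
    \int[leb4]_(q in cylinder T) (p q * dz f q) = 0 ;
  sol_divergence : forall f, test_function T f ->
    \int[leb4]_(q in cylinder T)
      (u q * dx f q + v q * dy f q + w q * dz f q) = 0 ;
  sol_trace : exists g0 g1 : R3 -> R,
    vertical_traces T u v w g0 g1 /\
    {ae leb3, forall s, base T s -> g0 s = 0 /\ g1 s = 0} }.

Definition reflect_z (q : R4) : R4 := (q.1.1.1, q.1.1.2, - q.1.2, q.2).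

Definition z_symmetric (T : R) (u v w p : R4 -> R) : Prop :=
  {ae leb4, forall q, cylinder T q ->
    [/\ u (reflect_z q) = u q, v (reflect_z q) = v q,
        w (reflect_z q) = - w q & p (reflect_z q) = p q]}.

Definition radial_mollifier (rho : R3 -> R) : Prop :=
  [/\ smooth rho,
      exists r : R, forall x, r < enorm x -> rho x = 0,
      forall x y, enorm x = enorm y -> rho x = rho y &
      \int[leb3]_(x in [set: R3]) rho x = 1].

Definition rescale (rho : R3 -> R) (eps : R) : R3 -> R :=
  fun x => eps ^- 3 * rho (eps^-1 *: x).

Definition increment (f : R4 -> R) (xi : R3) (q : R4) : R :=
  f (q.1 + xi, q.2) - f q.

Definition defect_density (rho : R3 -> R) (u v w : R4 -> R) (eps : R)
    (q : R4) : R :=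
  \int[leb3]_(xi in [set: R3])
    (('D_((1, 0, 0) : R3) (rescale rho eps) xi * increment u xi q
      + 'D_((0, 1, 0) : R3) (rescale rho eps) xi * increment v xi q
      + 'D_((0, 0, 1) : R3) (rescale rho eps) xi * increment w xi q)
     * (`|increment u xi q| ^+ 2 + `|increment v xi q| ^+ 2)).

(* The distributional limit D(u) exists and is the distribution [D]. *)
Definition is_defect (rho : R3 -> R) (T : R) (u v w : R4 -> R)
    (D : (R4 -> R) -> R) : Prop :=
  forall f, test_function T f ->
    \int[leb4]_(q in cylinder T) (defect_density rho u v w eps q * f q)
      @[eps --> 0^'+] --> D f.

Definition energy (u v : R4 -> R) (t : R) : \bar R :=
  (torus_norm 2%:E (slice u t) ^+ 2 + torus_norm 2%:E (slice v t) ^+ 2)%E.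

Definition conserves_energy (T : R) (u v : R4 -> R) : Prop :=
  exists2 N : set B, leb.-negligible N &
    forall t1 t2 : R, 0 < t1 < T -> 0 < t2 < T -> ~ N t1 -> ~ N t2 ->
      energy u v t1 = energy u v t2.

End Hydrostatic.

(* Main.v *)
From HB Require Import structures.
Require Import Defs.
From mathcomp Require Import all_boot all_order all_algebra.
From mathcomp Require Import ring lra.
From mathcomp Require Import all_classical all_reals all_analysis.
From mathcomp Require Import measurable_realfun ess_sup_inf.

Set Implicit Arguments.
Unset Strict Implicit.
Unset Printing Implicit Defensive.

Import Order.TTheory GRing.Theory Num.Theory.
Import numFieldNormedType.Exports.

Local Open Scope classical_set_scope.
Local Open Scope ring_scope.

(** Both conclusions come from one estimate.  For q = u or q = v and
    s = min (alpha, 3/4), a number in ]1/2, 1[,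
      int int |q (x + h, t) - q (x, t)|^4 dx dt <= M |h|^(4 s)   for all h
    ([nikolskii]).  The Besov norm controls differences of order
    floor alpha + 1; Marchaud's inequality brings the order down to 1, and it
    does so because s < 1.  The Besov norm of a time slice need not be a
    measurable function of time, but only the monotonicity of the integral is
    used on it.  By Young's inequality, every square integrable a satisfies
      int int |a| (|delta_h u|^2 + |delta_h v|^2) = O (|h|^(2 s))
    ([quadratic_increment_bound]).  The hypothesis alpha > 1/2 enters through
    2 s > 1 only.

    Defect.  The gradient of the mollifier at scale eps is O (eps^-4) and lives
    in a box of volume O (eps^3) on which |xi| = O (eps).  Hence the defect at
    scale eps, tested against a smooth function, is O (eps^(2 s - 1))
    ([defect_zero]).

    Energy.  Let K_m be the m-th normalised product kernel
      K_m (x) = c_m (cos (pi x_1) cos (pi x_2) cos (pi x_3))^(2 (m + 1)).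
    It is an approximate identity on the torus, and since cos^2 has three
    Fourier modes it is a finite sum K_m (x - y) = c sum_j a_j (x) a_j (y) of
    products of trigonometric polynomials ([mode_sum]).  Testing the momentum
    equations with a_j (x) psi (t) shows that the coefficients U_j = int u a_j
    and V_j = int v a_j have integrable weak time derivatives G_j and H_j, so
    that U_j^2 has the weak derivative 2 U_j G_j ([weak_square]).  In the sum
    2 sum_j (U_j G_j + V_j H_j) the Coriolis terms cancel, the pressure terms
    cancel because the velocity is divergence free and p does not depend on z,
    and the transport terms add up to
      - int_x int_y (|u x - u y|^2 + |v x - v y|^2) (u, v, w) (x) . grad K_m (x - y)
    ([energy_identity]).  Only one of the three factors is not an increment of
    u or v, and it is merely required to be square integrable: this is why no
    regularity of w is needed.  As |grad K_m (xi)| is at most a constant times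
    m |xi| K_(m-1) (xi), where K_(m-1) concentrates at |xi| of size m^(-1/2),
    the time integral of this flux is O (m^(1/2 - s)) and tends to 0
    ([derivative_kernel_small]).  So the truncated energy c sum_j (U_j^2 + V_j^2)
    is nearly constant in time.  It differs from the energy by
      1/2 int_x int_y K_m (x - y) (|u x - u y|^2 + |v x - v y|^2)
    ([kernel_variance]), which tends to 0 for the same reason ([kernel_small]).
    Thus the energy is, in L^1 of time, arbitrarily close to constants, and it
    is constant almost everywhere ([ae_constant]). *)

(** * Integral inequalities without measurability, Tonelli and Fubini on rectangles *)

Section Integrals.
Context {R : realType}.
Local Open Scope ereal_scope.

Section Monotone.
Context d (X : measurableType d) (mu : {measure set X -> \bar R}).

(** The integral of a nonnegative function is a supremum over simple
    functions below it, hence monotone for all functions, measurable or not.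
    This is what allows integrals of Besov norms of time slices to be used. *)
Lemma ge0_le_integral_any (D : set X) (f g : X -> \bar R) :
  (forall x, D x -> 0 <= f x) -> (forall x, D x -> f x <= g x) ->
  \int[mu]_(x in D) f x <= \int[mu]_(x in D) g x.
Proof.
move=> f0 fg.
have g0 x : D x -> 0 <= g x by move=> Dx; exact: le_trans (f0 _ Dx) (fg _ Dx).
rewrite integral_mkcond [leRHS]integral_mkcond.
have rf0 x : 0 <= (f \_ D) x.
  by rewrite patchE; case: ifPn => //; rewrite inE => /f0.
have rg0 x : 0 <= (g \_ D) x.
  by rewrite patchE; case: ifPn => //; rewrite inE => /g0.
rewrite ge0_integralTE// ge0_integralTE//.
apply: le_ereal_sup => /= _ [h /= hf <-]; exists h => // x /=.
apply: (le_trans (hf x)); rewrite !patchE; case: ifPn => //.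
by rewrite inE => /fg.
Qed.

Lemma abse_integral_le_any (D : set X) (f g : X -> \bar R) :
  (forall x, D x -> `|f x| <= g x) ->
  `|\int[mu]_(x in D) f x| <= \int[mu]_(x in D) g x.
Proof.
move=> fg; rewrite integralE.
have g0 : 0 <= \int[mu]_(x in D) g x.
  by apply: integral_ge0 => x Dx; exact: le_trans (fg _ Dx).
have p : \int[mu]_(x in D) f^\+ x <= \int[mu]_(x in D) g x.
  apply: ge0_le_integral_any => // x Dx; apply: le_trans (fg _ Dx).
  by rewrite -/((abse \o f) x) fune_abse leeDl.
have n : \int[mu]_(x in D) f^\- x <= \int[mu]_(x in D) g x.
  apply: ge0_le_integral_any => // x Dx; apply: le_trans (fg _ Dx).
  by rewrite -/((abse \o f) x) fune_abse leeDr.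
have p0 : 0 <= \int[mu]_(x in D) f^\+ x by apply: integral_ge0.
have n0 : 0 <= \int[mu]_(x in D) f^\- x by apply: integral_ge0.
move: p n p0 n0 g0.
move: (\int[mu]_(x in D) f^\+ x) (\int[mu]_(x in D) f^\- x)
  (\int[mu]_(x in D) g x) => [a| |] [b| |] [c| |] //=; rewrite ?leey//.
by rewrite !lee_fin => *; rewrite ler_norml; apply/andP; split; lra.
Qed.

(** An integral that is infinite or undefined has real part 0, which every
    nonnegative bound exceeds. *)
Lemma Rintegral_le_any (D : set X) (f : X -> R) (g : X -> \bar R) :
  (forall x, D x -> `|f x|%:E <= g x) ->
  `|Rintegral mu D f|%:E <= \int[mu]_(x in D) g x.
Proof.
move=> fg; apply: le_trans (abse_integral_le_any (f := EFin \o f) fg).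
by rewrite /Rintegral /comp; case: integral => [r| |] //=; rewrite ?normr0 ?leey.
Qed.

End Monotone.

Section ProductSets.
Context d1 d2 (X : measurableType d1) (Y : measurableType d2).
Variables (m1 : {sigma_finite_measure set X -> \bar R}).
Variables (m2 : {sigma_finite_measure set Y -> \bar R}).
Variables (A : set X) (B : set Y).
Hypotheses (mA : measurable A) (mB : measurable B).

Let patch_setX (f : X * Y -> \bar R) x y :
  (f \_ (A `*` B)) (x, y) = ((fun x' => ((fun y' => f (x', y')) \_ B) y) \_ A) x.
Proof.
rewrite !patchE; case: (pselect (A x)) => Ax; case: (pselect (B y)) => By_;
  rewrite ?(mem_set Ax) ?(memNset Ax) ?(mem_set By_) ?(memNset By_).
- by rewrite mem_set.
- by rewrite memNset// => -[].
- by rewrite memNset// => -[].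
- by rewrite memNset// => -[].
Qed.

Let patch_setX' (f : X * Y -> \bar R) x y :
  (f \_ (A `*` B)) (x, y) = ((fun y' => ((fun x' => f (x', y')) \_ A) x) \_ B) y.
Proof.
rewrite patch_setX !patchE; case: ifP => //; case: ifP => //.
Qed.

Lemma tonelli_setX1 (f : X * Y -> \bar R) :
  measurable_fun setT f -> (forall z, 0 <= f z) ->
  \int[(m1 \x m2)]_(z in A `*` B) f z =
  \int[m1]_(x in A) \int[m2]_(y in B) f (x, y).
Proof.
move=> mf f0; rewrite integral_mkcond fubini_tonelli1; last 2 first.
- apply/(measurable_restrictT _ _).1; first exact: measurableX.
  exact: measurable_funS mf.
- by move=> z; apply: erestrict_ge0 => *; exact: f0.
rewrite [RHS]integral_mkcond; apply: eq_integral => x _.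
rewrite /fubini_F /=; under eq_integral do rewrite patch_setX.
rewrite patchE; case: ifPn => Ax.
  rewrite [RHS]integral_mkcond; apply: eq_integral => y _.
  by rewrite patchE Ax.
rewrite -[RHS](integral0 m2 setT); apply: eq_integral => y _.
by rewrite patchE (negbTE Ax).
Qed.

Lemma tonelli_setX2 (f : X * Y -> \bar R) :
  measurable_fun setT f -> (forall z, 0 <= f z) ->
  \int[(m1 \x m2)]_(z in A `*` B) f z =
  \int[m2]_(y in B) \int[m1]_(x in A) f (x, y).
Proof.
move=> mf f0; rewrite integral_mkcond fubini_tonelli2; last 2 first.
- apply/(measurable_restrictT _ _).1; first exact: measurableX.
  exact: measurable_funS mf.
- by move=> z; apply: erestrict_ge0 => *; exact: f0.
rewrite [RHS]integral_mkcond; apply: eq_integral => y _.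
rewrite /fubini_G /=; under eq_integral do rewrite patch_setX'.
rewrite patchE; case: ifPn => By_.
  rewrite [RHS]integral_mkcond; apply: eq_integral => x _.
  by rewrite patchE By_.
rewrite -[RHS](integral0 m1 setT); apply: eq_integral => x _.
by rewrite patchE (negbTE By_).
Qed.

Lemma tonelli_swap (f : X * Y -> \bar R) :
  measurable_fun setT f -> (forall z, 0 <= f z) ->
  \int[m1]_(x in A) \int[m2]_(y in B) f (x, y) =
  \int[m2]_(y in B) \int[m1]_(x in A) f (x, y).
Proof. by move=> mf f0; rewrite -tonelli_setX1// tonelli_setX2. Qed.

Lemma measurable_tonelli2 (f : X * Y -> \bar R) :
  measurable_fun setT f -> (forall z, 0 <= f z) ->
  measurable_fun setT (fun y => \int[m1]_(x in A) f (x, y)).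
Proof.
move=> mf f0.
have -> : (fun y => \int[m1]_(x in A) f (x, y)) =
    (fun y => \int[m1]_x (f \_ (A `*` setT)) (x, y)).
  apply/funext => y; rewrite integral_mkcond; apply: eq_integral => x _.
  rewrite !patchE; case: (pselect (A x)) => Ax.
    by rewrite !mem_set.
  by rewrite !memNset// => -[].
apply: (measurable_fun_fubini_tonelli_G (f \_ (A `*` setT))).
  apply/(measurable_restrictT _ _).1; first exact: measurableX.
  exact: measurable_funS mf.
by move=> z; apply: erestrict_ge0 => *; exact: f0.
Qed.

(** The real integral of a slice is meaningful for almost every slice only,
    so the almost everywhere integrability of slices is part of the result. *)
Lemma fubini_setX (f : X * Y -> R) :
  (m1 \x m2).-integrable (A `*` B) (EFin \o f) ->
  [/\ {ae m2, forall y, B y -> m1.-integrable A (fun x => (f (x, y))%:E)},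
      m2.-integrable B (fun y => (\int[m1]_(x in A) f (x, y))%R%:E) &
      (\int[m1 \x m2]_(z in A `*` B) f z =
       \int[m2]_(y in B) \int[m1]_(x in A) f (x, y))%R].
Proof.
move=> /(integrable_mkcond _ (measurableX mA mB)) If.
have AE := ae_integrable2 If.
have E y : B y -> (fun x => ((EFin \o f) \_ (A `*` B)) (x, y)) =
    ((fun x => (f (x, y))%:E) \_ A).
  move=> By_; apply/funext => x; rewrite patch_setX' patchE mem_set//.
have aeB : {ae m2, forall y, B y -> m1.-integrable A (fun x => (f (x, y))%:E)}.
  apply: filterS AE => y + By_.
  by rewrite E// => /(integrable_mkcond _ mA).
have G : fubini_G m1 ((EFin \o f) \_ (A `*` B)) =
    (fun y => \int[m1]_(x in A) (f (x, y))%:E) \_ B.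
  apply/funext => y; rewrite /fubini_G patchE; case: ifPn => By_.
    rewrite [RHS]integral_mkcond; apply: eq_integral => x _.
    by rewrite patch_setX' patchE By_.
  rewrite -[RHS](integral0 m1 setT); apply: eq_integral => x _.
  by rewrite patch_setX' patchE (negbTE By_).
have mf := measurable_int _ If.
have IG : m2.-integrable setT (fubini_G m1 ((EFin \o f) \_ (A `*` B))).
  apply/integrableP; split; first exact: (measurable_fubini_G If).
  apply: le_lt_trans ((integrable21ltyP m1 m2 mf).1 If).
  by apply: ge0_le_integral_any => // y _; exact: abse_integral_le_any.
rewrite G in IG.
have IG' : m2.-integrable B (fun y => \int[m1]_(x in A) (f (x, y))%:E).
  exact/(integrable_mkcond _ mB).
have ae_fin : {ae m2, forall y, B y -> \int[m1]_(x in A) (f (x, y))%:E =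
    (\int[m1]_(x in A) f (x, y))%R%:E}.
  apply: filterS aeB => y /[apply] If'.
  by rewrite fineK// integrable_fin_num.
have mG' : measurable_fun B (fun y => (\int[m1]_(x in A) f (x, y))%R%:E).
  apply/measurable_EFinP; apply: measurableT_comp => //=.
  exact: measurable_int IG'.
split => //.
- apply/integrableP; split => //.
  move/integrableP: IG' => [_]; apply: le_lt_trans.
  apply: ge0_le_integral_any => // y By_.
  rewrite /Rintegral; case: integral => //= *; by rewrite ?normr0 ?leey.
- rewrite /Rintegral; congr fine; rewrite integral_mkcond -integral21_prod_meas1//.
  rewrite G -integral_mkcond; apply: ae_eq_integral => //.
  exact: measurable_int IG'.
Qed.

End ProductSets.
End Integrals.

(** * Translation invariance of integrals over the torus *)

Section Translation.
Context {R : realType}.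
Local Notation B := (measurableTypeR R).
Local Notation R3 := (R * R * R)%type.
Local Notation leb := (@lebesgue_measure R).
Local Open Scope ereal_scope.

Lemma measurable_shift (h : R) : measurable_fun setT (fun x : B => (x + h)%R : B).
Proof. exact: measurable_funD. Qed.

(** The pushforward by a translation agrees with the Lebesgue measure on
    half-open intervals, and these determine the measure. *)
Lemma lebesgue_measure_shift (h : R) (A : set B) : measurable A ->
  pushforward leb (fun x : B => (x + h)%R : B) A = leb A.
Proof.
move=> mA; apply/esym.
have mphi : measurable_fun setT (fun x : B => (x + h)%R : B) by exact: measurable_shift.
pose phi : {mfun B >-> B} := HB.pack (fun x : B => (x + h)%R : B)
  (isMeasurableFun.Build _ _ _ _ _ mphi).
rewrite -[pushforward _ _]/(pushforward leb phi).
apply: (@lebesgue_measure_unique R (pushforward leb phi)) => //= _ [[a b]] _ <-.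
have -> : pushforward leb phi `]a, b] = leb `](a - h)%R, (b - h)%R].
  rewrite /pushforward; congr (_ _); apply/seteqP; split => x /=;
  by rewrite !in_itv/= lerBrDr ltrBlDr.
by rewrite !lebesgue_measure_itv/= !lte_fin ltrD2r -!EFinB; case: ifP => // _; congr EFin; ring.
Qed.

Lemma ge0_integral_shift (h : R) (f : R -> \bar R) :
  measurable_fun (setT : set B) f -> (forall x, 0 <= f x) ->
  \int[leb]_x f (x + h)%R = \int[leb]_x f x.
Proof.
move=> mf f0.
rewrite -[LHS]/(\int[leb]_(x in (fun x : B => (x + h)%R : B) @^-1` setT)
  (f \o (fun x : B => (x + h)%R : B)) x).
rewrite -(@ge0_integral_pushforward _ _ B B R _ (measurable_shift h) leb setT f)//.
apply: eq_measure_integral; first exact: measurable_shift.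
by move=> ? A mA _; exact: (lebesgue_measure_shift h mA).
Qed.

Lemma ge0_integral_shift_itv (h a b : R) (f : R -> \bar R) :
  measurable_fun (setT : set B) f -> (forall x, 0 <= f x) ->
  \int[leb]_(x in `[a, b[) f (x + h)%R = \int[leb]_(x in `[(a + h)%R, (b + h)%R[) f x.
Proof.
move=> mf f0; rewrite integral_mkcond [RHS]integral_mkcond -[RHS](ge0_integral_shift h).
- apply: eq_integral => x _; rewrite !patchE !mem_setE /= !in_itv/=.
  by rewrite lerD2r ltrD2r.
- apply/(measurable_restrictT _ _).1 => //; exact: measurable_funS mf.
- by move=> x; apply: erestrict_ge0.
Qed.

(** By periodicity h may be taken in [0, 1[; the part of [h, 1 + h[ beyond
    1 is then translated back to [0, h[. *)
Lemma ge0_integral_periodic (h : R) (f : R -> \bar R) :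
  measurable_fun (setT : set B) f -> (forall x, 0 <= f x) ->
  (forall x, f (x + 1)%R = f x) ->
  \int[leb]_(x in `[0%R, 1%R]) f (x + h)%R = \int[leb]_(x in `[0%R, 1%R]) f x.
Proof.
move=> mf f0 fper.
have fperz (n : int) x : f (x + n%:~R)%R = f x.
  have fpern (m : nat) y : f (y + m%:R)%R = f y.
    elim: m y => [|m IH] y; first by rewrite addr0.
    by rewrite -natr1 addrA fper IH.
  case: n => n; first exact: fpern.
  by rewrite NegzE -{2}(subrK n.+1%:R x) fpern mulrNz.
have [r r01 hr] : exists2 r, (0 <= r < 1)%R & forall x, f (x + h)%R = f (x + r)%R.
  exists (h - (Num.floor h)%:~R)%R.
    by rewrite subr_ge0 floor_le_tmp ltrBlDl -intrD1 lt_succ_floor.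
  by move=> x; rewrite addrA -mulrNz fperz.
move: r01 => /andP[r0 r1].
under eq_integral do rewrite hr.
have mitv (a b : R) : measurable_fun (`[a, b[ : set B) f by exact: measurable_funS mf.
have mfr : measurable_fun (setT : set B) (fun x => f (x + r)%R).
  by apply: measurableT_comp => //; exact: measurable_shift.
rewrite -!integral_itv_bndo_bndc; last 2 first.
- exact: measurable_funS mf.
- exact: measurable_funS mfr.
rewrite ge0_integral_shift_itv// add0r.
have U (a b c : R) : (a <= b <= c)%R ->
  \int[leb]_(x in `[a, c[) f x = \int[leb]_(x in `[a, b[) f x + \int[leb]_(x in `[b, c[) f x.
  move=> abc; rewrite -ge0_integral_setU//=.
  - congr (integral _ _ _); apply/seteqP; split => x /=; rewrite !in_itv/=.
    + by move=> /andP[ax xc]; case: (ltP x b) => bx; [left; rewrite ax|right; rewrite xc].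
    + move: abc => /andP[ab bc] [] /andP[h1 h2]; apply/andP; split => //.
      * exact: lt_le_trans bc.
      * exact: le_trans h1.
  - exact: measurable_funS mf.
  - apply/disj_set2P/seteqP; split => // x [] /=; rewrite !in_itv/= => /andP[_ xb] /andP[bx _].
    by move: (lt_le_trans xb bx); rewrite ltxx.
rewrite (U r 1%R (1 + r)%R) ?(ltW r1) ?lerDl//.
rewrite (U 0%R r 1%R) ?r0 ?(ltW r1)//.
rewrite addeC; congr (_ + _).
transitivity (\int[leb]_(x in `[(0 + 1)%R, (r + 1)%R[) f x).
  by rewrite add0r addrC.
rewrite -ge0_integral_shift_itv//.
by apply: eq_integral => x _; exact: fper.
Qed.

(** Iterated integrals reduce translation invariance on the cube to the
    invariance in each coordinate. *)
Lemma ge0_integral_cube (f : B * B * B -> \bar R) :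
  measurable_fun setT f -> (forall x, 0 <= f x) ->
  \int[leb3]_(x in cube) f x =
  \int[leb]_(c in `[0%R, 1%R]) \int[leb]_(b in `[0%R, 1%R])
    \int[leb]_(a in `[0%R, 1%R]) f (a, b, c).
Proof.
move=> mf f0.
have m01 : measurable (`[0%R, 1%R] : set B) by exact: measurable_itv.
rewrite /leb3 /cube tonelli_setX2//; last exact: measurableX.
apply: eq_integral => c _; rewrite /leb2 tonelli_setX2//.
by apply: measurableT_comp => //; exact: measurable_pair2.
Qed.

Lemma ge0_integral_cube_shift (h : R3) (f : B * B * B -> \bar R) :
  measurable_fun setT f -> (forall x, 0 <= f x) ->
  (forall a b c, [/\ f ((a + 1)%R, b, c) = f (a, b, c),
     f (a, (b + 1)%R, c) = f (a, b, c) & f (a, b, (c + 1)%R) = f (a, b, c)]) ->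
  \int[leb3]_(x in cube) f (x + h)%R = \int[leb3]_(x in cube) f x.
Proof.
move: h => [[h1 h2] h3] mf f0 fper.
have m01 : measurable (`[0%R, 1%R] : set B) by exact: measurable_itv.
have msh : measurable_fun (setT : set (B * B * B))
    (fun x => ((x.1.1 + h1)%R, (x.1.2 + h2)%R, (x.2 + h3)%R) : B * B * B).
  by apply: measurable_fun_pair => /=; [apply: measurable_fun_pair|] => /=;
    apply: measurable_funD => //; do ?apply: measurableT_comp => //.
rewrite -[LHS]/(\int[leb3]_(x in cube)
  (f \o (fun x => ((x.1.1 + h1)%R, (x.1.2 + h2)%R, (x.2 + h3)%R) : B * B * B)) x).
rewrite (ge0_integral_cube (measurableT_comp mf msh))//; last by move=> x; exact: f0.
rewrite [RHS](ge0_integral_cube mf f0).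
have mf1 b c : measurable_fun setT (fun a : B => f (a, b, c)).
  by apply: measurableT_comp => //; apply: measurable_fun_pair.
have mf2 c : measurable_fun setT (fun ab : B * B => f (ab, c)).
  by apply: measurableT_comp => //; exact: measurable_fun_pair.
have mf3 c : measurable_fun setT (fun b : B =>
    \int[leb]_(a in `[0%R, 1%R]) f (a, b, c)).
  exact: (measurable_tonelli2 leb m01 (mf2 c)).

have mf4 : measurable_fun setT (fun c : B => \int[leb]_(b in `[0%R, 1%R])
    \int[leb]_(a in `[0%R, 1%R]) f (a, b, c)).
  have -> : (fun c => \int[leb]_(b in `[0%R, 1%R])
      \int[leb]_(a in `[0%R, 1%R]) f (a, b, c)%R) =
      (fun c => \int[leb2]_(ab in `[0%R, 1%R] `*` `[0%R, 1%R]) f (ab, c)).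
    by apply/funext => c; rewrite /leb2 tonelli_setX2.
  exact: (measurable_tonelli2 leb2 (measurableX m01 m01) mf).
have E1 b c : \int[leb]_(a in `[0%R, 1%R]) f ((a + h1)%R, b, c) =
    \int[leb]_(a in `[0%R, 1%R]) f (a, b, c).
  by apply: (ge0_integral_periodic h1 (mf1 b c)) => // a; have [] := fper a b c.
have E2 c : \int[leb]_(b in `[0%R, 1%R]) \int[leb]_(a in `[0%R, 1%R])
      f (a, (b + h2)%R, c) =
    \int[leb]_(b in `[0%R, 1%R]) \int[leb]_(a in `[0%R, 1%R]) f (a, b, c).
  apply: (ge0_integral_periodic h2 (mf3 c)) => b; first exact: integral_ge0.
  by apply: eq_integral => a _; have [] := fper a b c.
transitivity (\int[leb]_(c in `[0%R, 1%R]) \int[leb]_(b in `[0%R, 1%R])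
    \int[leb]_(a in `[0%R, 1%R]) f (a, b, c + h3)%R).
  apply: eq_integral => c _; rewrite -[RHS]E2.
  by apply: eq_integral => b _; exact: (E1 (b + h2)%R (c + h3)%R).
apply: (ge0_integral_periodic h3 mf4) => c.
  by apply: integral_ge0 => b _; exact: integral_ge0.
by apply: eq_integral => b _; apply: eq_integral => a _; have [] := fper a b c.
Qed.

End Translation.

(** * The L^4 norm over the space-time cylinder *)

Section Nikolskii.
Context {R : realType}.
Local Notation B := (measurableTypeR R).
Local Notation R3 := (R * R * R)%type.
Local Notation R4 := (R * R * R * R)%type.
Local Notation leb := (@lebesgue_measure R).

(** Measurability on all of R^4; a function on the cylinder is brought to this
    case by setting it to 0 at the other times, see [time_cut]. *)
Definition meas4 (f : R4 -> R) := measurable_fun (setT : set (B * B * B * B)) f.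

Definition space_shift (h : R3) (f : R4 -> R) : R4 -> R := fun q => f (q.1 + h, q.2).

Lemma measurable_cube : measurable (cube : set (B * B * B)).
Proof. by apply: measurableX; [apply: measurableX|]; exact: measurable_itv. Qed.

Lemma measurable_cylinder (T : R) : measurable (cylinder T : set (B * B * B * B)).
Proof. by apply: measurableX; [exact: measurable_cube|exact: measurable_itv]. Qed.

Lemma meas4_comp (f : R4 -> R) d (X : measurableType d) (phi : X -> R4) :
  meas4 f -> measurable_fun setT (phi : X -> B * B * B * B) ->
  measurable_fun setT (fun x => f (phi x)).
Proof. by move=> mf mphi; apply: (measurableT_comp mf mphi). Qed.

Lemma measurable_space_shift (h : R3) :
  measurable_fun setT ((fun q => (q.1 + h, q.2)) : B * B * B * B -> B * B * B * B).
Proof.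
case: h => [[h1 h2] h3].
apply: (@eq_measurable_fun _ _ _ _ _ (fun q : B * B * B * B =>
  (q.1.1.1 + h1, q.1.1.2 + h2, q.1.2 + h3, q.2) : B * B * B * B)) => //.
by apply: measurable_fun_pair; [apply: measurable_fun_pair;
    [apply: measurable_fun_pair|]|] => //=;
  apply: measurable_funD => //; do ?apply: measurableT_comp => //.
Qed.

Lemma meas4_shift h f : meas4 f -> meas4 (space_shift h f).
Proof. by move=> mf; apply: (meas4_comp mf); exact: measurable_space_shift. Qed.

Lemma meas4D f g : meas4 f -> meas4 g -> meas4 (fun q => f q + g q).
Proof. exact: measurable_funD. Qed.

Lemma meas4B f g : meas4 f -> meas4 g -> meas4 (fun q => f q - g q).
Proof. exact: measurable_funB. Qed.

Lemma meas4M f g : meas4 f -> meas4 g -> meas4 (fun q => f q * g q).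
Proof. exact: measurable_funM. Qed.

Lemma meas4_inc h f : meas4 f -> meas4 (increment f h).
Proof. by move=> mf; apply: meas4B => //; exact: meas4_shift. Qed.

Lemma torusD f g : torus_function f -> torus_function g ->
  torus_function (fun q : R4 => f q + g q).
Proof.
move=> [f1 f2] [g1 g2]; split => x y z t; last by rewrite f2 g2.
by have [-> ->] := f1 x y z t; have [-> ->] := g1 x y z t.
Qed.

Lemma torus_shift h f : torus_function f -> torus_function (space_shift h f).
Proof.
move: h => [[h1 h2] h3] [f1 f2]; split=> x y z t.
  rewrite -![space_shift _ _ _]/(f (_ + h1, _ + h2, _ + h3, _)) !(addrAC _ 1).
  by have [-> ->] := f1 (x + h1) (y + h2) (z + h3) t.
rewrite -![space_shift _ _ _]/(f (_ + h1, _ + h2, _ + h3, _)) !(addrAC _ 1).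
exact: f2.
Qed.

Lemma torus_inc (h : R3) (f : R4 -> R) : torus_function f -> torus_function (increment f h).
Proof.
move=> tf; have [s1 s2] := torus_shift h tf; case: tf => [f1 f2].
split => x y z t; rewrite -![increment _ _ _]/(space_shift h f _ - f _).
  by have [-> ->] := f1 x y z t; have [-> ->] := s1 x y z t.
by rewrite f2 s2.
Qed.

Local Open Scope ereal_scope.

Lemma integral_cylinder (T : R) (f : R4 -> \bar R) :
  measurable_fun (setT : set (B * B * B * B)) f -> (forall q, 0 <= f q) ->
  \int[leb4]_(q in cylinder T) f q =
  \int[leb]_(t in `]0%R, T[) \int[leb3]_(x in cube) f (x, t).
Proof.
move=> mf f0; rewrite /leb4 /cylinder tonelli_setX2//.
exact: measurable_cube.
Qed.

(** Each time slice is a function on the torus, whose integral is invariant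
    under translations. *)
Lemma integral_cylinder_shift (T : R) (h : R3) (f : R4 -> R) (g : R -> \bar R) :
  meas4 f -> torus_function f ->
  measurable_fun (setT : set B) g -> (forall x, 0 <= g x) ->
  \int[leb4]_(q in cylinder T) g (space_shift h f q) =
  \int[leb4]_(q in cylinder T) g (f q).
Proof.
move=> mf [f1 f2] mg g0.
have mgf : measurable_fun (setT : set (B * B * B * B)) (g \o f).
  exact: measurableT_comp.
have mgs : measurable_fun (setT : set (B * B * B * B)) (g \o space_shift h f).
  by apply: measurableT_comp => //; exact: meas4_shift.
have -> := integral_cylinder T mgs (fun q => g0 _).
have -> := integral_cylinder T mgf (fun q => g0 _).
apply: eq_integral => t _.
apply: (ge0_integral_cube_shift h (f := fun x => g (f (x, t)))) => //.
  by apply: (measurableT_comp mgf); exact: measurable_pair2.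
by move=> a b c; have [-> ->] := f1 a b c t; rewrite f2.
Qed.

Definition norm4 (T : R) (f : R4 -> R) : \bar R := cylinder_norm T 4%:E f.

Lemma Lnorm4_pow d (X : measurableType d) (mu : {measure set X -> \bar R})
    (D : set X) (f : X -> R) :
  'N[mu]_4%:E[(EFin \o f) \_ D] `^ 4 = \int[mu]_(x in D) ((f x) ^+ 4)%:E.
Proof.
rewrite poweR_Lnorm ?pnatr_eq0// [RHS]integral_mkcond; apply: eq_integral => x _.
rewrite !patchE; case: ifP => _ /=; last by rewrite normr0 powR0// pnatr_eq0.
by rewrite powR_mulrn// -normrX ger0_norm// exprn_even_ge0.
Qed.

Lemma norm4_pow T f : norm4 T f `^ 4 = \int[leb4]_(q in cylinder T) ((f q) ^+ 4)%:E.
Proof. exact: Lnorm4_pow. Qed.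

Lemma norm4_ge0 T f : 0 <= norm4 T f.
Proof. exact: Lnorm_ge0. Qed.

Let meas_patch T f : meas4 f ->
  measurable_fun (setT : set (B * B * B * B)) (f \_ (cylinder T)).
Proof.
move=> mf; apply/(measurable_restrictT _ _).1; first exact: measurable_cylinder.
exact: measurable_funS mf.
Qed.

Lemma norm4D T f g : meas4 f -> meas4 g ->
  norm4 T (fun q => f q + g q)%R <= norm4 T f + norm4 T g.
Proof.
move=> mf mg; rewrite /norm4 /cylinder_norm !restrict_EFin.
have -> : (fun q => (f q + g q)%R) \_ (cylinder T) =
    ((f \_ (cylinder T)) \+ (g \_ (cylinder T)))%R.
  apply/funext => q; rewrite /= !patchE; case: ifP => // _; by rewrite addr0.
by apply: (minkowski_EFin leb4 (meas_patch T mf) (meas_patch T mg)); rewrite ler1n.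
Qed.

Lemma norm4_shift T h f : meas4 f -> torus_function f ->
  norm4 T (space_shift h f) = norm4 T f.
Proof.
move=> mf tf; rewrite /norm4 /cylinder_norm unlock; congr (_ `^ _).
have E k : meas4 k -> \int[leb4]_x `|((EFin \o k) \_ (cylinder T)) x| `^ 4 =
    \int[leb4]_(q in cylinder T) ((fun x => (x ^+ 4)%:E) (k q)).
  move=> mk; rewrite [RHS]integral_mkcond; apply: eq_integral => q _.
  rewrite !patchE; case: ifP => _ /=; last by rewrite normr0 powR0// pnatr_eq0.
  by rewrite powR_mulrn// -normrX ger0_norm// exprn_even_ge0.
rewrite !E//; last exact: meas4_shift.
apply: (integral_cylinder_shift T h (g := fun x => (x ^+ 4)%:E)) => //.
- by apply/measurable_EFinP; exact: measurable_funX.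
- by move=> x; rewrite lee_fin exprn_even_ge0.
Qed.

Lemma norm4N T f : norm4 T (fun q => - f q)%R = norm4 T f.
Proof.
rewrite /norm4 /cylinder_norm unlock; congr (_ `^ _); apply: eq_integral => q _.
by rewrite !patchE; case: ifP => //= _; rewrite normrN.
Qed.

Lemma norm4_inc T h f : meas4 f -> torus_function f ->
  norm4 T (increment f h) <= 2%:E * norm4 T f.
Proof.
move=> mf tf; rewrite mule_natl mule2n.
apply: le_trans (norm4D T (meas4_shift h mf) (g := fun q => (- f q)%R) _) _.
  exact: measurable_funN.
by rewrite norm4N norm4_shift.
Qed.

Lemma norm4_double T f : meas4 f -> norm4 T (fun q => f q + f q)%R = 2%:E * norm4 T f.
Proof.
move=> mf; rewrite /norm4 /cylinder_norm unlock.
rewrite [X in X `^ _ = _](_ : _ = (2 ^+ 4)%:E * \int[leb4]_x `|((EFin \o f) \_ (cylinder T)) x| `^ 4).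
  rewrite poweRM ?lee_fin ?exprn_ge0//; last by apply: integral_ge0 => *; exact: poweR_ge0.
  congr (_ * _); rewrite poweR_EFin -powR_mulrn// -powRrM mulfV ?pnatr_eq0// powRr1//.
rewrite -ge0_integralZl_EFin//.
- apply: eq_integral => q _; rewrite !patchE; case: ifP => //= _.
  + rewrite -EFinM !powR_mulrn// -exprMn (_ : f q + f q = 2 * f q)%R; last by ring.
    by rewrite normrM gtr0_norm.
  + by rewrite normr0 powR0 ?pnatr_eq0// mule0.
- by move=> *; exact: poweR_ge0.
- apply: (measurableT_comp (measurable_poweR _)) => //.
  apply: measurableT_comp => //; rewrite restrict_EFin.
  by apply/measurable_EFinP; exact: meas_patch.
Qed.
End Nikolskii.

(** * Marchaud's inequality *)

Section Marchaud.
Context {R : realType}.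
Local Notation R3 := (R * R * R)%type.
Local Notation R4 := (R * R * R * R)%type.

Implicit Types (h : R3) (f g : R4 -> R).

(** The m-th difference, written with [increment] to act on functions of
    space and time. *)
Definition diffn (m : nat) h f : R4 -> R := iter m (fun g => increment g h) f.

Definition shift_add h f : R4 -> R := fun q => space_shift h f q + f q.

Lemma meas4_diffn m h f : meas4 f -> meas4 (diffn m h f).
Proof. by move=> mf; elim: m => //= m IH; exact: meas4_inc. Qed.

Lemma torus_diffn m h f : torus_function f -> torus_function (diffn m h f).
Proof. by move=> mf; elim: m => //= m IH; exact: torus_inc. Qed.

Lemma meas4_shift_add h f : meas4 f -> meas4 (shift_add h f).
Proof. by move=> mf; apply: meas4D => //; exact: meas4_shift. Qed.

Lemma torus_shift_add h f : torus_function f -> torus_function (shift_add h f).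
Proof. by move=> mf; apply: torusD => //; exact: torus_shift. Qed.

(** With S the translation by h, this is Delta_(2h) = (S + 1) Delta_h, that is
    S^2 - 1 = (S + 1) (S - 1). *)
Lemma increment_double h f :
  increment f (h + h) = shift_add h (increment f h).
Proof.
apply/funext => q; rewrite /increment /shift_add /space_shift /increment /= addrA.
by rewrite addrA subrK.
Qed.

Lemma increment_shift_add h f :
  increment (shift_add h f) h = shift_add h (increment f h).
Proof.
apply/funext => q; rewrite /increment /shift_add /space_shift /increment /=.
by ring.
Qed.

Lemma increment_shift_addn m h f :
  increment (iter m (shift_add h) f) h = iter m (shift_add h) (increment f h).
Proof. by elim: m => //= m IH; rewrite increment_shift_add IH. Qed.

Lemma diffn_double m h f :
  diffn m (h + h) f = iter m (shift_add h) (diffn m h f).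
Proof.
elim: m => //= m IH; rewrite increment_double IH -/(diffn m h f).
by rewrite increment_shift_addn.
Qed.

Local Open Scope ereal_scope.

(** From (S + 1)^m - 2^m = (S - 1) Q (S), where the polynomial Q has
    nonnegative coefficients of sum m 2^(m-1), and ||S|| = 1.  With f an m-th
    difference, (S + 1)^m f is an m-th difference of step 2h by
    [diffn_double]. *)
Lemma norm4_shift_addn T m h f : meas4 f -> torus_function f ->
  (2 ^+ m)%:E * norm4 T f <= norm4 T (iter m (shift_add h) f) +
    (m%:R * 2 ^+ m.-1)%:E * norm4 T (increment f h).
Proof.
elim: m f => [|m IH] f mf tf.
  by rewrite expr0 mul1e /= mul0r mul0e adde0.
have mi := meas4_inc h mf; have ti := torus_inc h tf.
have ms := meas4_shift_add h mf; have ts := torus_shift_add h tf.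
rewrite (_ : (2 ^+ m.+1)%:E = (2 ^+ m)%:E * 2%:E); last by rewrite -EFinM exprSr.
rewrite -muleA -norm4_double//.
have dbl : norm4 T (fun q => f q + f q)%R <=
    norm4 T (shift_add h f) + norm4 T (increment f h).
  rewrite -(norm4N T (increment f h)).
  have -> : (fun q => f q + f q)%R =
      (fun q => shift_add h f q + - increment f h q)%R.
    by apply/funext => q; rewrite /shift_add /increment /space_shift /=; ring.
  by apply: norm4D => //; exact: measurable_funN.
apply: (le_trans (lee_wpmul2l _ dbl)); first by rewrite lee_fin exprn_ge0.
rewrite ge0_muleDr ?norm4_ge0//.
apply: (le_trans (leeD2r _ (IH _ ms ts))).
rewrite -iterSr -addeA; apply: leeD2l; rewrite increment_shift_add.
have H : norm4 T (shift_add h (increment f h)) <= 2%:E * norm4 T (increment f h).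
  rewrite mule_natl mule2n; apply: le_trans (norm4D T (meas4_shift h mi) mi) _.
  by rewrite norm4_shift.
have c0 : 0%R <= (m%:R * 2 ^+ m.-1)%:E :> \bar R.
  by rewrite lee_fin mulr_ge0 ?exprn_ge0.
apply: (le_trans (leeD2r _ (lee_wpmul2l c0 H))).
rewrite muleA -EFinM -ge0_muleDl ?lee_fin ?mulr_ge0 ?exprn_ge0//.
apply: lee_wpmul2r; first exact: norm4_ge0.
rewrite -EFinD lee_fin; case: m {IH c0} => [|m] /=.
  by rewrite mul0r mul0r add0r expr0 mulr1.
by rewrite exprS -[m.+2%:R]natr1; lra.
Qed.

Local Close Scope ereal_scope.

Lemma enorm_ge0 h : 0 <= enorm h.
Proof. exact: sqrtr_ge0. Qed.

Lemma enorm_gt0 h : h != 0 -> 0 < enorm h.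
Proof.
move=> h0; rewrite sqrtr_gt0 lt_neqAle eq_sym.
have H : 0 <= h.1.1 ^+ 2 + h.1.2 ^+ 2 + h.2 ^+ 2.
  by rewrite !addr_ge0 ?sqr_ge0.
rewrite H andbT; apply: contra h0.
rewrite !paddr_eq0 ?addr_ge0 ?sqr_ge0// !sqrf_eq0.
by case: h {H} => [[a b] c] /= /andP[/andP[/eqP-> /eqP->] /eqP->].
Qed.

Lemma enorm_double h : enorm (h + h) = 2 * enorm h.
Proof.
have -> : 2 = Num.sqrt (2 ^+ 2) :> R by rewrite sqrtr_sqr gtr0_norm.
rewrite /enorm -sqrtrM ?sqr_ge0//; congr Num.sqrt => /=; ring.
Qed.

(** Dyadic induction.  If |h| >= 1 the trivial bound F suffices.  Otherwise
    the inequality bounds a at h by 2^-m times a at 2h, up to the contribution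
    of b; the power |2h|^s is 2^s |h|^s, and the loss 2^s is beaten by the
    gain 2^m since s < 1 <= m.  The constant K' is such that the two
    contributions add up to K' |h|^s. *)
Lemma marchaud_iteration (a b : R3 -> R) (m : nat) (s F K : R) :
  (0 < m)%N -> 0 < s < 1 -> 0 <= F -> 0 <= K ->
  (forall h, 0 <= a h <= F) ->
  (forall h, h != 0 -> b h <= K * enorm h `^ s) ->
  (forall h, 2 ^+ m * a h <= a (h + h) + m%:R * 2 ^+ m.-1 * b h) ->
  exists2 K', 0 <= K' & forall h, h != 0 -> a h <= K' * enorm h `^ s.
Proof.
case: m => // m _ /andP[s0 s1] F0 K0 aF bK ab /=.
pose c : R := 2 `^ s.
have c2 : c < 2.
  by rewrite /c /powR gt_eqF// -[ltRHS]lnK ?posrE// ltr_expR gtr_pMl ?ln_gt0 ?ltr1n.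
have c0 : 0 <= c by exact: powR_ge0.
pose K' := F + m.+1%:R * K / (2 - c).
have mK0 : 0 <= m.+1%:R * K by rewrite mulr_ge0.
have K'F : F <= K' by rewrite lerDl divr_ge0// subr_ge0 ltW.
have K'0 : 0 <= K' by exact: le_trans K'F.
have K'K : m.+1%:R * K <= K' * (2 - c).
  rewrite /K' mulrDl divfK ?gt_eqF ?subr_gt0// lerDr mulr_ge0// subr_ge0 ltW//.
exists K' => //.
(* k counts the doublings of h that bring it to norm at least 1 *)
suff H (k : nat) : forall h, h != 0 -> 1 <= 2 ^+ k * enorm h -> a h <= K' * enorm h `^ s.
  move=> h h0; have e0 := enorm_gt0 h0.
  apply: (H (Num.bound (enorm h)^-1)) => //.
  rewrite -ler_pdivrMr// div1r; apply: le_trans (ltW (archi_boundP _)) _.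
    by rewrite invr_ge0 ltW.
  by rewrite -natrX ler_nat ltnW// ltn_expl.
elim: k => [|k IH] h h0.
  rewrite expr0 mul1r => h1; have /andP[_ aFh] := aF h.
  apply: (le_trans aFh); apply: (le_trans K'F); rewrite ler_peMr//.
  have <- : 1 `^ s = 1 :> R by rewrite powR1.
  by rewrite ge0_ler_powR ?nnegrE ?enorm_ge0// ltW.
rewrite exprSr -mulrA -enorm_double => hk.
have hh0 : h + h != 0.
  apply: contra h0 => /eqP hh; case: h {hk} hh => [[x y] z] [] hx hy hz.
  by apply/eqP; congr (_, _, _); lra.
have := IH _ hh0 hk; rewrite enorm_double powRM ?enorm_ge0// -/c => IH'.
have := bK _ h0; have := ab h; set e := enorm h `^ s in IH' *.
have e0 : 0 <= e by exact: powR_ge0.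
rewrite exprS/=; set P : R := 2 ^+ m.
have P1 : 1 <= P by rewrite exprn_ege1// ler1n.
move: (a h) (a (h + h)) IH' (b h) => x y xy z xyz ze.
have P0 : 0 < P by lra.
rewrite -(ler_pM2l (mulr_gt0 _ P0 : 0 < 2 * P))//.
apply: (le_trans xyz).
have A1 : m.+1%:R * P * z <= m.+1%:R * P * (K * e).
  by rewrite ler_wpM2l// mulr_ge0// ltW.
have A2 : m.+1%:R * K * (P * e) <= K' * (2 - c) * (P * e).
  by rewrite ler_wpM2r// mulr_ge0// ltW.
have A3 : K' * c * e <= P * (K' * c * e) by rewrite ler_peMl// !mulr_ge0.
have : 0 <= e by [].
nra.
Qed.
End Marchaud.

(** * From Besov regularity to fourth moments of first differences *)

Section NikolskiiBound.
Context {R : realType}.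
Local Notation B := (measurableTypeR R).
Local Notation R3 := (R * R * R)%type.
Local Notation R4 := (R * R * R * R)%type.
Local Notation leb := (@lebesgue_measure R).

Implicit Types (h : R3) (f g : R4 -> R).

(** Values at times outside ]0, T[ are irrelevant; putting 0 there makes the
    function measurable on all of R^4. *)
Definition time_cut (T : R) f : R4 -> R := f \_ ([set: R3] `*` `]0, T[).

Lemma time_cutE T f q : 0 < q.2 < T -> time_cut T f q = f q.
Proof.
by move=> qT; rewrite /time_cut patchE mem_set//; split => //=; rewrite in_itv.
Qed.

Lemma meas4_time_cut T f : measurable_on T f -> meas4 (time_cut T f).
Proof.
move=> mf; apply/(measurable_restrictT _ _).1 => //.
exact: measurableX.
Qed.

Lemma torus_time_cut T f : torus_function f -> torus_function (time_cut T f).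
Proof.
have E a b c a' b' c' t : f (a, b, c, t) = f (a', b', c', t) ->
    time_cut T f (a, b, c, t) = time_cut T f (a', b', c', t).
  move=> e; rewrite /time_cut !patchE e.
  case: (pselect (`]0, T[%classic t)) => tT; first by rewrite !mem_set.
  by rewrite !memNset// => -[].
move=> [f1 f2]; split => x y z t; last exact/E.
by have [h1 h2] := f1 x y z t; split; exact: E.
Qed.

Lemma slice_diffn m h f t : slice (diffn m h f) t = iter m (finite_difference h) (slice f t).
Proof. by elim: m => //= m <-; apply/funext => x. Qed.

Local Open Scope ereal_scope.

Lemma le_poweR (x y : \bar R) (r : R) : (0 <= r)%R -> 0 <= x -> x <= y ->
  x `^ r <= y `^ r.
Proof.
move=> r0 x0 xy; apply: gt0_ler_poweR => //.
- by rewrite in_itv/= x0 leey.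
- by rewrite in_itv/= leey (le_trans x0).
Qed.

Lemma norm4_diffn T m h f : meas4 f -> torus_function f ->
  norm4 T (diffn m h f) <= (2 ^+ m)%:E * norm4 T f.
Proof.
move=> mf tf; elim: m => [|m IH]; first by rewrite expr0 mul1e.
rewrite exprS EFinM -muleA; apply: le_trans (lee_wpmul2l _ IH) => //.
by apply: norm4_inc; [exact: meas4_diffn|exact: torus_diffn].
Qed.

Lemma besov_seminorm_ge0 (a : R) (g : R3 -> R) :
  0 <= ereal_sup [set (enorm h `^ (- a))%R%:E *
                  torus_norm 4%:E (iter (Num.truncn a).+1 (finite_difference h) g)
             | h in [set h : R3 | h != 0%R]].
Proof.
pose h1 : R3 := (1%R, 0%R, 0%R).
have h10 : h1 != 0%R by apply/eqP => -[]; apply/eqP; rewrite oner_eq0.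
apply: le_trans (ereal_sup_ubound _); last by exists h1; [exact: h10|reflexivity].
by apply: mule_ge0; [rewrite lee_fin powR_ge0|exact: Lnorm_ge0].
Qed.

Lemma besov_norm_ge0 (a : R) (g : R3 -> R) : 0 <= besov_norm a 4%:E g.
Proof. by apply: adde_ge0; [exact: Lnorm_ge0|exact: besov_seminorm_ge0]. Qed.

Lemma besov_bochner_finite T a f :
  bochner_norm T 4%:E (besov_norm a 4%:E) f < +oo ->
  \int[leb]_(t in `]0%R, T[) (besov_norm a 4%:E (slice f t)) `^ 4 < +oo.
Proof.
rewrite /bochner_norm => /(poweR_lty 4).
rewrite poweR_Lnorm ?pnatr_eq0// [in X in _ -> X]integral_mkcond.
congr (_ < _); apply: eq_integral => t _; rewrite !patchE; case: ifP => _.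
  by rewrite gee0_abs// besov_norm_ge0.
by rewrite abse0 poweR0r// pnatr_eq0.
Qed.

Lemma torus_norm4_pow (g : R3 -> R) :
  (torus_norm 4%:E g) `^ 4 = \int[leb3]_(x in cube) ((g x) ^+ 4)%:E.
Proof. exact: Lnorm4_pow. Qed.

(** The fourth powers of both norms are integrals over time of the norms of the
    slices, which the Besov norm dominates slice by slice. *)
Lemma besov_diffn T a f : measurable_on T f -> torus_function f ->
  bochner_norm T 4%:E (besov_norm a 4%:E) f < +oo ->
  exists2 K : R, (0 <= K)%R &
    [/\ norm4 T (time_cut T f) <= K%:E &
    forall h, h != 0%R ->
      norm4 T (diffn (Num.truncn a).+1 h (time_cut T f)) <= (K * enorm h `^ a)%:E].
Proof.
move=> mf tf /besov_bochner_finite; set J := integral _ _ _ => Joo.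
have J0 : 0 <= J by apply: integral_ge0 => t _; exact: poweR_ge0.
have Jfin : J \is a fin_num by rewrite ge0_fin_numE.
exists (fine J `^ 4^-1)%R; first exact: powR_ge0.
have mc := meas4_time_cut mf; have tc := torus_time_cut T tf.
have pow4_meas g : meas4 g ->
    measurable_fun (setT : set (B * B * B * B)) (fun q => ((g q) ^+ 4)%:E).
  by move=> mg; apply/measurable_EFinP; exact: measurable_funX.
have pow4_ge0 g (q : R4) : 0 <= ((g q) ^+ 4)%:E :> \bar R.
  by rewrite lee_fin exprn_even_ge0.
have root g (c : R) : (0 <= c)%R -> \int[leb4]_(q in cylinder T) ((g q) ^+ 4)%:E <= c%:E ->
    norm4 T g <= (c `^ 4^-1)%:E.
  move=> c0; rewrite -norm4_pow => H.
  have -> : norm4 T g = (norm4 T g `^ 4) `^ 4^-1.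
    by rewrite -poweRrM mulfV ?pnatr_eq0// poweRe1// norm4_ge0.
  by rewrite -poweR_EFin; apply: le_poweR => //; exact: poweR_ge0.
have slice_cut t : (`]0%R, T[%classic : set R) t -> slice (time_cut T f) t = slice f t.
  by rewrite /= in_itv/= => tT; apply/funext => x; rewrite /slice time_cutE.
split.
  apply: root; first exact: fine_ge0.
  rewrite fineK// integral_cylinder//; last exact: pow4_meas.
  apply: ge0_le_integral_any => t tT; first exact: integral_ge0.
  under eq_integral do rewrite -[time_cut T f (_, t)]/(slice (time_cut T f) t _) slice_cut//.
  rewrite -torus_norm4_pow; apply: le_poweR => //; first exact: Lnorm_ge0.
  by apply: leeDl; exact: besov_seminorm_ge0.
move=> h h0; have e0 := enorm_gt0 h0.
have -> : (fine J `^ 4^-1 * enorm h `^ a = (fine J * (enorm h `^ a) ^+ 4) `^ 4^-1)%R.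
  rewrite powRM ?fine_ge0 ?exprn_ge0 ?powR_ge0//; congr (_ * _)%R.
  by rewrite -powR_mulrn ?powR_ge0// -powRrM mulfV ?pnatr_eq0// powRr1 ?powR_ge0.
apply: root; first by rewrite mulr_ge0 ?fine_ge0 ?exprn_ge0 ?powR_ge0.
have me := meas4_diffn (Num.truncn a).+1 h mc.
have c0 : (0 <= (enorm h `^ (- a)) ^+ 4)%R by rewrite exprn_ge0 ?powR_ge0.
suff H : ((enorm h `^ (- a)) ^+ 4)%:E * \int[leb4]_(q in cylinder T)
    ((diffn (Num.truncn a).+1 h (time_cut T f) q) ^+ 4)%:E <= J.
  have p0 : (0 < enorm h `^ a ^+ 4)%R by rewrite exprn_gt0 ?powR_gt0.
  rewrite mulrC EFinM fineK// -lee_pdivrMl//; congr (_ <= _): H.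
  by rewrite powRN exprVn.
rewrite integral_cylinder//; last exact: pow4_meas.
rewrite -ge0_integralZl_EFin//; last 2 first.
- by move=> t _; exact: integral_ge0.
- apply: measurable_funTS.
  exact: (measurable_tonelli2 leb3 measurable_cube (pow4_meas _ me)).
apply: ge0_le_integral_any => t tT.
  by rewrite mule_ge0// integral_ge0.
under eq_integral do rewrite -[diffn _ _ _ (_, t)]/(slice (diffn _ _ _) t _)
  slice_diffn slice_cut//.
rewrite -torus_norm4_pow.
rewrite -powR_mulrn ?powR_ge0// -poweR_EFin -poweRM ?lee_fin ?powR_ge0 ?Lnorm_ge0//.
apply: le_poweR => //; first by rewrite mule_ge0 ?lee_fin ?powR_ge0// Lnorm_ge0.
apply: le_trans (leeDr _ _); last exact: Lnorm_ge0.
by apply: ereal_sup_ubound; exists h.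
Qed.
(** Marchaud's inequality keeps the exponent only when it is less than 1, and
    any exponent in ]1/2, 1[ serves the purpose. *)
Definition nik_exp (a : R) : R := Num.min a (3 / 4)%R.

(** For |h| <= 1 the exponent is lowered from a to s by monotonicity, for
    |h| > 1 the norm of the function is enough; the order of the difference is
    then reduced one unit at a time by [marchaud_iteration]. *)
Lemma nikolskii_norm4 T a f : (2^-1 < a)%R -> measurable_on T f -> torus_function f ->
  bochner_norm T 4%:E (besov_norm a 4%:E) f < +oo ->
  exists2 K : R, (0 <= K)%R &
    norm4 T (time_cut T f) <= K%:E /\
    forall h, h != 0%R ->
      norm4 T (increment (time_cut T f) h) <= (K * enorm h `^ (nik_exp a))%:E.
Proof.
move=> a2 mf tf /(besov_diffn mf tf)[K K0 [fK dK]].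
have mc := meas4_time_cut mf; have tc := torus_time_cut T tf.
set g := time_cut T f in fK dK mc tc *.
set s := nik_exp a.
have s01 : (0 < s < 1)%R.
  rewrite /s /nik_exp lt_min gt_min; apply/andP; split; last by apply/orP; right; lra.
  by apply/andP; split; lra.
have sa : (s <= a)%R by rewrite /s /nik_exp ge_min lexx.
pose m := Num.truncn a; pose F (k : nat) : R := (2 ^+ k * K)%R.
pose d (k : nat) h := fine (norm4 T (diffn k h g)).
have dle k h : norm4 T (diffn k h g) <= (F k)%:E.
  apply: le_trans (norm4_diffn T k h mc tc) _.
  by rewrite EFinM lee_wpmul2l// lee_fin exprn_ge0.
have dE k h : (d k h)%:E = norm4 T (diffn k h g).
  by rewrite fineK// ge0_fin_numE ?norm4_ge0// (le_lt_trans (dle k h))// ltry.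
have F0 k : (0 <= F k)%R by rewrite mulr_ge0// exprn_ge0.
(* downward induction on the order of the difference *)
suff H : forall k, (exists2 K' : R, (0 <= K')%R & forall h, h != 0%R ->
    (d k.+1 h <= K' * enorm h `^ s)%R) ->
    exists2 K' : R, (0 <= K')%R & forall h, h != 0%R -> (d 1%N h <= K' * enorm h `^ s)%R.
  have [K' K'0 dK'] : exists2 K' : R, (0 <= K')%R & forall h, h != 0%R ->
      (d 1%N h <= K' * enorm h `^ s)%R.
    apply: (H m); exists (K + F m.+1)%R; first by rewrite addr_ge0.
    move=> h h0; have e0 := enorm_gt0 h0; have [h1|h1] := leP (enorm h) 1%R.
    - rewrite -lee_fin dE; apply: le_trans (dK _ h0) _; rewrite lee_fin.
      apply: (@le_trans _ _ (K * enorm h `^ s)%R).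
        by rewrite ler_wpM2l// ger_powR// e0.
      by rewrite ler_wpM2r ?powR_ge0// lerDl.
    - rewrite -lee_fin dE; apply: le_trans (dle _ _) _; rewrite lee_fin.
      apply: (@le_trans _ _ (F m.+1 * enorm h `^ s)%R).
        rewrite ler_peMr//; have <- : (1 `^ s = 1 :> R)%R by rewrite powR1.
        by rewrite ge0_ler_powR ?nnegrE ?enorm_ge0// ltW//; case/andP: s01.
      by rewrite ler_wpM2r ?powR_ge0// lerDr.
  exists (K + K')%R; first by rewrite addr_ge0.
  split; first by apply: (le_trans fK); rewrite lee_fin lerDl.
  move=> h h0; rewrite -[increment g h]/(diffn 1 h g) -dE lee_fin.
  apply: (le_trans (dK' _ h0)); rewrite ler_wpM2r ?powR_ge0// lerDr//.
elim=> [//|k IH] [K' K'0 dK']; apply: IH.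
apply: (marchaud_iteration (a := d k.+1) (b := d k.+2) (m := k.+1) (F := F k.+1) (K := K')) => //.
- move=> h; rewrite -!lee_fin dE norm4_ge0/=; exact: (dle k.+1).
- move=> h; rewrite -lee_fin EFinM EFinD EFinM !dE diffn_double.
  exact: (norm4_shift_addn T k.+1 h (meas4_diffn _ _ mc) (torus_diffn _ _ tc)).
Qed.

Lemma nikolskii T a f : (2^-1 < a)%R -> measurable_on T f -> torus_function f ->
  bochner_norm T 4%:E (besov_norm a 4%:E) f < +oo ->
  exists2 M : R, (0 <= M)%R &
    \int[leb4]_(q in cylinder T) ((time_cut T f q) ^+ 4)%:E <= M%:E /\
    forall h, \int[leb4]_(q in cylinder T) ((increment (time_cut T f) h q) ^+ 4)%:E <=
      (M * (enorm h `^ (nik_exp a)) ^+ 4)%:E.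
Proof.
move=> a2 mf tf /(nikolskii_norm4 a2 mf tf)[K K0 [fK dK]].
have pw (x : \bar R) (c : R) : 0 <= x -> x <= c%:E -> x `^ 4 <= (c ^+ 4)%:E.
  move=> x0 xc; have c0 : (0 <= c)%R by rewrite -lee_fin (le_trans x0).
  by rewrite -powR_mulrn// -poweR_EFin; exact: le_poweR.
exists (K ^+ 4)%R; first by rewrite exprn_ge0.
split; first by rewrite -norm4_pow; apply: pw => //; exact: norm4_ge0.
move=> h; have [->|h0] := eqVneq h 0%R.
  rewrite (_ : \int[leb4]_(q in _) _ = 0).
    by rewrite lee_fin mulr_ge0// exprn_ge0// powR_ge0.
  rewrite -[RHS](integral0 leb4 (cylinder T)); apply: eq_integral => q _.
  by rewrite /increment addr0 -surjective_pairing subrr expr0n.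
rewrite -norm4_pow -exprMn; apply: pw; first exact: norm4_ge0.
exact: dK.
Qed.

End NikolskiiBound.

(** * Quadratic increments against a square integrable weight *)

Section Mixed.
Context {R : realType}.
Local Notation B := (measurableTypeR R).
Local Notation R3 := (R * R * R)%type.
Local Notation R4 := (R * R * R * R)%type.
Implicit Types (h : R3) (f g : R4 -> R).

(** Weighted Young inequality; the weight r will be the size of b^2 and c^2. *)
Lemma young2 (r a b c : R) : 0 < r ->
  `|a| * (b ^+ 2 + c ^+ 2) <= r * a ^+ 2 + r^-1 * (b ^+ 4 + c ^+ 4).
Proof.
move=> r0; have ri0 : 0 < r^-1 by rewrite invr_gt0.
rewrite -[a ^+ 2]real_normK ?num_real//; set x := `|a|.
have H y : x * y ^+ 2 <= r / 2 * x ^+ 2 + r^-1 / 2 * y ^+ 4.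
  rewrite -subr_ge0 (_ : _ - _ = r / 2 * (x - r^-1 * y ^+ 2) ^+ 2).
    by rewrite mulr_ge0 ?sqr_ge0// divr_ge0// ltW.
  by field; rewrite gt_eqF.
have := H b; have := H c.
have : 0 <= r^-1 * b ^+ 4 by rewrite mulr_ge0 ?(ltW ri0)// exprn_even_ge0.
have : 0 <= r^-1 * c ^+ 4 by rewrite mulr_ge0 ?(ltW ri0)// exprn_even_ge0.
move: (b ^+ 4) (c ^+ 4) (b ^+ 2) (c ^+ 2) => b4 c4 b2 c2; rewrite mulrDr.
lra.
Qed.

Local Open Scope ereal_scope.

Lemma Lnorm2_pow d (X : measurableType d) (mu : {measure set X -> \bar R})
    (D : set X) (f : X -> R) :
  'N[mu]_2%:E[(EFin \o f) \_ D] `^ 2 = \int[mu]_(x in D) ((f x) ^+ 2)%:E.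
Proof.
rewrite poweR_Lnorm ?pnatr_eq0// [RHS]integral_mkcond; apply: eq_integral => x _.
rewrite !patchE; case: ifP => _ /=; last by rewrite normr0 powR0// pnatr_eq0.
by rewrite powR_mulrn// real_normK ?num_real.
Qed.

Lemma cylinder_time_cut T f q : cylinder T q -> time_cut T f q = f q.
Proof. by case: q => x t [_ /=]; rewrite in_itv/= => tT; rewrite time_cutE. Qed.

Lemma cylinder_inc_cut T f h q : cylinder T q ->
  increment (time_cut T f) h q = increment f h q.
Proof.
case: q => x t [_ /=]; rewrite in_itv/= => tT.
by rewrite /increment !time_cutE.
Qed.

Lemma cylinder_L2 T f : cylinder_norm T 2%:E f < +oo ->
  exists2 W : R, (0 <= W)%R &
    \int[leb4]_(q in cylinder T) ((time_cut T f q) ^+ 2)%:E <= W%:E.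
Proof.
move=> /(poweR_lty 2); rewrite /cylinder_norm Lnorm2_pow => H.
set J := integral _ _ _ in H.
have J0 : 0 <= J by apply: integral_ge0 => q _; rewrite lee_fin sqr_ge0.
exists (fine J); first exact: fine_ge0.
rewrite fineK ?ge0_fin_numE//; rewrite le_eqVlt; apply/orP; left; apply/eqP.
apply: eq_integral => q; rewrite inE => qT.
by rewrite cylinder_time_cut.
Qed.

Lemma meas4_EFin f : meas4 f ->
  measurable_fun (setT : set (B * B * B * B)) (fun q => (f q)%:E).
Proof. by move=> mf; apply/measurable_EFinP. Qed.

Lemma meas4X n f : meas4 f -> meas4 (fun q => f q ^+ n)%R.
Proof. exact: measurable_funX. Qed.

Lemma meas4_norm f : meas4 f -> meas4 (fun q => `|f q|)%R.
Proof. by move=> mf; exact: measurableT_comp. Qed.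

(** Young's inequality with weight r = |h|^(2s): the fourth powers of the
    increments have integral O (r^2), so both terms are O (r). *)
Lemma quadratic_increment_bound T (s W M1 M2 : R) (a u v : R4 -> R) h :
  meas4 a -> meas4 u -> meas4 v ->
  (0 <= W)%R -> (0 <= M1)%R -> (0 <= M2)%R ->
  \int[leb4]_(q in cylinder T) ((a q) ^+ 2)%:E <= W%:E ->
  \int[leb4]_(q in cylinder T) ((increment u h q) ^+ 4)%:E <=
    (M1 * (enorm h `^ s) ^+ 4)%:E ->
  \int[leb4]_(q in cylinder T) ((increment v h q) ^+ 4)%:E <=
    (M2 * (enorm h `^ s) ^+ 4)%:E ->
  \int[leb4]_(q in cylinder T)
      (`|a q| * ((increment u h q) ^+ 2 + (increment v h q) ^+ 2))%:E <=
  ((W + M1 + M2) * (enorm h `^ s) ^+ 2)%:E.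
Proof.
move=> ma mu mv W0 M10 M20 aW uM vM.
have mC := @measurable_cylinder R T.
have mdu := meas4_inc h mu; have mdv := meas4_inc h mv.
have [->|h0] := eqVneq h 0%R.
  rewrite (_ : \int[leb4]_(q in _) _ = 0).
    by rewrite lee_fin mulr_ge0 ?exprn_ge0 ?powR_ge0// !addr_ge0.
  rewrite -[RHS](integral0 leb4 (cylinder T)); apply: eq_integral => q _.
  by rewrite /increment addr0 -surjective_pairing !subrr expr0n addr0 mulr0.
have e0 := enorm_gt0 h0.
have p0 : (0 < enorm h `^ s)%R by exact: powR_gt0.
set r := ((enorm h `^ s) ^+ 2)%R; have r0 : (0 < r)%R by rewrite exprn_gt0.
have r4 : (enorm h `^ s ^+ 4 = r ^+ 2)%R by rewrite -exprM.
rewrite r4 in uM vM.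
have m4 g : meas4 g -> measurable_fun (cylinder T : set (B * B * B * B))
    (fun q => ((g q) ^+ 4)%:E).
  by move=> mg; apply: measurable_funTS; apply: meas4_EFin; exact: meas4X.
apply: (@le_trans _ _ (\int[leb4]_(q in cylinder T)
   (r%:E * ((a q) ^+ 2)%:E + (r^-1)%:E * (((increment u h q) ^+ 4)%:E +
      ((increment v h q) ^+ 4)%:E)))).
  apply: ge0_le_integral_any => q _.
    by rewrite lee_fin mulr_ge0// addr_ge0// sqr_ge0.
  rewrite -[leRHS]/((r * a q ^+ 2 + r^-1 * (increment u h q ^+ 4 +
      increment v h q ^+ 4))%R%:E) lee_fin; exact: young2.
rewrite ge0_integralD//; first last.
- apply: measurable_funTS; apply: emeasurable_funM => //; apply: emeasurable_funD;
    apply: meas4_EFin; exact: meas4X.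
- move=> q _; apply: mule_ge0; first by rewrite lee_fin invr_ge0 ltW.
  by apply: adde_ge0; rewrite lee_fin exprn_even_ge0.
- apply: measurable_funTS; apply: emeasurable_funM => //.
  apply: meas4_EFin; exact: meas4X.
- by move=> q _; apply: mule_ge0; rewrite lee_fin ?(ltW r0) ?sqr_ge0.
rewrite ge0_integralZl_EFin//; first last.
- exact: ltW.
- by apply: measurable_funTS; apply: meas4_EFin; exact: meas4X.
- by move=> q _; rewrite lee_fin sqr_ge0.
rewrite ge0_integralZl_EFin//; first last.
- by rewrite invr_ge0 ltW.
- by apply: emeasurable_funD; exact: m4.
- by move=> q _; rewrite -EFinD lee_fin addr_ge0// exprn_even_ge0.
rewrite ge0_integralD//; first last.
- exact: m4.
- by move=> q _; rewrite lee_fin exprn_even_ge0.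
- exact: m4.
- by move=> q _; rewrite lee_fin exprn_even_ge0.
have ri0 : 0 <= (r^-1)%:E by rewrite lee_fin invr_ge0 ltW.
apply: le_trans (leeD (lee_wpmul2l _ aW) (lee_wpmul2l ri0 (leeD uM vM))) _.
  by rewrite lee_fin ltW.
rewrite -[leLHS]/((r * W + r^-1 * (M1 * r ^+ 2 + M2 * r ^+ 2))%R%:E) lee_fin.
by rewrite le_eqVlt; apply/orP; left; apply/eqP; field; rewrite gt_eqF.
Qed.

End Mixed.

(** * Mollifiers *)

Section Mollifier.
Context {R : realType}.
Local Notation B := (measurableTypeR R).
Local Notation R3 := (R * R * R)%type.
Local Notation R4 := (R * R * R * R)%type.
Local Notation leb := (@lebesgue_measure R).

Lemma smooth_continuous (V : normedModType R) (f : V -> R) : smooth f -> continuous f.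
Proof. by move=> sf x; apply: differentiable_continuous; exact: (sf [::] x). Qed.

(** In [smooth] the last direction of the list is differentiated first, so v is
    appended at the end. *)
Lemma smooth_derive (V : normedModType R) (f : V -> R) v : smooth f -> smooth ('D_v f).
Proof. by move=> sf s x; have := sf (rcons s v) x; rewrite foldr_rcons. Qed.

Lemma continuous_bounded_on (V : normedModType R) (f : V -> R) (K : set V) :
  continuous f -> compact K -> exists2 M, 0 <= M & forall x, K x -> `|f x| <= M.
Proof.
move=> cf cK.
have /compact_bounded[M [Mr HM]] : compact (f @` K).
  by apply: continuous_compact => //; exact: continuous_subspaceT.
exists (Num.max 0 (M + 1)); first by rewrite le_max lexx.
move=> x Kx; rewrite le_max; apply/orP; right.
by apply: (HM (M + 1)); [rewrite ltrDl|exists x].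
Qed.

(** A product of intervals, whose volume is immediate, is used instead of the
    Euclidean ball. *)
Definition box (r : R) : set R3 := `[- r, r] `*` `[- r, r] `*` `[- r, r].

Lemma box_enorm r x : box r x -> 0 <= r -> enorm x <= 2 * r.
Proof.
case: x => [[a b] c] [[]] /=; rewrite !in_itv/= => /andP[a1 a2] /andP[b1 b2] /andP[c1 c2] r0.
rewrite -[leRHS]ger0_norm ?mulr_ge0// -sqrtr_sqr ler_wsqrtr//=; nra.
Qed.

Lemma notin_box_enorm r x : ~ box r x -> 0 <= r -> r < enorm x.
Proof.
move=> xr r0; rewrite ltNge; apply: contra_notN xr => xr.
have : enorm x ^+ 2 <= r ^+ 2 by rewrite lerXn2r ?nnegrE ?enorm_ge0.
rewrite /enorm sqr_sqrtr ?addr_ge0 ?sqr_ge0//; case: x {xr} => [[a b] c] /= H.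
have := sqr_ge0 a; have := sqr_ge0 b; have := sqr_ge0 c => *.
have S y : y ^+ 2 <= r ^+ 2 -> - r <= y <= r.
  by move=> yr; rewrite -ler_norml -(ger0_norm r0) -ler_sqr ?nnegrE// !real_normK ?num_real.
by split; [split|]; rewrite /= in_itv/=; apply: S; lra.
Qed.

(** Outside the enlarged box the function vanishes in a neighbourhood of the
    point. *)
Lemma compact_support_derive (rho : R3 -> R) (r : R) (v : R3) : 0 <= r ->
  box 1 v -> (forall x, r < enorm x -> rho x = 0) ->
  forall x, ~ box (r + 1) x -> 'D_v rho x = 0.
Proof.
move=> r0 v1 rho0 x xbox.
have far (t : R) : `|t| < 1 -> rho (t *: v + x) = 0.
  move=> t1; apply: rho0; apply: notin_box_enorm => // -[[]].
  case: x xbox => [[a b] c] xbox; case: v v1 => [[v1 v2] v3] v1n /=.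
  have tv (y : R) : `|y| <= 1 -> `|t * y| <= 1.
    by move=> y1; rewrite normrM -[leRHS]mulr1 ler_pM// ltW.
  have [n1 n2 n3] : [/\ `|v1| <= 1, `|v2| <= 1 & `|v3| <= 1].
    by rewrite !ler_norml; case: v1n => -[] /=; rewrite !in_itv.
  have sh (y z : R) : `|y| <= 1 -> - r <= t * y + z <= r -> - (r + 1) <= z <= r + 1.
    by move=> /tv; rewrite ler_norml => /andP[? ?] /andP[? ?]; apply/andP; split; lra.
  rewrite !in_itv/= => h1 h2 h3; apply: xbox.
  by split; [split|]; rewrite /= in_itv/=; [exact: sh n1 h1|exact: sh n2 h2|exact: sh n3 h3].
rewrite /derive; apply: cvg_lim => //.
apply: (@cvg_near_cst _ _ _ _ _); near=> t.
rewrite /= far; last by near: t; apply: dnbhs0_lt.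
have := far 0; rewrite normr0 scale0r add0r => ->//.
by rewrite subrr scaler0.
Unshelve. all: by end_near. Qed.

Lemma compact_box (r : R) : compact (box r).
Proof.
by apply: compact_setX; [apply: compact_setX|]; exact: segment_compact.
Qed.

Lemma derive_rescale (rho : R3 -> R) (eps : R) (v x : R3) : smooth rho ->
  'D_v (rescale rho eps) x = eps ^- 3 * eps^-1 * 'D_v rho (eps^-1 *: x).
Proof.
move=> sr.
pose sc : R3 -> R3 := *:%R eps^-1.
have dr y : differentiable rho y by exact: (sr [::]).
have ds : differentiable sc x by [].
have df : differentiable (rho \o sc) x by exact: differentiable_comp.
have E : 'd (rho \o sc) x = 'd rho (sc x) \o 'd sc x :> (R3 -> R).
  exact: diff_comp.
have E' : 'd sc x = sc :> (R3 -> R3) by exact: diff_val.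
have -> : rescale rho eps = eps ^- 3 \*o (rho \o sc) by [].
rewrite deriveMl; last exact: diff_derivable.
rewrite -mulrA; congr (_ * _); rewrite (deriveE _ df) E /comp E' (deriveE _ (dr _)).
exact: linearZ.
Qed.

(** A derivative of the rescaled mollifier is eps^-4 times a rescaled
    derivative of the mollifier, which is continuous and compactly supported. *)
Lemma mollifier_derive_bound (rho : R3 -> R) : radial_mollifier rho ->
  exists2 r : R, 0 < r & forall v, box 1 v -> exists2 C : R, 0 <= C &
    forall eps x, 0 < eps -> `|'D_v (rescale rho eps) x| <= C * eps ^- 4 /\
    (~ box (r * eps) x -> 'D_v (rescale rho eps) x = 0).
Proof.
move=> [sr [r0 rr0] _ _]; pose r := Num.max 0 r0.
have r_ge0 : 0 <= r by rewrite le_max lexx.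
have rr x : r < enorm x -> rho x = 0.
  by move=> rx; apply: rr0; apply: le_lt_trans rx; rewrite le_max lexx orbT.
exists (r + 1) => [|v v1]; first by rewrite ltr_wpDl.
have cD := smooth_continuous (smooth_derive v sr).
have [C C0 HC] := continuous_bounded_on cD (@compact_box (r + 1)).
have D0 := compact_support_derive r_ge0 v1 rr.
exists C => // eps x e0; rewrite derive_rescale//; split; last first.
  move=> nb; rewrite D0 ?mulr0//; apply: contra_not nb.
  case: x => [[a b] c] [[]] /=.
  have sc (y : R) : eps^-1 *: y \in `[- (r + 1), r + 1] -> y \in `[- ((r + 1) * eps), (r + 1) * eps].
    by rewrite !in_itv/= /GRing.scale/= mulrC ler_pdivlMr// ler_pdivrMr// mulNr.
  by move=> h1 h2 h3; split; [split|]; apply: sc.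
rewrite normrM [X in X * _]ger0_norm; last by rewrite mulr_ge0 ?invr_ge0 ?exprn_ge0// ltW.
rewrite -invfM -exprSr mulrC ler_wpM2r ?invr_ge0 ?exprn_ge0 ?(ltW e0)//.
by have [/HC//|/D0->] := pselect (box (r + 1) (eps^-1 *: x)); rewrite normr0.
Qed.

Local Open Scope ereal_scope.

Lemma leb3_box (r : R) : (0 <= r)%R -> leb3 (box r) = ((2 * r) ^+ 3)%:E.
Proof.
move=> r0; have mI : measurable (`[(- r)%R, r] : set B) by exact: measurable_itv.
have E2 : leb2 (`[(- r)%R, r] `*` `[(- r)%R, r]) = leb `[(- r)%R, r] * leb `[(- r)%R, r].
  exact: product_measure1E.
have -> : leb3 (box r) = leb2 (`[(- r)%R, r] `*` `[(- r)%R, r]) * leb `[(- r)%R, r].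
  by apply: product_measure1E => //; exact: measurableX.
rewrite E2.
have -> : leb `[(- r)%R, r] = (2 * r)%:E.
  rewrite lebesgue_measure_itv/= lte_fin opprK -EFinD.
  by case: ifPn => [_|]; [congr EFin; ring|rewrite -leNgt => h; congr EFin; lra].
by rewrite -!EFinM; congr EFin; ring.
Qed.

Lemma measurable_box (r : R) : measurable (box r : set (B * B * B)).
Proof. by apply: measurableX; [apply: measurableX|]; exact: measurable_itv. Qed.

(** Joint measurability in the increment and the point is what Tonelli's
    theorem requires when averaging over increments. *)
Lemma measurable_increment2 (f : R4 -> R) : meas4 f ->
  measurable_fun (setT : set ((B * B * B) * (B * B * B * B)))
    (fun z => increment f z.1 z.2).
Proof.
move=> mf; apply: measurable_funB; last first.
  by apply: (meas4_comp mf).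
apply: (meas4_comp mf (phi := fun z : (B * B * B) * (B * B * B * B) => (z.2.1 + z.1, z.2.2)%R)).
apply: (@eq_measurable_fun _ _ _ _ _ (fun z : (B * B * B) * (B * B * B * B) =>
  (z.2.1.1.1 + z.1.1.1, z.2.1.1.2 + z.1.1.2, z.2.1.2 + z.1.2, z.2.2)%R : B * B * B * B)) => //.
by apply: measurable_fun_pair; [apply: measurable_fun_pair;
    [apply: measurable_fun_pair|]|] => //=;
  first [apply: measurable_funD => //|idtac]; do ?apply: measurableT_comp => //.
Qed.

End Mollifier.

(** * The defect vanishes *)

Section Defect.
Context {R : realType}.
Local Notation B := (measurableTypeR R).
Local Notation R3 := (R * R * R)%type.
Local Notation R4 := (R * R * R * R)%type.
Implicit Types (f u v w : R4 -> R).
Local Open Scope ereal_scope.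

(** The inequality (a - b)^2 <= 2 (a^2 + b^2) and translation invariance. *)
Lemma increment_L2 T f (W : R) h : meas4 f -> torus_function f ->
  \int[leb4]_(q in cylinder T) ((f q) ^+ 2)%:E <= W%:E ->
  \int[leb4]_(q in cylinder T) ((increment f h q) ^+ 2)%:E <= (4 * W)%:E.
Proof.
move=> mf tf fW.
have mC := @measurable_cylinder R T.
have m2 g : meas4 g -> measurable_fun (cylinder T : set (B * B * B * B))
    (fun q => ((g q) ^+ 2)%:E).
  by move=> mg; apply: measurable_funTS; apply: meas4_EFin; exact: meas4X.
apply: (@le_trans _ _ (\int[leb4]_(q in cylinder T)
   (2%:E * (((space_shift h f q) ^+ 2)%:E + ((f q) ^+ 2)%:E)))).
  apply: ge0_le_integral_any => q _; first by rewrite lee_fin sqr_ge0.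
  rewrite -EFinD -EFinM lee_fin /increment -[f (q.1 + h, q.2)%R]/(space_shift h f q).
  have := sqr_ge0 (space_shift h f q + f q); nra.
rewrite ge0_integralZl_EFin//; first last.
- by apply: emeasurable_funD; apply: m2 => //; exact: meas4_shift.
- by move=> q _; rewrite -EFinD lee_fin addr_ge0// sqr_ge0.
rewrite ge0_integralD//; first last.
- exact: m2.
- by move=> q _; rewrite lee_fin sqr_ge0.
- by apply: m2; exact: meas4_shift.
- by move=> q _; rewrite lee_fin sqr_ge0.
rewrite (integral_cylinder_shift T h (g := fun x => (x ^+ 2)%:E))//; last 2 first.
- by apply/measurable_EFinP; exact: measurable_funX.
- by move=> x; rewrite lee_fin sqr_ge0.
have -> : (4 * W)%:E = 2%:E * (W%:E + W%:E) by rewrite -EFinD -EFinM; congr EFin; ring.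
by rewrite lee_wpmul2l// leeD.
Qed.

Lemma norm_combination3 (d1 d2 d3 x y z K : R) :
  (`|d1| <= K -> `|d2| <= K -> `|d3| <= K ->
   `|d1 * x + d2 * y + d3 * z| <= K * (`|x| + `|y| + `|z|))%R.
Proof.
move=> h1 h2 h3; rewrite !mulrDr.
apply: le_trans (ler_normD _ _) _; apply: lerD; last by rewrite normrM ler_wpM2r.
by apply: le_trans (ler_normD _ _) _; apply: lerD; rewrite normrM ler_wpM2r.
Qed.

(** By Tonelli the tested defect is at most C eps^-4 times an integral over
    |xi| = O (eps) of int int |delta_xi (u, v, w)| (|delta_xi u|^2 +
    |delta_xi v|^2), which is O (eps^(2s)) by [quadratic_increment_bound]; the
    volume of the domain is O (eps^3) and 2s - 1 > 0. *)
Lemma defect_zero (T s : R) (u v w : R4 -> R) (Mu Mv Wu Wv Ww : R)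
  (rho : R3 -> R) : (2^-1 < s)%R ->
  meas4 u -> meas4 v -> meas4 w ->
  torus_function u -> torus_function v -> torus_function w ->
  (forall h, \int[leb4]_(q in cylinder T) ((increment u h q) ^+ 4)%:E <=
    (Mu * (enorm h `^ s) ^+ 4)%:E) ->
  (forall h, \int[leb4]_(q in cylinder T) ((increment v h q) ^+ 4)%:E <=
    (Mv * (enorm h `^ s) ^+ 4)%:E) ->
  (0 <= Mu)%R -> (0 <= Mv)%R -> (0 <= Wu)%R -> (0 <= Wv)%R -> (0 <= Ww)%R ->
  \int[leb4]_(q in cylinder T) ((u q) ^+ 2)%:E <= Wu%:E ->
  \int[leb4]_(q in cylinder T) ((v q) ^+ 2)%:E <= Wv%:E ->
  \int[leb4]_(q in cylinder T) ((w q) ^+ 2)%:E <= Ww%:E ->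
  radial_mollifier rho -> is_defect rho T u v w (fun _ => 0%R).
Proof.
move=> s2 mu mv mw tu tv tw uM vM Mu0 Mv0 Wu0 Wv0 Ww0 uW vW wW /mollifier_derive_bound[r r0 Hr].
move=> f [sf tf _].
have mC := @measurable_cylinder R T.
have [Cf Cf0 HCf] : exists2 C, (0 <= C)%R & forall q, cylinder T q -> (`|f q| <= C)%R.
  have [C C0 HC] := continuous_bounded_on (smooth_continuous sf)
    (compact_setX (compact_setX (compact_setX (@segment_compact _ 0 1) (@segment_compact _ 0 1))
      (@segment_compact _ 0 1)) (@segment_compact _ 0 T))%R.
  exists C => // q [qc qt]; apply: HC; split => //; move: qt; rewrite /= !in_itv/=.
  by move=> /andP[/ltW-> /ltW->].
have box1 (a b c : R) : (`|a| <= 1 -> `|b| <= 1 -> `|c| <= 1 -> box 1 (a, b, c))%R.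
  by rewrite !ler_norml => h1 h2 h3; split; [split|]; rewrite /= in_itv.
have [C1 C10 H1] := Hr _ (box1 1 0 0 ltac:(by rewrite normr1) ltac:(by rewrite normr0) ltac:(by rewrite normr0))%R.
have [C2 C20 H2] := Hr _ (box1 0 1 0 ltac:(by rewrite normr0) ltac:(by rewrite normr1) ltac:(by rewrite normr0))%R.
have [C3 C30 H3] := Hr _ (box1 0 0 1 ltac:(by rewrite normr0) ltac:(by rewrite normr0) ltac:(by rewrite normr1))%R.
pose C := (C1 + C2 + C3)%R; have C0 : (0 <= C)%R by rewrite !addr_ge0.
have C1C : (C1 <= C)%R by rewrite /C -addrA lerDl addr_ge0.
have C2C : (C2 <= C)%R by rewrite /C addrAC lerDr addr_ge0.
have C3C : (C3 <= C)%R by rewrite /C lerDr addr_ge0.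
pose a h q : R := (`|increment u h q| + `|increment v h q| + `|increment w h q|)%R.
pose b h q : R := (increment u h q ^+ 2 + increment v h q ^+ 2)%R.
pose g h q : R := (a h q * b h q)%R.
have a_ge0 h q : (0 <= a h q)%R by rewrite !addr_ge0.
have b_ge0 h q : (0 <= b h q)%R by rewrite !addr_ge0// sqr_ge0.
have g_ge0 h q : (0 <= g h q)%R by rewrite mulr_ge0.
(* a bound for the square integral of the sum of the three increments *)
pose W := (3 * (4 * Wu + 4 * Wv + 4 * Ww))%R.
have W0 : (0 <= W)%R by rewrite !mulr_ge0// !addr_ge0// mulr_ge0.
have ma h : meas4 (a h).
  by apply: meas4D; [apply: meas4D|]; apply: meas4_norm; exact: meas4_inc.
have aW h : \int[leb4]_(q in cylinder T) ((a h q) ^+ 2)%:E <= W%:E.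
  have m2 k : meas4 k -> measurable_fun (cylinder T : set (B * B * B * B))
      (fun q => ((k q) ^+ 2)%:E).
    by move=> mk; apply: measurable_funTS; apply: meas4_EFin; exact: meas4X.
  apply: (@le_trans _ _ (\int[leb4]_(q in cylinder T) (3%:E * (((increment u h q) ^+ 2)%:E +
    ((increment v h q) ^+ 2)%:E + ((increment w h q) ^+ 2)%:E)))).
    apply: ge0_le_integral_any => q _; first by rewrite lee_fin sqr_ge0.
    rewrite -[leRHS]/((3 * (increment u h q ^+ 2 + increment v h q ^+ 2 + increment w h q ^+ 2))%R%:E).
    rewrite lee_fin /a -[(increment u h q ^+ 2)%R]real_normK ?num_real//
      -[(increment v h q ^+ 2)%R]real_normK ?num_real// -[(increment w h q ^+ 2)%R]real_normK ?num_real//.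
    move: `|increment u h q|%R `|increment v h q|%R `|increment w h q|%R => x y z.
    have := sqr_ge0 (x - y); have := sqr_ge0 (y - z); have := sqr_ge0 (x - z); nra.
  have mdu := m2 _ (meas4_inc h mu); have mdv := m2 _ (meas4_inc h mv).
  have mdw := m2 _ (meas4_inc h mw).
  rewrite ge0_integralZl_EFin//; first last.
  - by apply: emeasurable_funD => //; exact: emeasurable_funD.
  - by move=> q _; rewrite !adde_ge0// lee_fin sqr_ge0.
  rewrite ge0_integralD//; first last.
  - by move=> q _; rewrite lee_fin sqr_ge0.
  - exact: emeasurable_funD.
  - by move=> q _; rewrite !adde_ge0// lee_fin sqr_ge0.
  rewrite ge0_integralD//; first last.
  - by move=> q _; rewrite lee_fin sqr_ge0.
  - by move=> q _; rewrite lee_fin sqr_ge0.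
  rewrite -[W%:E]/(3%:E * ((4 * Wu)%:E + (4 * Wv)%:E + (4 * Ww)%:E)).
  apply: lee_wpmul2l => //.
  by apply: leeD; [apply: leeD|]; exact: increment_L2.
have gM h : \int[leb4]_(q in cylinder T) (g h q)%:E <=
    ((W + Mu + Mv) * (enorm h `^ s) ^+ 2)%:E.
  have := quadratic_increment_bound (ma h) mu mv W0 Mu0 Mv0 (aW h) (uM h) (vM h).
  by congr (_ <= _); apply: eq_integral => q _; rewrite ger0_norm.
have mg : measurable_fun (setT : set ((B * B * B) * (B * B * B * B))) (fun z => (g z.1 z.2)%:E).
  apply/measurable_EFinP.
  have := measurable_increment2 mu; have := measurable_increment2 mv.
  have := measurable_increment2 mw => h3 h2 h1.
  apply: measurable_funM; last by apply: measurable_funD; exact: measurable_funX.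
  by apply: measurable_funD; [apply: measurable_funD|]; exact: measurableT_comp.
pose M := (W + Mu + Mv)%R; have M0 : (0 <= M)%R by rewrite !addr_ge0.
(* M |xi|^(2 s), the volume of the box and the size eps^-4 of the gradient combine to K0 eps^(2 s - 1) *)
pose K0 := (Cf * C * M * (2 * r) ^+ 3 * ((2 * r) `^ s) ^+ 2)%R.
have main eps : (0 < eps)%R ->
    (`|\int[leb4]_(q in cylinder T) (defect_density rho u v w eps q * f q)| <=
      K0 * eps `^ (2 * s - 1))%R.
  move=> e0; pose rr := (r * eps)%R; have rr0 : (0 <= rr)%R by rewrite mulr_ge0 ?ltW.
  pose K := (C * eps ^- 4)%R.
  have K_ge0 : (0 <= K)%R by rewrite mulr_ge0// invr_ge0 exprn_ge0// ltW.
  have mbox := @measurable_box R rr.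
  have dd q : cylinder T q -> `|defect_density rho u v w eps q|%:E <=
      K%:E * \int[leb3]_(xi in box rr) (g xi q)%:E.
    move=> qT; rewrite -ge0_integralZl_EFin//; first last.
    - apply: measurable_funTS; exact: (measurableT_comp mg (measurable_pair2 q)).
    - by move=> xi _; rewrite lee_fin.
    rewrite [leRHS]integral_mkcond; apply: Rintegral_le_any => xi _.
    have [b1 z1] := H1 eps xi e0; have [b2 z2] := H2 eps xi e0; have [b3 z3] := H3 eps xi e0.
    rewrite patchE; case: ifPn => [_|/negP xb]; last first.
      have nb : ~ box rr xi by move=> /mem_set.
      by rewrite z1// z2// z3// !mul0r !addr0 mul0r normr0.
    rewrite -EFinM lee_fin !real_normK ?num_real// normrM [X in (_ * X)%R]ger0_norm; last exact: b_ge0.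
    rewrite /g mulrA ler_wpM2r ?b_ge0// /K /a.
    move: b1 b2 b3; set d1 := derive _ _ _; set d2 := derive _ _ _; set d3 := derive _ _ _.
    set E := (eps ^- 4)%R => b1 b2 b3.
    have E0 : (0 <= E)%R by rewrite /E invr_ge0 exprn_ge0// ltW.
    have CE1 : (C1 * E <= C * E)%R := ler_wpM2r E0 C1C.
    have CE2 : (C2 * E <= C * E)%R := ler_wpM2r E0 C2C.
    have CE3 : (C3 * E <= C * E)%R := ler_wpM2r E0 C3C.
    apply: norm_combination3; [exact: le_trans CE1|exact: le_trans CE2|exact: le_trans CE3].
  rewrite -lee_fin.
  apply: (@le_trans _ _ (\int[leb4]_(q in cylinder T)
     ((Cf * K)%:E * \int[leb3]_(xi in box rr) (g xi q)%:E))).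
    apply: Rintegral_le_any => q qT; rewrite normrM mulrC EFinM EFinM -muleA.
    by apply: lee_pmul; rewrite ?lee_fin ?HCf//; exact: dd.
  have mi : measurable_fun (setT : set (B * B * B * B)) (fun q => \int[leb3]_(xi in box rr) (g xi q)%:E).
    by apply: (measurable_tonelli2 leb3 mbox mg) => z; rewrite lee_fin.
  rewrite ge0_integralZl_EFin//; first last.
  - by rewrite mulr_ge0.
  - exact: measurable_funTS.
  - by move=> q _; apply: integral_ge0 => xi _; rewrite lee_fin.
  rewrite -(tonelli_swap leb3 leb4 mbox mC mg); last by move=> z; rewrite lee_fin.
  pose J := (M * ((2 * rr) `^ s) ^+ 2)%R.
  have J0 : (0 <= J)%R by rewrite mulr_ge0// sqr_ge0.
  apply: (@le_trans _ _ ((Cf * K)%:E * (J%:E * leb3 (box rr)))).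
    apply: lee_wpmul2l; first by rewrite lee_fin mulr_ge0.
    rewrite -integral_cst//; apply: ge0_le_integral_any => xi xib.
      by apply: integral_ge0 => q _; rewrite lee_fin.
    apply: (le_trans (gM xi)); rewrite lee_fin ler_wpM2l//.
    rewrite lerXn2r ?nnegrE ?powR_ge0// ge0_ler_powR ?nnegrE ?enorm_ge0//.
    + by apply: le_trans (ltW s2).
    + by rewrite mulr_ge0.
    + exact: box_enorm.
  rewrite leb3_box// -!EFinM lee_fin le_eqVlt; apply/orP; left; apply/eqP.
  have E1 : ((2 * (r * eps)) `^ s = (2 * r) `^ s * eps `^ s)%R.
    by rewrite mulrA powRM// ?mulr_ge0// ltW.
  have E2 : (eps `^ (2 * s - 1) = (eps `^ s) ^+ 2 / eps)%R.
    rewrite powRB; last by rewrite (gt_eqF e0) implybT.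
    by rewrite powRr1 ?(ltW e0)// [(2 * s)%R]mulrC powRrM powR_mulrn ?powR_ge0.
  rewrite /J /K0 /K /rr E1 E2.
  by field; rewrite gt_eqF.
apply/norm_cvg0P.
have lim0 : (K0 * eps `^ (2 * s - 1))%R @[eps --> 0%R^'+] --> (0%R : R).
  have s1 : (0 < 2 * s - 1)%R by lra.
  by have := cvgM (cvg_cst K0) (powR_cvg0 s1); rewrite mulr0; apply.
apply: squeeze_cvgr (cvg_cst (0%R : R)) lim0.
near=> eps; rewrite normr_ge0/=; apply: main; near: eps; exact: nbhs_right_gt.
Unshelve. all: by end_near. Qed.

End Defect.

(** * An explicit class of smooth functions *)

Section Elementary.
Context {R : realType}.
Local Notation R4 := (R * R * R * R)%type.

(** The functions x^-n exp (-1/x) for x > 0, extended by 0.  For n = 0 it is the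
    usual flat function; allowing every n makes the family stable under
    differentiation, see [is_derive_flat]. *)
Definition flat (n : nat) (x : R) : R := if 0 < x then x ^- n * expR (- x^-1) else 0.

Lemma flat_le0 n x : x <= 0 -> flat n x = 0.
Proof. by move=> x0; rewrite /flat ltNge x0. Qed.

Lemma flat_ge0 n x : 0 <= flat n x.
Proof.
rewrite /flat; case: ifPn => // x0; rewrite mulr_ge0 ?expR_ge0// invr_ge0 exprn_ge0//.
exact: ltW.
Qed.

Lemma flat_gt0 n x : 0 < x -> 0 < flat n x.
Proof. by move=> x0; rewrite /flat x0 mulr_gt0 ?expR_gt0// invr_gt0 exprn_gt0. Qed.

(** The term of order n + 2 of the exponential series at 1/x dominates the
    pole.  A bound of order x^2 gives differentiability at 0. *)
Lemma flat_bound n x : `|flat n x| <= n.+2`!%:R * x ^+ 2.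
Proof.
rewrite ger0_norm ?flat_ge0// /flat; case: ifPn => [x0|_]; last by rewrite mulr_ge0 ?sqr_ge0.
have y0 : 0 < x^-1 by rewrite invr_gt0.
have := expR_ge1Dxn n.+1 (ltW y0); set F : R := n.+2`!%:R => H.
have F0 : 0 < F by rewrite ltr0n fact_gt0.
have {}H : x^-1 ^+ n.+2 <= F * expR x^-1.
  by rewrite mulrC -ler_pdivrMr//; apply: le_trans H; rewrite lerDr.
rewrite expRN ler_pdivrMr ?expR_gt0// -exprVn.
have -> : x^-1 ^+ n = x^-1 ^+ n.+2 * x ^+ 2.
  by rewrite -addn2 exprD -mulrA -exprMn mulVf ?gt_eqF// expr1n mulr1.
by rewrite (mulrAC F) ler_wpM2r// sqr_ge0.
Qed.

Lemma is_derive_flat n (x : R) : is_derive x 1 (flat n) (- n%:R * flat n.+1 x + flat n.+2 x).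
Proof.
have [x0|x0|<-] := ltgtP 0 x.
- have E : \near x, (fun y => y ^- n * expR (- y^-1)) x = flat n x.
    by near=> y; rewrite /flat; have -> : 0 < y by near: y; exact: lt_nbhsr.
  apply: (near_eq_is_derive E).
  have xn : x != 0 by rewrite gt_eqF.
  have xn0 : x ^+ n != 0 by rewrite expf_neq0.
  have dV : is_derive x 1 (fun y : R => y^-1) (- x ^- 2).
    by have := is_deriveV (f := id) xn (is_derive_id x 1); rewrite /= scaler1.
  have d1 : is_derive x 1 (fun y : R => y ^- n) (- n%:R * x ^- n.+1).
    have dX : is_derive x 1 (fun y : R => y ^+ n) (n%:R * x ^+ n.-1).
      rewrite (_ : (fun y : R => y ^+ n) = id ^+ n).
        by apply: is_derive_eq; rewrite /GRing.scale/= mulr1.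
      by apply/funext => y; rewrite exprfctE.
    have H := is_deriveV (f := fun y : R => y ^+ n) xn0 dX.
    apply: is_derive_eq; rewrite /GRing.scale/=.
    case: n xn0 {H dX E} => [|n] xn0; first by rewrite !mul0r oppr0 !mul0r mulr0.
    have Xn0 : x ^+ n != 0 by rewrite expf_neq0.
    rewrite /= !exprS; move: (x ^+ n) Xn0 => X X0; field; rewrite xn X0 //.
  have dN : is_derive x 1 (fun y : R => - y^-1) (x ^- 2).
    by apply: is_derive_eq; rewrite opprK.
  have d2 : is_derive x 1 (fun y : R => expR (- y^-1)) (expR (- x^-1) * x ^- 2).
    exact: (is_derive1_comp (f := expR) (g := fun y : R => - y^-1)).
  apply: is_derive_eq; rewrite /flat x0 /GRing.scale/=.
  rewrite !exprS; move: (x ^+ n) xn0 (expR _) => X X0 e; field; rewrite xn X0 //.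
- have E : \near x, (fun=> 0) x = flat n x.
    near=> y; rewrite flat_le0//; have : y < 0 by near: y; exact: lt_nbhsl.
    exact: ltW.
  apply: (near_eq_is_derive E); rewrite !flat_le0 ?ltW// mulr0 addr0.
  exact: is_derive_cst.
- rewrite !flat_le0// mulr0 addr0.
  have H : h^-1 *: (flat n (h *: 1 + 0) - flat n 0) @[h --> 0^'] --> 0.
    apply/norm_cvg0P.
    have L : (n.+2`!%:R * `|h|) @[h --> (0:R)^'] --> (0:R).
      rewrite -[X in _ --> X](mulr0 n.+2`!%:R); apply: cvgM; first exact: cvg_cst.
      apply/cvgr0Pnorm_lt => e e0; near=> h; rewrite normr_id; near: h.
      exact: dnbhs0_lt.
    apply: squeeze_cvgr (cvg_cst (0 : R)) L.
    near=> h; rewrite normr_ge0/= (flat_le0 n (lexx 0)) subr0 addr0.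
    have h0 : h != 0 by near: h; exact: nbhs_dnbhs_neq.
    rewrite /GRing.scale/= mulr1 normrM normfV ler_pdivrMl ?normr_gt0//.
    rewrite mulrCA -expr2 real_normK ?num_real//; exact: flat_bound.
  by apply: DeriveDef; [apply/cvg_ex; exists 0|exact: cvg_lim].
Unshelve. all: by end_near. Qed.

(** An inductive class of functions closed under differentiation: smoothness
    follows by induction, without iterated derivatives being computed. *)
Inductive elem : (R -> R) -> Prop :=
| elem_cst c : elem (fun=> c)
| elem_flat n : elem (flat n)
| elem_cos : elem (@cos R)
| elem_sin : elem (@sin R)
| elem_add f g : elem f -> elem g -> elem (fun x => f x + g x)
| elem_mul f g : elem f -> elem g -> elem (fun x => f x * g x)
| elem_aff f a b : elem f -> elem (fun x => f (a * x + b))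
| elem_inv f : elem f -> (forall x, 0 < f x) -> elem (fun x => (f x)^-1).

Lemma elem_derive f : elem f ->
  exists2 f', elem f' & forall x : R, is_derive x 1 f (f' x).
Proof.
elim=> {f} [c|n| | |f g _ [f' ef' df] _ [g' eg' dg]|f g ef [f' ef' df] eg [g' eg' dg]
  |f a b _ [f' ef' df]|f ef [f' ef' df] f0].
- by exists (fun=> 0); [exact: elem_cst|move=> x; exact: is_derive_cst].
- exists (fun x => - n%:R * flat n.+1 x + flat n.+2 x); last exact: is_derive_flat.
  by apply: elem_add; [apply: elem_mul; [exact: elem_cst|]|]; exact: elem_flat.
- exists (fun x => -1 * sin x); first by apply: elem_mul; [exact: elem_cst|exact: elem_sin].
  by move=> x; rewrite mulN1r; exact: is_derive_cos.
- by exists (@cos R); [exact: elem_cos|move=> x; exact: is_derive_sin].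
- exists (fun x => f' x + g' x); first exact: elem_add.
  by move=> x; exact: is_deriveD.
- exists (fun x => f x * g' x + g x * f' x).
    by apply: elem_add; exact: elem_mul.
  by move=> x; exact: is_deriveM.
- exists (fun x => a * f' (a * x + b)).
    by apply: elem_mul; [exact: elem_cst|exact: elem_aff].
  move=> x; have d1 : is_derive x 1 (fun y : R => a * y + b) a.
    have := is_deriveD (is_deriveM (is_derive_cst a x 1) (is_derive_id x 1)) (is_derive_cst b x 1).
    by rewrite addr0 scaler0 addr0 /GRing.scale/= mulr1.
  by rewrite mulrC; exact: (is_derive1_comp (f := f) (g := fun y : R => a * y + b)).
- exists (fun x => -1 * ((f x)^-1 * (f x)^-1 * f' x)).
    apply: elem_mul; first exact: elem_cst.
    by apply: elem_mul => //; apply: elem_mul; exact: elem_inv.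
  move=> x; have fx : f x != 0 by rewrite gt_eqF.
  have := is_deriveV fx (df x).
  by rewrite mulN1r -invfM -expr2 /GRing.scale/= mulNr.
Qed.

Lemma elem_derivable f x : elem f -> derivable f x 1.
Proof. by move=> /elem_derive[f' _ df]; have [] := df x. Qed.

Lemma elem_derive1 f : elem f -> elem (derive1 f).
Proof.
move=> /elem_derive[f' ef' df]; suff -> : (derive1 f) = f' by [].
by apply/funext => x; rewrite derive1E derive_val.
Qed.

Lemma elem_continuous f : elem f -> continuous f.
Proof.
by move=> ef x; apply: differentiable_continuous; apply/derivable1_diffP/elem_derivable.
Qed.

(** The functions of four variables generated by functions of [elem] of one
    linear coordinate.  The coordinate is an arbitrary continuous linear form,
    which treats the four variables at once. *)
Inductive tens : (R4 -> R) -> Prop :=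
| tens_coord (pi : {linear R4 -> R}) g :
    continuous pi -> elem g -> tens (fun q => g (pi q))
| tens_add f g : tens f -> tens g -> tens (fun q => f q + g q)
| tens_mul f g : tens f -> tens g -> tens (fun q => f q * g q).

Lemma derive_coord (pi : {linear R4 -> R}) g v q : continuous pi -> elem g ->
  differentiable (fun q => g (pi q)) q /\
  'D_v (fun q => g (pi q)) q = pi v * (derive1 g) (pi q).
Proof.
move=> cpi eg.
have dpi : differentiable pi q by exact: linear_differentiable.
have dg : differentiable g (pi q) by apply/derivable1_diffP/elem_derivable.
have dc : differentiable (g \o pi) q by exact: differentiable_comp.
split; first exact: dc.
rewrite -[LHS]/('D_v (g \o pi) q) deriveE//.
have E : 'd (g \o pi) q = 'd g (pi q) \o 'd pi q :> (R4 -> R) by exact: diff_comp.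
have E' : 'd pi q = pi :> (R4 -> R) by exact: diff_lin.
by rewrite E /comp E' diff1E.
Qed.

Lemma tens_derive f v : tens f -> (forall q, differentiable f q) /\ tens ('D_v f).
Proof.
elim=> {f} [pi g cpi eg|f g tf [df tdf] tg [dg tdg]|f g tf [df tdf] tg [dg tdg]].
- split; first by move=> q; have [] := derive_coord v q cpi eg.
  have -> : 'D_v (fun q => g (pi q)) = (fun q => pi v * (derive1 g) (pi q)).
    by apply/funext => q; have [] := derive_coord v q cpi eg.
  apply: tens_mul; last exact: tens_coord (elem_derive1 eg).
  exact: (tens_coord cpi (elem_cst (pi v))).
- split; first by move=> q; exact: differentiableD.
  have -> : 'D_v (fun q => f q + g q) = (fun q => 'D_v f q + 'D_v g q).
    by apply/funext => q; rewrite -[LHS]/('D_v (f + g) q) deriveD//; exact: diff_derivable.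
  exact: tens_add.
- split; first by move=> q; exact: differentiableM.
  have -> : 'D_v (fun q => f q * g q) = (fun q => f q * 'D_v g q + g q * 'D_v f q).
    by apply/funext => q; rewrite -[LHS]/('D_v (f * g) q) deriveM//; exact: diff_derivable.
  by apply: tens_add; exact: tens_mul.
Qed.

(** The class is closed under directional derivatives and its members are
    differentiable. *)
Lemma tens_smooth f : tens f -> smooth f.
Proof.
move=> tf s x; suff H : tens (foldr (fun v g => 'D_v g) f s).
  by have [] := tens_derive 0 H.
by elim: s => //= v s /(tens_derive v)[].
Qed.

End Elementary.

(** * Tensor product test functions *)

Section TensorTest.
Context {R : realType}.
Local Notation R4 := (R * R * R * R)%type.

Definition tensor (a b c psi : R -> R) : R4 -> R :=
  fun q => a q.1.1.1 * b q.1.1.2 * c q.1.2 * psi q.2.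

Let pr4 : {linear R4 -> R} := snd.
Let pr3 : {linear R4 -> R} := snd \o fst.
Let pr2 : {linear R4 -> R} := snd \o (fst \o fst).
Let pr1 : {linear R4 -> R} := fst \o (fst \o fst).

Let c4 : continuous pr4. Proof. by move=> x; exact: cvg_snd. Qed.
Let c3 : continuous pr3.
Proof. by move=> x; apply: continuous_comp; [exact: cvg_fst|exact: cvg_snd]. Qed.
Let c11 : continuous (fst \o fst : R4 -> R * R).
Proof. by move=> x; apply: continuous_comp; exact: cvg_fst. Qed.
Let c2 : continuous pr2.
Proof. by move=> x; apply: continuous_comp; [exact: c11|exact: cvg_snd]. Qed.
Let c1 : continuous pr1.
Proof. by move=> x; apply: continuous_comp; [exact: c11|exact: cvg_fst]. Qed.

Lemma tens_tensor a b c psi : elem a -> elem b -> elem c -> elem psi ->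
  tens (tensor a b c psi).
Proof.
move=> ea eb ec ep; apply: tens_mul; last exact: (tens_coord c4 ep).
apply: tens_mul; last exact: (tens_coord c3 ec).
apply: tens_mul; first exact: (tens_coord c1 ea).
exact: (tens_coord c2 eb).
Qed.

Lemma derive_tensor a b c psi (v q : R4) : elem a -> elem b -> elem c -> elem psi ->
  'D_v (tensor a b c psi) q =
    v.1.1.1 * tensor (derive1 a) b c psi q + v.1.1.2 * tensor a (derive1 b) c psi q +
    v.1.2 * tensor a b (derive1 c) psi q + v.2 * tensor a b c (derive1 psi) q.
Proof.
move=> ea eb ec ep.
have [d1 e1] := derive_coord v q c1 ea; have [d2 e2] := derive_coord v q c2 eb.
have [d3 e3] := derive_coord v q c3 ec; have [d4 e4] := derive_coord v q c4 ep.
pose f1 := fun q => a (pr1 q); pose f2 := fun q => b (pr2 q).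
pose f3 := fun q => c (pr3 q); pose f4 := fun q => psi (pr4 q).
have d12 : differentiable (f1 * f2) q by exact: differentiableM.
have d123 : differentiable (f1 * f2 * f3) q by exact: differentiableM.
rewrite -[LHS]/('D_v (f1 * f2 * f3 * f4) q).
rewrite deriveM; [|exact: diff_derivable|exact: diff_derivable].
rewrite deriveM; [|exact: diff_derivable|exact: diff_derivable].
rewrite deriveM; [|exact: diff_derivable|exact: diff_derivable].
rewrite e1 e2 e3 e4 /tensor /GRing.scale/= !mulrfctE /f1 /f2 /f3 /f4 /=.
ring.
Qed.

Definition periodic1 (a : R -> R) := forall x, a (x + 1) = a x.

Lemma test_tensor T a b c psi : elem a -> elem b -> elem c -> elem psi ->
  periodic1 a -> periodic1 b -> periodic1 c ->
  (exists l r, [/\ 0 < l, r < T & forall t, psi t != 0 -> l <= t <= r]) ->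
  test_function T (tensor a b c psi).
Proof.
move=> ea eb ec ep pa pb pc [l [r [l0 rT lr]]]; split.
- exact/tens_smooth/tens_tensor.
- by split=> x y z t; rewrite /tensor /= ?pa ?pb ?pc.
- exists l, r; split => // q; rewrite /tensor mulf_eq0 negb_or => /andP[_]; exact: lr.
Qed.

Lemma dx_tensor a b c psi : elem a -> elem b -> elem c -> elem psi ->
  dx (tensor a b c psi) = tensor (derive1 a) b c psi.
Proof.
move=> ea eb ec ep; apply/funext => q.
by rewrite /dx derive_tensor//= mul1r !mul0r !addr0.
Qed.

Lemma dy_tensor a b c psi : elem a -> elem b -> elem c -> elem psi ->
  dy (tensor a b c psi) = tensor a (derive1 b) c psi.
Proof.
move=> ea eb ec ep; apply/funext => q.
by rewrite /dy derive_tensor//= mul1r !mul0r !addr0 add0r.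
Qed.

Lemma dz_tensor a b c psi : elem a -> elem b -> elem c -> elem psi ->
  dz (tensor a b c psi) = tensor a b (derive1 c) psi.
Proof.
move=> ea eb ec ep; apply/funext => q.
by rewrite /dz derive_tensor//= mul1r !mul0r !addr0 !add0r.
Qed.

Lemma dt_tensor a b c psi : elem a -> elem b -> elem c -> elem psi ->
  dt (tensor a b c psi) = tensor a b c (derive1 psi).
Proof.
move=> ea eb ec ep; apply/funext => q.
by rewrite /dt derive_tensor//= mul1r !mul0r !add0r.
Qed.

End TensorTest.

(** * Calculus in the explicit class and smooth steps *)

Section Step.
Context {R : realType}.
Local Notation B := (measurableTypeR R).
Local Notation leb := (@lebesgue_measure R).
Implicit Types (f g : R -> R).

Lemma is_derive_elem f (x : R) : elem f -> is_derive x 1 f (derive1 f x).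
Proof. by move=> ef; rewrite derive1E; apply: derivableP; exact: elem_derivable. Qed.

Lemma derive1_aff f a b : elem f ->
  derive1 (fun x => f (a * x + b)) = (fun x => a * derive1 f (a * x + b)).
Proof.
move=> ef; apply/funext => x; rewrite derive1E.
have d1 : is_derive x 1 (fun y : R => a * y + b) a.
  have := is_deriveD (is_deriveM (is_derive_cst a x 1) (is_derive_id x 1)) (is_derive_cst b x 1).
  by rewrite addr0 scaler0 addr0 /GRing.scale/= mulr1.
have := is_derive1_comp (f := f) (g := fun y : R => a * y + b) (is_derive_elem _ ef) d1.
by move=> [_ /= h]; rewrite -[LHS]/('D_1 (f \o (fun y : R => a * y + b)) x) h mulrC.
Qed.

Lemma derive1_add f g : elem f -> elem g ->
  derive1 (fun x => f x + g x) = (fun x => derive1 f x + derive1 g x).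
Proof.
move=> ef eg; apply/funext => x; rewrite derive1E -[LHS]/('D_1 (f + g) x).
by rewrite deriveD ?derive1E//; exact: elem_derivable.
Qed.

Lemma derive1_scale f c : elem f ->
  derive1 (fun x => c * f x) = (fun x => c * derive1 f x).
Proof.
move=> ef; apply/funext => x; rewrite derive1E -[LHS]/('D_1 (c \*o f) x).
by rewrite deriveMl ?derive1E//; exact: elem_derivable.
Qed.

Lemma elem_scale f c : elem f -> elem (fun x => c * f x).
Proof. by move=> ef; apply: elem_mul => //; exact: elem_cst. Qed.

Lemma elem_measurable f : elem f -> measurable_fun (setT : set B) f.
Proof. by move=> ef; exact: continuous_measurable_fun (elem_continuous ef). Qed.

Lemma elem_integrable f a b : elem f -> leb.-integrable `[a, b] (EFin \o f).
Proof.
move=> ef; apply: continuous_compact_integrable; first exact: segment_compact.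
by apply: continuous_subspaceT; exact: elem_continuous.
Qed.

Lemma elem_FTC f a b : elem f -> a < b ->
  \int[leb]_(x in `[a, b]) derive1 f x = f b - f a.
Proof.
move=> ef ab; rewrite /Rintegral (continuous_FTC2 ab (F := f))//.
- by apply: continuous_subspaceT; exact: elem_continuous (elem_derive1 ef).
- split.
  + by move=> x _; exact: elem_derivable.
  + by apply: cvg_at_right_filter; exact: elem_continuous.
  + by apply: cvg_at_left_filter; exact: elem_continuous.
Qed.

Lemma elem_bounded f a b : elem f -> exists2 C, 0 <= C & forall x, a <= x <= b -> `|f x| <= C.
Proof.
move=> ef.
have [C C0 HC] := continuous_bounded_on (elem_continuous ef) (@segment_compact _ a b).
by exists C => // x xab; apply: HC; rewrite /= in_itv.
Qed.

(** A smooth function equal to 0 on ]-oo, 0] and to 1 on [1, +oo[. *)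
Definition step (x : R) : R := flat 0 x * (flat 0 x + flat 0 (-1 * x + 1))^-1.

Let den_gt0 (x : R) : 0 < flat 0 x + flat 0 (-1 * x + 1).
Proof.
have [x0|x0] := ltP 0 x; first by rewrite ltr_pwDl ?flat_gt0 ?flat_ge0.
by rewrite ltr_wpDl ?flat_ge0// flat_gt0//; lra.
Qed.

Lemma elem_step : elem step.
Proof.
apply: elem_mul; first exact: elem_flat.
apply: elem_inv => //; apply: elem_add; first exact: elem_flat.
exact: (elem_aff (-1) 1 (elem_flat 0)).
Qed.

Lemma step_le0 x : x <= 0 -> step x = 0.
Proof. by move=> x0; rewrite /step flat_le0// mul0r. Qed.

Lemma step_ge1 x : 1 <= x -> step x = 1.
Proof.
move=> x1; rewrite /step (@flat_le0 _ _ (-1 * x + 1)); last by lra.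
by rewrite addr0 divff// gt_eqF// flat_gt0//; lra.
Qed.

Lemma step_itv x : 0 <= step x <= 1.
Proof.
rewrite /step; have := den_gt0 x; have := flat_ge0 0 x; have := flat_ge0 0 (-1 * x + 1).
move=> h1 h2 h3; rewrite divr_ge0 ?(ltW h3)//= ler_pdivrMr// mul1r; lra.
Qed.

Definition dstep := derive1 step.

Lemma dstep_out x : x < 0 \/ 1 < x -> dstep x = 0.
Proof.
rewrite /dstep derive1E => -[x0|x1].
- rewrite (near_eq_derive (g := cst (0 : R))) ?derive_cst//.
  near=> y; rewrite step_le0//; apply: ltW; near: y; exact: lt_nbhsl.
- rewrite (near_eq_derive (g := cst (1 : R))) ?derive_cst//.
  near=> y; rewrite step_ge1//; apply: ltW; near: y; exact: lt_nbhsr.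
Unshelve. all: by end_near. Qed.

Lemma dstep_bounded : exists2 C, 0 < C & forall x, `|dstep x| <= C.
Proof.
have [C C0 HC] := elem_bounded 0 1 (elem_derive1 elem_step).
exists (C + 1); first by rewrite ltr_wpDl.
move=> x; have [x0|x0] := ltP x 0; first by rewrite dstep_out ?normr0 ?addr_ge0//; left.
have [x1|x1] := ltP 1 x; first by rewrite dstep_out ?normr0 ?addr_ge0//; right.
by apply: (le_trans (HC x _)); [rewrite x0|rewrite lerDl].
Qed.

End Step.

(** * Localisation in time *)

Section WeakDerivative.
Context {R : realType}.
Local Notation B := (measurableTypeR R).
Local Notation leb := (@lebesgue_measure R).
Variable T : R.
Hypothesis T0 : 0 < T.
Local Notation I := (`]0, T[%classic : set B).

Let mI : measurable I. Proof. exact: measurable_itv. Qed.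

Lemma integrable_bounded_mul d (X : measurableType d) (mu : {measure set X -> \bar R})
    (D : set X) (f k : X -> R) (C : R) :
  measurable D -> mu.-integrable D (EFin \o f) -> measurable_fun D k ->
  (forall x, D x -> `|k x| <= C) -> mu.-integrable D (EFin \o (fun x => f x * k x)).
Proof.
move=> mD If mk kC.
have mf : measurable_fun D f by apply/measurable_EFinP; exact: measurable_int If.
apply: (le_integrable mD _ _ (integrableZl mD C If)).
- by apply/measurable_EFinP; exact: measurable_funM.
- move=> x Dx; have C0 : 0 <= C by apply: le_trans (kC x Dx).
  by rewrite /= lee_fin normrM [leRHS]normrM mulrC (ger0_norm C0) ler_wpM2r// kC.
Qed.

(** The derivative of a smooth step from 0 to 1 between s and s + 1/(n+1): a
    smooth approximation, from the right, of the Dirac mass at s. *)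
Definition time_kernel (n : nat) (s r : R) : R := n.+1%:R * dstep (n.+1%:R * r + - (n.+1%:R * s)).

Lemma elem_time_kernel n s : elem (time_kernel n s).
Proof.
apply: elem_scale.
exact: (elem_aff n.+1%:R (- (n.+1%:R * s)) (elem_derive1 elem_step)).
Qed.

Lemma time_kernel_derive n s :
  derive1 (fun r => step (n.+1%:R * r + - (n.+1%:R * s))) = time_kernel n s.
Proof. by rewrite (derive1_aff _ _ elem_step). Qed.

Lemma time_kernel_out n s r : r < s \/ s + n.+1%:R^-1 < r -> time_kernel n s r = 0.
Proof.
move=> rs; rewrite /time_kernel dstep_out ?mulr0//.
have N0 : 0 < n.+1%:R :> R by [].
rewrite -mulrBr; case: rs => h; [left|right].
- by rewrite pmulr_rlt0// subr_lt0.
- by rewrite mulrC -ltr_pdivrMr// div1r ltrBrDl.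
Qed.

Lemma time_kernel_mass n s : 0 < s < T -> s + n.+1%:R^-1 < T ->
  \int[leb]_(r in I) time_kernel n s r = 1.
Proof.
move=> /andP[s0 sT] snT.
have ek := elem_time_kernel n s.
have mk : measurable_fun (`]0, T[ : set B) (time_kernel n s).
  by apply: measurable_funTS; exact: elem_measurable.
transitivity (\int[leb]_(r in `[0, T]) time_kernel n s r).
  rewrite /Rintegral; congr fine; apply/esym/integral_itv_bndoo.
  exact/measurable_EFinP.
rewrite -time_kernel_derive elem_FTC//; last first.
  exact: (elem_aff n.+1%:R (- (n.+1%:R * s)) elem_step).
have N0 : 0 < n.+1%:R :> R by [].
rewrite step_ge1; last first.
  by rewrite -mulrBr mulrC -ler_pdivrMr// div1r lerBrDl ltW.
by rewrite step_le0 ?subr0// mulr0 add0r oppr_le0 mulr_ge0// ltW.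
Qed.

(** The kernel has mass 1 and is at most C (n+1) on an interval of length
    1/(n+1) contained in the ball of radius 2/(n+1) around s, so the error is at most 4C times the
    mean oscillation of A on that ball. *)
Lemma approx_point (A : R -> R) s : leb.-integrable I (EFin \o A) -> 0 < s < T ->
  lebesgue_pt (A \_ I) s ->
  (\int[leb]_(r in I) (A r * time_kernel n s r)) @[n --> \oo] --> A s.
Proof.
move=> IA sT pt; have [C C0 HC] := @dstep_bounded R.
have kC n r : `|time_kernel n s r| <= n.+1%:R * C.
  by rewrite /time_kernel normrM ger0_norm// ler_wpM2l.
have As : (A \_ I) s = A s by rewrite patchE mem_set//= in_itv.
have key n : s + n.+1%:R^-1 < T ->
    (`|\int[leb]_(r in I) (A r * time_kernel n s r) - A s|%:E <=
     (4 * C)%:E * davg (A \_ I) s (2 / n.+1%:R))%E.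
  move=> snT.
  have Ik : leb.-integrable I (EFin \o (fun r => A r * time_kernel n s r)).
    apply: (integrable_bounded_mul mI IA) => [|r _]; last exact: kC.
    by apply: measurable_funTS; apply: elem_measurable; exact: elem_time_kernel.
  have Ik1 : leb.-integrable I (EFin \o time_kernel n s).
    apply: (integrableS _ mI _ (elem_integrable 0 T (elem_time_kernel n s))).
      exact: measurable_itv.
    exact: subset_itv_oo_cc.
  have Ik2 : leb.-integrable I (EFin \o (fun r => A s * time_kernel n s r)).
    by have := integrableZl mI (A s) Ik1.
  have -> : \int[leb]_(r in I) (A r * time_kernel n s r) - A s =
      \int[leb]_(r in I) ((A r - A s) * time_kernel n s r).
    transitivity (\int[leb]_(r in I) (A r * time_kernel n s r) -
        \int[leb]_(r in I) (A s * time_kernel n s r)).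
      by rewrite RintegralZl// time_kernel_mass// mulr1.
    by rewrite -RintegralB//; apply: eq_Rintegral => r _; rewrite mulrBl.
  have r0 : 0 < 2 / n.+1%:R :> R by rewrite divr_gt0.
  pose g := (fun r => ((n.+1%:R * C)%:E * `|((A \_ I) r - A s)%:E|)%E) \_ (ball s (2 / n.+1%:R)).
  have g0 r : (0 <= g r)%E.
    by apply: erestrict_ge0 => x _; rewrite mule_ge0// lee_fin mulr_ge0// ltW.
  apply: (@le_trans _ _ (\int[leb]_(r in I) g r)%E).
    apply: Rintegral_le_any => r Ir; rewrite normrM mulrC EFinM /g patchE.
    case: ifPn => [rb|/negP rb].
      rewrite patchE (mem_set Ir) /=; apply: lee_wpmul2r; first by rewrite lee_fin.
      by rewrite lee_fin kC.
    rewrite time_kernel_out ?normr0 ?mul0e//.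
    have {}rb : ~ ball s (2 / n.+1%:R) r by move=> /mem_set.
    have [rs|sr] := ltP r s; [by left|right; rewrite ltNge; apply/negP => rsn].
    apply: rb; rewrite /ball/= ler0_norm ?subr_le0// opprB.
    apply: (@le_lt_trans _ _ n.+1%:R^-1); first by rewrite lerBlDl.
    by rewrite ltr_pMl ?invr_gt0// ltr1n.
  apply: (@le_trans _ _ (\int[leb]_r g r)%E).
    rewrite integral_mkcond; apply: ge0_le_integral_any => r _.
      exact: erestrict_ge0.
    by rewrite patchE; case: ifPn.
  rewrite -integral_mkcond /davg /iavg lebesgue_measure_ball; last exact: ltW.
  rewrite ge0_integralZl_EFin//; first last.
  - by rewrite mulr_ge0// ltW.
  - have mA0 : measurable_fun (setT : set B) (A \_ I).
      have mA : measurable_fun I A by apply/measurable_EFinP; exact: measurable_int IA.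
      exact: ((measurable_restrictT A mI).1 mA).
    have m1 : measurable_fun (setT : set B) (fun r => (A \_ I) r - A s).
      exact: measurable_funB.
    apply: measurable_funTS; apply: measurableT_comp => //; exact/measurable_EFinP.
  - exact: measurable_ball.
  rewrite muleA inver mulrn_eq0 /= gt_eqF// -EFinM.
  rewrite (_ : 4 * C / (2 / n.+1%:R *+ 2) = n.+1%:R * C).
    by rewrite As.
  by rewrite -mulr_natr; field.
have small (d : R) : 0 < d -> \forall n \near \oo, 2 / n.+1%:R < d.
  move=> d0; near=> n; rewrite -ltr_pdivlMl//; near: n.
  have d20 : 0 < 2^-1 * d by rewrite mulr_gt0.
  exact: (near_infty_natSinv_lt (PosNum d20)).
apply/cvgrPdist_le => e e0; move/fine_cvgP: pt => [ptf /cvgrPdist_le pte].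
have e1 : 0 < e / (4 * C) by rewrite divr_gt0// mulr_gt0.
have [d1 /= d10 H1] := ptf.
have [d2 /= d20 H2] := pte _ e1.
near=> n.
have snT : s + n.+1%:R^-1 < T.
  rewrite -ltrBrDl; near: n.
  have Ts0 : 0 < T - s by rewrite subr_gt0; case/andP: sT.
  exact: (near_infty_natSinv_lt (PosNum Ts0)).
have n0 : 0 < 2 / n.+1%:R :> R by rewrite divr_gt0.
have fin : davg (A \_ I) s (2 / n.+1%:R) \is a fin_num.
  apply: H1 => //=; rewrite sub0r normrN gtr0_norm//; near: n; exact: small.
have := H2 (2 / n.+1%:R); rewrite /= sub0r normrN gtr0_norm//.
have -> : 2 / n.+1%:R < d2 by near: n; exact: small.
move=> /(_ isT n0); rewrite sub0r normrN => dle.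
have := key n snT; rewrite -[davg _ _ _]fineK// -EFinM lee_fin distrC => /le_trans; apply.
rewrite mulrC -ler_pdivlMr ?mulr_gt0//; exact: le_trans (ler_norm _) dle.
Unshelve. all: by end_near. Qed.

(** The steps converge pointwise to the indicator of ]s, T[, with values in
    [0, 1]: dominated convergence. *)
Lemma approx_tail (G : R -> R) s : leb.-integrable I (EFin \o G) -> 0 < s < T ->
  (\int[leb]_(r in I) (G r * step (n.+1%:R * r + - (n.+1%:R * s)))) @[n --> \oo] -->
  \int[leb]_(r in `]s, T[) G r.
Proof.
move=> IG /andP[s0 sT].
have mG : measurable_fun I G by apply/measurable_EFinP; exact: measurable_int IG.
pose f n r := (G r * step (n.+1%:R * r + - (n.+1%:R * s)))%:E.
pose g r := ((G \_ `]s, T[) r)%:E.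
have subI : `]s, T[ `<=` I by apply: subset_itvr; rewrite bnd_simp ltW.
have mst : measurable (`]s, T[ : set B) by exact: measurable_itv.
have mf n : measurable_fun I (f n).
  apply/measurable_EFinP; apply: measurable_funM => //; apply: measurable_funTS.
  apply: elem_measurable; exact: (elem_aff n.+1%:R (- (n.+1%:R * s)) elem_step).
have mg : measurable_fun I g.
  apply/measurable_EFinP; apply: ((measurable_restrict G mst mI).1 _).
  by apply: measurable_funS mG => // x [].
have step_le1 x : `|step x| <= 1 :> R by have /andP[h1 h2] := step_itv x; rewrite ger0_norm.
have fg : {ae leb, forall x, I x -> f ^~ x @ \oo --> g x}.
  apply: nearW => r Ir; rewrite /f /g.
  have [rs|sr] := leP r s.
    rewrite patchE memNset/=; last by rewrite in_itv/= ltNge rs.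
    apply: cvg_near_cst; near=> n; rewrite step_le0 ?mulr0//.
    by rewrite -mulrBr mulr_ge0_le0// subr_le0.
  rewrite patchE mem_set/=; last by move: Ir; rewrite /= !in_itv/= sr => /andP[].
  apply: cvg_near_cst; near=> n; rewrite step_ge1 ?mulr1//.
  rewrite -mulrBr mulrC -ler_pdivrMr// div1r ltW//; near: n.
  have sr0 : 0 < r - s by rewrite subr_gt0.
  exact: (near_infty_natSinv_lt (PosNum sr0)).
have dom : {ae leb, forall x n, I x -> (`|f n x| <= (abse \o (EFin \o G)) x)%E}.
  apply: nearW => r n Ir; rewrite /f /= lee_fin normrM ler_piMr//.
have [_ _ +] := dominated_convergence mI mf mg fg (integrable_abse IG) dom.
have -> : (\int[leb]_(x in I) g x = (\int[leb]_(r in `]s, T[) G r)%:E)%E.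
  rewrite /g; under eq_integral do rewrite -[(_ _)%:E]/((EFin \o (G \_ `]s, T[)) _) -restrict_EFin.
  rewrite -integral_mkcondr (setIidr subI) fineK//.
  by apply: integrable_fin_num => //; exact: integrableS IG.
by move=> /fine_cvgP[_].
Unshelve. all: by end_near. Qed.

End WeakDerivative.

(** * The square of an integral over the triangle *)

Section RealFubini.
Context {R : realType}.
Context d1 d2 (X : measurableType d1) (Y : measurableType d2).
Variables (m1 : {sigma_finite_measure set X -> \bar R}).
Variables (m2 : {sigma_finite_measure set Y -> \bar R}).

Lemma Rfubini2 (f : X * Y -> R) :
  (m1 \x m2)%E.-integrable setT (EFin \o f) ->
  \int[(m1 \x m2)%E]_z f z = \int[m2]_y \int[m1]_x f (x, y).
Proof.
rewrite -setXTT => If.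
by have [_ _ ->] := fubini_setX measurableT measurableT If.
Qed.

(** The slices along the second variable are integrable for almost every x
    only; elsewhere the real integral is an arbitrary finite value. *)
Lemma Rfubini1 (f : X * Y -> R) :
  (m1 \x m2)%E.-integrable setT (EFin \o f) ->
  m1.-integrable setT (fun x => (\int[m2]_y f (x, y))%:E) /\
  \int[(m1 \x m2)%E]_z f z = \int[m1]_x \int[m2]_y f (x, y).
Proof.
move=> If.
have ae1 := ae_integrable1 If.
have IF := integrable_fubini_F If.
have aeE : {ae m1, forall x, fubini_F m2 (EFin \o f) x = (\int[m2]_y f (x, y))%:E}.
  by apply: filterS ae1 => x Ix; rewrite /Rintegral fineK// integrable_fin_num.
have mI : measurable_fun setT (fun x => (\int[m2]_y f (x, y))%:E).
  apply/measurable_EFinP.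
  by apply: measurableT_comp => //=; exact: measurable_int IF.
split.
  apply/integrableP; split => //; move/integrableP : IF => [_]; apply: le_lt_trans.
  apply: ge0_le_integral_any => // x _.
  by rewrite /fubini_F /Rintegral; case: integral => //= *; rewrite ?normr0 ?leey.
rewrite /Rintegral; congr fine; rewrite -integral12_prod_meas1//.
apply: ae_eq_integral => //; first exact: measurable_int IF.
by apply: filterS aeE => x Hx _.
Qed.
End RealFubini.

Section Triangle.
Context {R : realType}.
Local Notation B := (measurableTypeR R).
Local Notation leb := (@lebesgue_measure R).

Definition upper_integral (g : R -> R) (x : R) : R := \int[leb]_(y in `]x, +oo[) g y.

(** The square of the integral is the integral of g (x) g (y) over the plane.
    The diagonal is negligible, and the two triangles x < y and y < x
    contribute equally. *)
Lemma sqr_integral_triangle (g : R -> R) : leb.-integrable setT (EFin \o g) ->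
  leb.-integrable setT (EFin \o (fun x => g x * upper_integral g x)) /\
  (\int[leb]_x g x) ^+ 2 = 2 * \int[leb]_x (g x * upper_integral g x).
Proof.
move=> Ig.
have mg : measurable_fun (setT : set B) g by apply/measurable_EFinP; exact: measurable_int Ig.
pose gg (z : B * B) := g z.1 * g z.2.
have mgg : measurable_fun setT gg.
  by apply: measurable_funM; apply: measurableT_comp.
have mag : measurable_fun (setT : set B) (fun x => `|(g x)%:E|)%E.
  by apply: measurableT_comp => //; exact/measurable_EFinP.
have Igg : (leb \x leb)%E.-integrable setT (EFin \o gg).
  apply/(integrable12ltyP leb leb); first exact/measurable_EFinP.
  have ag : (\int[leb]_x `|(g x)%:E| < +oo)%E by move/integrableP: Ig => [].
  rewrite (_ : (\int[leb]_x _)%E = \int[leb]_x (`|(g x)%:E| * \int[leb]_y `|(g y)%:E|))%E.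
    rewrite ge0_integralZr//; last by apply: integral_ge0.
    by rewrite lte_mul_pinfty ?ge0_fin_numE//; apply: integral_ge0.
  apply: eq_integral => x _; rewrite -ge0_integralZl//.
  by apply: eq_integral => y _; rewrite /gg /= normrM EFinM.
pose up : set (B * B) := [set z | z.1 < z.2].
have mup : measurable up.
  rewrite -[up]setTI (_ : up = [set z | (z.1%:E < z.2%:E)%E]); last first.
    by apply/seteqP; split => z /=; rewrite lte_fin.
  by apply: measurable_lte => //; apply/measurable_EFinP.
have I1 : (leb \x leb)%E.-integrable setT (EFin \o (fun z => gg z * \1_up z)).
  apply: (integrable_bounded_mul measurableT Igg (C := 1)) => // z _.
  by rewrite indicE; case: (_ \in _); rewrite ?normr1 ?normr0.
have I2 : (leb \x leb)%E.-integrable setT (EFin \o (fun z => gg z * \1_(~` up) z)).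
  apply: (integrable_bounded_mul measurableT Igg (C := 1)) => //.
    by apply: measurable_indic; exact: measurableC.
  by move=> z _; rewrite indicE; case: (_ \in _); rewrite ?normr1 ?normr0.
have [J1 E1] := Rfubini1 I1.
have E2 := Rfubini2 I2.
have [_ E3] := Rfubini1 Igg.
have in1 x : \int[leb]_y (gg (x, y) * \1_up (x, y)) = g x * upper_integral g x.
  rewrite /upper_integral -RintegralZl//; last by apply: integrableS Ig => //; exact: measurable_itv.
  rewrite [RHS]Rintegral_mkcond; apply: eq_Rintegral => y _.
  rewrite patchE indicE /gg /=.
  have [xy|xy] := ltP x y.
    by rewrite !mem_set//= ?in_itv/= ?xy// mulr1.
  by rewrite !memNset//= ?in_itv/= ?andbT ?mulr0//; apply/negP; rewrite -leNgt.
have in2 y : \int[leb]_x (gg (x, y) * \1_(~` up) (x, y)) = g y * upper_integral g y.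
  have -> : upper_integral g y = \int[leb]_(x in `[y, +oo[) g x.
    rewrite /upper_integral -Rintegral_itv_obnd_cbnd//; by apply: integrableS Ig => //; exact: measurable_itv.
  rewrite -RintegralZl//; last by apply: integrableS Ig => //; exact: measurable_itv.
  rewrite [RHS]Rintegral_mkcond; apply: eq_Rintegral => x _.
  rewrite patchE indicE /gg /= mulrC (mulrC (g x)).
  have [xy|xy] := leP y x.
    by rewrite !mem_set//= ?in_itv/= ?xy ?mul1r//; apply/negP; rewrite -leNgt.
  by rewrite !memNset//= ?in_itv/= ?andbT ?mul0r//; apply/negP; rewrite -ltNge.
split.
  by move: J1; under eq_fun do rewrite in1.
have E4 : \int[(leb \x leb)%E]_z gg z = \int[(leb \x leb)%E]_z (gg z * \1_up z) +
    \int[(leb \x leb)%E]_z (gg z * \1_(~` up) z).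
  rewrite -RintegralD//; apply: eq_Rintegral => z _.
  by rewrite -mulrDr !indicE in_setC; case: (_ \in _); rewrite /= ?addr0 ?add0r mulr1.
have F1 : \int[(leb \x leb)%E]_z (gg z * \1_up z) = \int[leb]_x (g x * upper_integral g x).
  by rewrite E1; apply: eq_Rintegral => x _; exact: in1.
have F2 : \int[(leb \x leb)%E]_z (gg z * \1_(~` up) z) = \int[leb]_x (g x * upper_integral g x).
  by rewrite E2; apply: eq_Rintegral => x _; exact: in2.
move: E4; rewrite F1 F2 E3.
have -> : \int[leb]_x \int[leb]_y gg (x, y) = (\int[leb]_x g x) ^+ 2.
  rewrite expr2 -RintegralZr//; apply: eq_Rintegral => x _.
  by rewrite -RintegralZl.
by move=> ->; ring.
Qed.

End Triangle.

(** * Weak time derivatives and their squares *)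

Section WeakRep.
Context {R : realType}.
Local Notation B := (measurableTypeR R).
Local Notation leb := (@lebesgue_measure R).
Variable T : R.
Hypothesis T0 : 0 < T.
Local Notation I := (`]0, T[%classic : set B).

Let mI : measurable I. Proof. exact: measurable_itv. Qed.

(** G is the weak derivative of A on ]0, T[; the test functions are taken in the
    class [elem]. *)
Definition weakd (A G : R -> R) := forall psi : R -> R, elem psi ->
  (exists l r, [/\ 0 < l, r < T & forall t, psi t != 0 -> l <= t <= r]) ->
  \int[leb]_(t in I) (A t * derive1 psi t + G t * psi t) = 0.

(** Up to the sign, the primitive that vanishes at T; starting from the right
    end matches [upper_integral]. *)
Definition tail (G : R -> R) (s : R) := \int[leb]_(r in `]s, T[) G r.

Lemma ae_exists (P : R -> Prop) : {ae leb, forall x, P x} -> exists2 x, 0 < x < T & P x.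
Proof.
move=> [N [mN N0 PN]]; apply: contrapT => nP.
have IN : I `<=` N.
  move=> x /=; rewrite in_itv/= => xT; apply: PN => /= Px.
  by apply: nP; exists x.
have : (leb I <= leb N)%E by apply: le_measure => //; rewrite inE.
by rewrite N0 lebesgue_measure_itv/= lte_fin T0 -EFinB lee_fin subr0 leNgt T0.
Qed.

Lemma Iin s : I s -> 0 < s < T. Proof. by rewrite /= in_itv. Qed.

Lemma integrable_tail (G : R -> R) s : leb.-integrable I (EFin \o G) -> 0 < s ->
  leb.-integrable `]s, T[ (EFin \o G).
Proof.
move=> IG s0; apply: integrableS IG => //.
by apply: subset_itvr; rewrite bnd_simp ltW.
Qed.

(** Testing with the difference of two smooth steps starting at s and at a
    fixed t, and letting the steps become sharp, gives A s - A t as the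
    difference of the tails at every Lebesgue point. *)
Lemma weak_rep (A G : R -> R) : leb.-integrable I (EFin \o A) ->
  leb.-integrable I (EFin \o G) -> weakd A G ->
  exists c, {ae leb, forall s, I s -> A s = c - tail G s}.
Proof.
move=> IA IG wAG.
have pts : {ae leb, forall x, lebesgue_pt (A \_ I) x}.
  exact: lebesgue_differentiation (integrable_locally mI IA).
have [t tT pt] := ae_exists pts.
exists (A t + tail G t); have aef : Filter (almost_everywhere leb).
  exact: ae_filter_ringOfSetsType.
apply: filterS pts => s ps /Iin sT.
pose stp n s0 r := step (n.+1%:R * r + - (n.+1%:R * s0)) : R.
have estp n s0 : elem (stp n s0).
  exact: (elem_aff n.+1%:R (- (n.+1%:R * s0)) elem_step).
have stp01 n s0 r : `|stp n s0 r| <= 1.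
  by have /andP[h1 h2] := step_itv (n.+1%:R * r + - (n.+1%:R * s0)); rewrite ger0_norm.
have Istp n s0 : leb.-integrable I (EFin \o (fun r => G r * stp n s0 r)).
  apply: (integrable_bounded_mul mI IG) => [|r _]; last exact: stp01.
  by apply: measurable_funTS; apply: elem_measurable.
have [C C0 HC] := @dstep_bounded R.
have Ikern n s0 : leb.-integrable I (EFin \o (fun r => A r * time_kernel n s0 r)).
  apply: (integrable_bounded_mul mI IA (C := n.+1%:R * C)) => [|r _].
    by apply: measurable_funTS; apply: elem_measurable; exact: elem_time_kernel.
  by rewrite /time_kernel normrM ger0_norm// ler_wpM2l.
pose a n s0 := \int[leb]_(r in I) (A r * time_kernel n s0 r).
pose b n s0 := \int[leb]_(r in I) (G r * stp n s0 r).
have lim : ((a n s - a n t) + (b n s - b n t)) @[n --> \oo] -->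
    ((A s - A t) + (tail G s - tail G t)).
  apply: cvgD; apply: cvgB.
  - exact: approx_point.
  - exact: approx_point.
  - exact: approx_tail.
  - exact: approx_tail.
have zero : \forall n \near \oo, (a n s - a n t) + (b n s - b n t) = 0.
  have Ts : 0 < T - s by rewrite subr_gt0; case/andP: sT.
  have Tt : 0 < T - t by rewrite subr_gt0; case/andP: tT.
  near=> n.
  have small s0 : 0 < T - s0 -> n.+1%:R^-1 < T - s0 -> s0 + n.+1%:R^-1 < T.
    by move=> _; rewrite ltrBrDl.
  have hs : s + n.+1%:R^-1 < T.
    by apply: small => //; near: n; exact: (near_infty_natSinv_lt (PosNum Ts)).
  have ht : t + n.+1%:R^-1 < T.
    by apply: small => //; near: n; exact: (near_infty_natSinv_lt (PosNum Tt)).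
  have N0 : 0 < n.+1%:R :> R by [].
  have stp0 s0 r : r <= s0 -> stp n s0 r = 0.
    by move=> rs; rewrite /stp step_le0// -mulrBr mulr_ge0_le0// subr_le0.
  have stp1 s0 r : s0 + n.+1%:R^-1 <= r -> stp n s0 r = 1.
    by move=> rs; rewrite /stp step_ge1// -mulrBr mulrC -ler_pdivrMr// div1r lerBrDl.
  (* both steps are 0 near 0 and 1 near T, so their difference has compact support *)
  pose psi r := stp n s r + -1 * stp n t r.
  have epsi : elem psi by apply: elem_add => //; exact: elem_scale.
  have /(wAG psi epsi) : exists l r, [/\ 0 < l, r < T & forall x, psi x != 0 -> l <= x <= r].
    exists (Num.min s t), (Num.max (s + n.+1%:R^-1) (t + n.+1%:R^-1)); split.
    - by rewrite lt_min; case/andP: sT => ->; case/andP: tT => ->.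
    - by rewrite gt_max hs ht.
    - move=> x; apply: contraNT; rewrite negb_and -!ltNge => /orP[|].
        rewrite lt_min => /andP[xs xt]; rewrite /psi !stp0 ?ltW//; lra.
      rewrite gt_max => /andP[xs xt]; rewrite /psi !stp1 ?ltW//; lra.
  rewrite /psi derive1_add//; last exact: elem_scale.
  rewrite derive1_scale// !time_kernel_derive.
  have -> : \int[leb]_(r in I) (A r * (time_kernel n s r + -1 * time_kernel n t r) +
      G r * (stp n s r + -1 * stp n t r)) =
    \int[leb]_(r in I) ((A r * time_kernel n s r - A r * time_kernel n t r) +
      (G r * stp n s r - G r * stp n t r)).
    by apply: eq_Rintegral => r _; ring.
  rewrite RintegralD//.
  - by rewrite RintegralB// RintegralB.
  - exact: (integrableB mI (Ikern n s) (Ikern n t)).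
  - exact: (integrableB mI (Istp n s) (Istp n t)).
have E : (A s - A t) + (tail G s - tail G t) = 0.
  exact: (cvg_unique _ lim (cvg_near_cst _ zero)).
move: E; move: (A s) (A t) (tail G s) (tail G t) => x1 x2 x3 x4; lra.
Unshelve. all: by end_near. Qed.

(** With A = c - tail G almost everywhere, A^2 = c^2 - 2 c tail G + (tail G)^2,
    and (tail G)^2 is twice the tail of G * tail G by
    [sqr_integral_triangle].  The representative A' = c - tail G is defined
    everywhere, which makes the integrability of A' G available. *)
Lemma weak_square (A G : R -> R) : leb.-integrable I (EFin \o A) ->
  leb.-integrable I (EFin \o G) -> weakd A G ->
  exists A' c, [/\ {ae leb, forall s, I s -> A s = A' s},
    leb.-integrable I (EFin \o (fun s => A' s * G s)) &
    {ae leb, forall s, I s -> A s ^+ 2 = c - 2 * tail (fun r => A' r * G r) s}].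
Proof.
move=> IA IG wAG; have [c Ac] := weak_rep IA IG wAG.
have tri s : 0 <= s ->
    leb.-integrable `]s, T[ (EFin \o (fun r => G r * tail G r)) /\
    tail G s ^+ 2 = 2 * tail (fun r => G r * tail G r) s.
  move=> s0; have mst : measurable (`]s, T[ : set B) by exact: measurable_itv.
  have Ist : leb.-integrable `]s, T[ (EFin \o G).
    apply: integrableS IG => //; apply: subset_itvr.
    by rewrite bnd_simp.
  have Ig : leb.-integrable setT (EFin \o (G \_ `]s, T[)).
    by rewrite -restrict_EFin; apply/(integrable_mkcond _ mst).
  have [It] := sqr_integral_triangle Ig.
  have up r : `]s, T[%classic r -> upper_integral (G \_ `]s, T[) r = tail G r.
    move=> /= ; rewrite in_itv/= => /andP[sr rT].
    rewrite /upper_integral -Rintegral_mkcondr /tail; congr (Rintegral _ _ _).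
    apply/seteqP; split => x /=; rewrite !in_itv/= ?andbT.
      by move=> [rx /andP[_ ->]]; rewrite rx.
    by move=> /andP[rx ->]; rewrite rx (lt_trans sr rx).
  have E : (fun r => (G \_ `]s, T[) r * upper_integral (G \_ `]s, T[) r) =
      (fun r => G r * tail G r) \_ `]s, T[.
    apply/funext => r; rewrite !patchE; case: ifPn => [|_]; last by rewrite mul0r.
    by rewrite inE => /up ->.
  move: It; rewrite E -restrict_EFin => /(integrable_mkcond _ mst) It.
  by rewrite -!Rintegral_mkcond.
have [I0 _] := tri 0 (lexx _).
exists (fun s => c - tail G s), (c ^+ 2); split => //.
- have : leb.-integrable I (EFin \o (fun r => c * G r - G r * tail G r)).
    exact: (integrableB mI (integrableZl mI c IG) I0).
  by apply: eq_integrable => // r _ /=; congr EFin; ring.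
- apply: filterS Ac => s As Is; rewrite As//; have /andP[s0 sT] := Iin Is.
  have [Is1 E] := tri s (ltW s0).
  have IGs := integrable_tail IG s0.
  have mst : measurable (`]s, T[ : set B) by exact: measurable_itv.
  have -> : tail (fun r => (c - tail G r) * G r) s = c * tail G s -
      tail (fun r => G r * tail G r) s.
    rewrite /tail -RintegralZl// -RintegralB//; last exact: (integrableZl mst c IGs).
    by apply: eq_Rintegral => r _; rewrite /tail; ring.
  rewrite sqrrB E; ring.
Qed.

End WeakRep.

(** * Powers of the cosine as finite sums of products *)

Section Kernel.
Context {R : realType}.
Local Notation leb := (@lebesgue_measure R).
Implicit Types (x y s : R) (m : nat).

Lemma elem_exp (f : R -> R) m : elem f -> elem (fun x => f x ^+ m).
Proof.
move=> ef; elim: m => [|m IH].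
  by under eq_fun do rewrite expr0; exact: elem_cst.
by under eq_fun do rewrite exprS; exact: elem_mul.
Qed.

Lemma elem_prod (I : Type) (r : seq I) (f : I -> R -> R) :
  (forall i, elem (f i)) -> elem (fun x => \prod_(i <- r) f i x).
Proof.
move=> ef; elim: r => [|i r IH].
  by under eq_fun do rewrite big_nil; exact: elem_cst.
by under eq_fun do rewrite big_cons; exact: elem_mul.
Qed.

Lemma elem_sum (I : Type) (r : seq I) (f : I -> R -> R) :
  (forall i, elem (f i)) -> elem (fun x => \sum_(i <- r) f i x).
Proof.
move=> ef; elim: r => [|i r IH].
  by under eq_fun do rewrite big_nil; exact: elem_cst.
by under eq_fun do rewrite big_cons; exact: elem_add.
Qed.

Lemma derive1_sum (I : Type) (r : seq I) (f : I -> R -> R) x :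
  (forall i, elem (f i)) ->
  derive1 (fun x => \sum_(i <- r) f i x) x = \sum_(i <- r) derive1 (f i) x.
Proof.
move=> ef; elim: r => [|i r IH].
  under eq_fun do rewrite big_nil; rewrite big_nil derive1E.
  by rewrite (_ : (fun=> 0) = cst 0)// derive_cst.
under eq_fun do rewrite big_cons; rewrite big_cons derive1_add//; last exact: elem_sum.
by rewrite IH.
Qed.

(** The three real Fourier modes 1, cos (2 pi x), sin (2 pi x) of cos^2 (pi x);
    the summand 0 gives the shape of an affine substitution in [elem]. *)
Definition trig (i : 'I_3) : R -> R :=
  if i == 0%N :> nat then fun=> 1
  else if i == 1%N :> nat then fun x => cos (2 * pi * x + 0)
  else fun x => sin (2 * pi * x + 0).

Lemma elem_trig i : elem (trig i).
Proof.
rewrite /trig; case: ifP => _; first exact: elem_cst.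
by case: ifP => _; [exact: elem_aff elem_cos|exact: elem_aff elem_sin].
Qed.

Lemma trig_periodic i : periodic1 (trig i).
Proof.
move=> x; rewrite /trig; case: ifP => // _.
have E : 2 * pi * (x + 1) + 0 = 2 * pi * x + 0 + pi *+ 2 :> R.
  by rewrite -[pi *+ 2]mulr_natl; ring.
by case: ifP => _; rewrite E mulr2n addrA ?cosDpi ?sinDpi opprK.
Qed.

Definition kap m s : R := cos (pi * s + 0) ^+ (2 * m).

Lemma elem_kap m : elem (kap m).
Proof. by apply: elem_exp; exact: elem_aff elem_cos. Qed.

Lemma cos_double x : 1 + cos (2 * x) = 2 * cos x ^+ 2 :> R.
Proof.
rewrite mulr_natl mulr2n cosD -expr2 -expr2.
have := cos2Dsin2 x; lra.
Qed.

(** 1 + cos (a) cos (b) + sin (a) sin (b) = 1 + cos (a - b) with a = 2 pi x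
    and b = 2 pi y. *)
Lemma trig_sum x y : \sum_i trig i x * trig i y = 2 * cos (pi * (x - y) + 0) ^+ 2.
Proof.
rewrite !big_ord_recl big_ord0 /trig /= !addr0 mulr1 -cos_double.
have -> : 2 * (pi * (x - y)) = 2 * pi * x - 2 * pi * y by ring.
by rewrite cosB addrA.
Qed.

(** A product of m modes; the index is an ordered choice of factors, so that a
    power of a sum expands without multiplicities. *)
Definition mono m (t : {ffun 'I_m -> 'I_3}) x : R := \prod_i trig (t i) x.

Lemma elem_mono m t : elem (@mono m t).
Proof. by apply: elem_prod => i; exact: elem_trig. Qed.

Lemma mono_periodic m t : periodic1 (@mono m t).
Proof. by move=> x; apply: eq_bigr => i _; exact: trig_periodic. Qed.

(** The m-th power of [trig_sum], expanded by distributivity. *)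
Lemma mono_sum m x y : \sum_t @mono m t x * mono t y = 2 ^+ m * kap m (x - y).
Proof.
transitivity (\prod_(i < m) \sum_j trig j x * trig j y).
  rewrite bigA_distr_bigA; apply: eq_bigr => t _.
  by rewrite /mono -big_split.
by rewrite prodr_const card_ord trig_sum exprMn /kap exprM.
Qed.

(** Differentiates the identity [mono_sum] in x. *)
Lemma derive1_mono_l m x y :
  \sum_t derive1 (@mono m t) x * mono t y = 2 ^+ m * derive1 (kap m) (x - y).
Proof.
have := derive1_sum (index_enum {ffun 'I_m -> 'I_3}) (f := fun t x => mono t y * mono t x) x
  (fun t => elem_scale (mono t y) (elem_mono t)).
under eq_fun do under eq_bigr do rewrite mulrC.
under eq_fun do rewrite mono_sum.
under [RHS]eq_bigr do rewrite (derive1_scale _ (elem_mono _)) mulrC.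
move=> <-.
have := derive1_aff 1 (- y) (elem_scale (2 ^+ m) (elem_kap m)).
under eq_fun do rewrite mul1r.
move=> ->; rewrite mul1r mul1r derive1_scale//; exact: elem_kap.
Qed.

Lemma kap_even m s : kap m (- s) = kap m s.
Proof. by rewrite /kap !addr0 mulrN cosN. Qed.

Lemma kap_periodic m : periodic1 (kap m).
Proof.
by move=> s; rewrite /kap !addr0 mulrDr mulr1 cosDpi exprM sqrrN -exprM.
Qed.

Lemma derive1_mono_r m x y :
  \sum_t @mono m t x * derive1 (mono t) y = - (2 ^+ m * derive1 (kap m) (x - y)).
Proof.
under eq_bigr do rewrite mulrC; rewrite derive1_mono_l -mulrN; congr (_ * _).
have := derive1_aff (-1) 0 (elem_kap m).
rewrite (_ : (fun x0 => kap m (-1 * x0 + 0)) = kap m); last first.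
  by apply/funext => s; rewrite addr0 mulN1r kap_even.
move=> /(congr1 (fun f => f (x - y))) ->.
by rewrite addr0 !mulN1r opprK opprB.
Qed.

Lemma is_derive_aff (a b x : R) : is_derive x 1 (fun y : R => a * y + b) a.
Proof.
have := is_deriveD (is_deriveM (is_derive_cst a x 1) (is_derive_id x 1)) (is_derive_cst b x 1).
by rewrite addr0 scaler0 addr0 /GRing.scale/= mulr1.
Qed.

Lemma derive1_kap m s :
  derive1 (kap m.+1) s = - (2 * pi * m.+1%:R * (cos (pi * s) * sin (pi * s)) * kap m s).
Proof.
rewrite derive1E.
have d1 : is_derive s 1 (fun y : R => cos (pi * y + 0)) (- sin (pi * s) * pi).
  have d0 := is_derive_aff pi 0 s.
  have := is_derive1_comp (f := @cos R) (g := fun y : R => pi * y + 0) (is_derive_cos _) d0.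
  by rewrite addr0.
have E : (2 * m.+1 = (2 * m).+2)%N by rewrite mulnS.
have := is_deriveX (2 * m).+2 d1 => -[_].
rewrite (_ : (fun y : R => cos (pi * y + 0)) ^+ (2 * m).+2 = kap m.+1); last first.
  by apply/funext => y; rewrite exprfctE /kap E.
have E2 : (2 * m).+2%:R = 2 * m.+1%:R :> R by rewrite -E natrM.
move=> ->; rewrite /GRing.scale/= /kap addr0 exprS E2.
ring.
Qed.

(** The normalising constant of the kernel [kap]. *)
Definition mass m : R := \int[leb]_(s in `[0, 1]) kap m s.
End Kernel.

(** * Moments of the powers of the cosine *)

Section Moments.
Context {R : realType}.
Local Notation B := (measurableTypeR R).
Local Notation leb := (@lebesgue_measure R).
Implicit Types (x y s : R) (m : nat).

Definition sn s : R := sin (pi * s + 0).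

Lemma elem_sn : elem sn. Proof. exact: elem_aff elem_sin. Qed.

Lemma kapS m s : kap m.+1 s = kap m s * (1 - sn s ^+ 2).
Proof.
rewrite /kap mulnS exprD mulrC; congr (_ * _); rewrite /sn.
by have := cos2Dsin2 (pi * s + 0); lra.
Qed.

Lemma kap_ge0 m s : 0 <= kap m s.
Proof. by rewrite /kap exprM exprn_ge0// sqr_ge0. Qed.

Lemma kap_le m s : kap m.+1 s <= kap m s.
Proof. by rewrite kapS ler_piMr ?kap_ge0// lerBlDr lerDl sqr_ge0. Qed.

Let Ikap m : leb.-integrable `[0, 1] (EFin \o kap m).
Proof. exact: elem_integrable (elem_kap m). Qed.

Let m01 : measurable (`[0, 1] : set B). Proof. exact: measurable_itv. Qed.

Lemma mass0 : mass 0 = 1 :> R.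
Proof.
rewrite /mass; under eq_Rintegral do rewrite /kap muln0 expr0.
by rewrite Rintegral_cst//= lebesgue_measure_itv/= lte_fin ltr01 mul1r oppr0 addr0.
Qed.

(** Wallis recursion: (cos^(2m+1) sin) (pi s) is periodic, so its derivative has integral
    0, and this derivative is pi times the difference of the integrands of
    the two sides. *)
Lemma massS m : (2 * m%:R + 2) * mass m.+1 = (2 * m%:R + 1) * mass m :> R.
Proof.
pose f s : R := cos (pi * s + 0) ^+ (2 * m).+1 * sn s.
have ecos : elem (fun s : R => cos (pi * s + 0)) by exact: elem_aff elem_cos.
have ef : elem f by apply: elem_mul; [exact: elem_exp|exact: elem_sn].
have df s : derive1 f s = pi * ((2 * m%:R + 2) * kap m.+1 s - (2 * m%:R + 1) * kap m s).
  rewrite derive1E.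
  have d0 := is_derive_aff pi 0 s.
  have d1 : is_derive s 1 (fun y : R => cos (pi * y + 0)) (- sn s * pi).
    exact: (is_derive1_comp (f := @cos R) (g := fun y : R => pi * y + 0) (is_derive_cos _) d0).
  have d2 : is_derive s 1 sn (cos (pi * s + 0) * pi).
    exact: (is_derive1_comp (f := @sin R) (g := fun y : R => pi * y + 0) (is_derive_sin _) d0).
  have := is_deriveM (is_deriveX (2 * m).+1 d1) d2 => -[_].
  rewrite (_ : (fun y : R => cos (pi * y + 0)) ^+ (2 * m).+1 * sn = f); last first.
    by apply/funext => y; rewrite /f mulrfctE exprfctE.
  move=> ->; rewrite exprfctE /GRing.scale/= kapS /kap exprS.
  have E : (2 * m).+1%:R = 2 * m%:R + 1 :> R by rewrite -natr1 natrM.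
  rewrite E; have := cos2Dsin2 (pi * s + 0); rewrite -/(sn s).
  move: (cos _) (sn s) m%:R => c d n cd; move: (c ^+ (2 * m)%N) => a.
  have -> : d ^+ 2 = 1 - c ^+ 2 by lra.
  transitivity (a * pi * (c ^+ 2 - (2 * n + 1) * d ^+ 2)); first by ring.
  have -> : d ^+ 2 = 1 - c ^+ 2 by lra.
  ring.
have := elem_FTC ef (@ltr01 R).
have -> : f 1 - f 0 = 0.
  by rewrite /f /sn !addr0 mulr1 mulr0 sinpi sin0 !mulr0 subr0.
have I1 := integrableZl m01 (2 * m%:R + 2) (Ikap m.+1).
have I2 := integrableZl m01 (2 * m%:R + 1) (Ikap m).
have -> : \int[leb]_(x in `[0, 1]) derive1 f x =
    pi * ((2 * m%:R + 2) * mass m.+1 - (2 * m%:R + 1) * mass m).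
  rewrite /mass -!RintegralZl// -RintegralB// -RintegralZl//.
    by apply: eq_Rintegral => s _; exact: df.
  exact: (integrableB m01 I1 I2).
move=> /eqP; rewrite mulf_eq0 gt_eqF ?pi_gt0//= subr_eq0 => /eqP //.
Qed.

Lemma mass_gt0 m : 0 < mass m :> R.
Proof.
elim: m => [|m IH]; first by rewrite mass0.
have m0 : 0 <= m%:R :> R by [].
have : 0 < (2 * m%:R + 2) * mass m.+1 :> R by rewrite massS mulr_gt0//; lra.
by rewrite pmulr_rgt0//; lra.
Qed.

(** Lets the normalisation at level m + 1 be replaced by the one at level m,
    up to a constant. *)
Lemma mass_half m : mass m <= 2 * mass m.+1 :> R.
Proof.
have m0 : 0 <= m%:R :> R by [].
have := massS m; have := mass_gt0 m; have := mass_gt0 m.+1; nra.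
Qed.

Lemma moment2 m : \int[leb]_(s in `[0, 1]) (kap m s * sn s ^+ 2) =
  mass m / (2 * m%:R + 2).
Proof.
have m0 : 0 <= m%:R :> R by [].
transitivity (mass m - mass m.+1 : R).
  rewrite /mass -RintegralB//; apply: eq_Rintegral => s _; rewrite kapS; ring.
have := massS m; move: (mass m) (mass m.+1) => a b ab.
have n0 : 2 * m%:R + 2 != 0 :> R by rewrite gt_eqF//; lra.
apply: (mulIf n0); rewrite divfK//; lra.
Qed.

Lemma moment4 m : \int[leb]_(s in `[0, 1]) (kap m s * sn s ^+ 4) =
  3 * mass m / ((2 * m%:R + 2) * (2 * m%:R + 4)).
Proof.
have m0 : 0 <= m%:R :> R by [].
have I2 := integrableZl m01 2 (Ikap m.+1).
transitivity (mass m - 2 * mass m.+1 + mass m.+2 : R).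
  rewrite /mass -RintegralZl// -RintegralB// -RintegralD//; last first.
    exact: (integrableB m01 (Ikap m) I2).
  apply: eq_Rintegral => s _; rewrite !kapS; ring.
have := massS m; have := massS m.+1; rewrite -[m.+1%:R]natr1.
move: (mass m) (mass m.+1) (mass m.+2) => a b c bc ab.
have n2 : 2 * m%:R + 2 != 0 :> R by rewrite gt_eqF//; lra.
have n4 : 2 * m%:R + 4 != 0 :> R by rewrite gt_eqF//; lra.
have -> : b = (2 * m%:R + 1) * a / (2 * m%:R + 2) by rewrite -ab; field.
have {}bc : (2 * m%:R + 4) * c = (2 * m%:R + 3) * b by lra.
have -> : c = (2 * m%:R + 3) * ((2 * m%:R + 1) * a / (2 * m%:R + 2)) / (2 * m%:R + 4).
  by apply: (mulfI n4); rewrite bc (_ : b = (2 * m%:R + 1) * a / (2 * m%:R + 2)); [field; rewrite n2 n4|rewrite -ab; field].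
by field; rewrite n2 n4.
Qed.

End Moments.

(** * The product kernel on the torus *)

Section Moments3.
Context {R : realType}.
Local Notation B := (measurableTypeR R).
Local Notation R3 := (R * R * R)%type.
Local Notation leb := (@lebesgue_measure R).
Implicit Types (a b c : R -> R) (m : nat).

Definition prod3 a b c (x : R3) : R := a x.1.1 * b x.1.2 * c x.2.

Lemma measurable_prod3 a b c : elem a -> elem b -> elem c ->
  measurable_fun (setT : set (B * B * B)) (prod3 a b c).
Proof.
move=> ea eb ec; have ma := elem_measurable ea; have mb := elem_measurable eb.
have mc := elem_measurable ec.
apply: measurable_funM; [apply: measurable_funM|].
- by apply: (measurableT_comp ma); exact: measurableT_comp.
- by apply: (measurableT_comp mb); exact: measurableT_comp.
- exact: (measurableT_comp mc).
Qed.

Lemma integral_prod3 a b c : elem a -> elem b -> elem c ->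
  (forall x, 0 <= a x) -> (forall x, 0 <= b x) -> (forall x, 0 <= c x) ->
  (\int[leb3]_(x in cube) (prod3 a b c x)%:E =
   ((\int[leb]_(x in `[0%R, 1%R]) a x) * (\int[leb]_(x in `[0%R, 1%R]) b x) *
    (\int[leb]_(x in `[0%R, 1%R]) c x))%R%:E)%E.
Proof.
move=> ea eb ec a0 b0 c0.
have m01 : measurable (`[0, 1] : set B) by exact: measurable_itv.
have fin f : elem f -> (\int[leb]_(x in `[0%R, 1%R]) (f x)%:E =
    (\int[leb]_(x in `[0%R, 1%R]) f x)%R%:E)%E.
  move=> ef; rewrite /Rintegral fineK//; apply: integrable_fin_num => //.
  exact: elem_integrable.
have Zr f (k : R) : elem f -> (\int[leb]_(x in `[0%R, 1%R]) (f x * k)%R%:E =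
    ((\int[leb]_(x in `[0%R, 1%R]) f x) * k)%R%:E)%E.
  move=> ef; rewrite -RintegralZr//; last exact: elem_integrable.
  by rewrite -fin//; apply: elem_mul => //; exact: elem_cst.
rewrite ge0_integral_cube; first last.
- by move=> x; rewrite lee_fin /prod3 !mulr_ge0.
- by apply/measurable_EFinP; exact: measurable_prod3.
pose A := \int[leb]_(x in `[0%R, 1%R]) a x.
pose Bb := \int[leb]_(x in `[0%R, 1%R]) b x.
transitivity (\int[leb]_(z in `[0%R, 1%R]) (c z * (A * Bb))%R%:E)%E; last first.
  by rewrite Zr// mulrC.
apply: eq_integral => z _.
transitivity (\int[leb]_(y in `[0%R, 1%R]) (b y * (A * c z))%R%:E)%E; last first.
  by rewrite Zr//; congr EFin; rewrite -/Bb; ring.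
apply: eq_integral => y _.
transitivity (\int[leb]_(x in `[0%R, 1%R]) (a x * (b y * c z))%R%:E)%E.
  by apply: eq_integral => x _; rewrite /prod3 /= mulrA.
by rewrite Zr//; congr EFin; rewrite -/A; ring.
Qed.

(** Equivalent to the distance to the integer lattice, but expressed by
    functions whose moments against [kap] are explicit. *)
Definition sumsn (x : R3) : R := `|sn x.1.1| + `|sn x.1.2| + `|sn x.2|.
(** The product kernel, of mass 1 on the torus. *)
Definition weight m : R3 -> R := fun x => prod3 (kap m) (kap m) (kap m) x / mass m ^+ 3.

Lemma weight_ge0 m x : 0 <= weight m x.
Proof.
rewrite /weight divr_ge0 ?exprn_ge0 ?(ltW (mass_gt0 _))//.
by rewrite /prod3 !mulr_ge0// kap_ge0.
Qed.

Local Open Scope ereal_scope.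

Lemma measurable_weight m : measurable_fun (setT : set (B * B * B)) (weight m).
Proof.
apply: measurable_funM => //.
by apply: measurable_prod3; exact: elem_kap.
Qed.

(** The kernel is a product, so the integral of a product factorises. *)
Lemma integral_weight_prod m a b c : elem a -> elem b -> elem c ->
  (forall x, 0 <= a x)%R -> (forall x, 0 <= b x)%R -> (forall x, 0 <= c x)%R ->
  \int[leb3]_(x in cube) (weight m x * prod3 a b c x)%:E =
  ((\int[leb]_(x in `[0%R, 1%R]) (kap m x * a x)) / mass m *
   ((\int[leb]_(x in `[0%R, 1%R]) (kap m x * b x)) / mass m) *
   ((\int[leb]_(x in `[0%R, 1%R]) (kap m x * c x)) / mass m))%R%:E.
Proof.
move=> ea eb ec a0 b0 c0; have ek := @elem_kap R m.
have i0 : (0 <= (mass m ^+ 3)^-1 :> R)%R.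
  by rewrite invr_ge0 exprn_ge0// ltW// mass_gt0.
transitivity (((mass m ^+ 3)^-1)%:E * \int[leb3]_(x in cube)
   (prod3 (fun x => kap m x * a x) (fun x => kap m x * b x) (fun x => kap m x * c x) x)%R%:E).
  rewrite -ge0_integralZl_EFin//.
  - apply: eq_integral => x _; rewrite -EFinM; congr EFin.
    rewrite /weight /prod3; ring.
  - exact: measurable_cube.
  - by move=> x _; rewrite lee_fin /prod3 !mulr_ge0// kap_ge0.
  - apply: measurable_funTS; apply/measurable_EFinP.
    by apply: measurable_prod3; exact: elem_mul.
rewrite (integral_prod3 (elem_mul ek ea) (elem_mul ek eb) (elem_mul ek ec)); first last.
- by move=> x; rewrite mulr_ge0 ?kap_ge0.
- by move=> x; rewrite mulr_ge0 ?kap_ge0.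
- by move=> x; rewrite mulr_ge0 ?kap_ge0.
rewrite -EFinM; congr EFin; field.
by rewrite gt_eqF// mass_gt0.
Qed.

Let one : R -> R := fun=> 1%R.
Let eone : elem one. Proof. exact: elem_cst. Qed.
Let one0 x : (0 <= one x)%R. Proof. exact: ler01. Qed.

Let mass1 m : ((\int[leb]_(x in `[0%R, 1%R]) (kap m x * one x)) / mass m = 1)%R.
Proof.
rewrite (_ : Rintegral _ _ _ = mass m) ?divff// ?gt_eqF ?mass_gt0//.
by apply: eq_Rintegral => x _; rewrite mulr1.
Qed.

Lemma weight_mass m : \int[leb3]_(x in cube) (weight m x)%:E = 1.
Proof.
have := integral_weight_prod m eone eone eone one0 one0 one0.
rewrite !mass1 !mul1r => <-.
by apply: eq_integral => x _; rewrite /prod3 /one !mulr1.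
Qed.

Lemma weight_sum m k (M : R) : ~~ odd k ->
  ((\int[leb]_(x in `[0%R, 1%R]) (kap m x * sn x ^+ k)) / mass m = M)%R ->
  \int[leb3]_(x in cube) (weight m x * (sn x.1.1 ^+ k + sn x.1.2 ^+ k + sn x.2 ^+ k))%:E
  = (3 * M)%R%:E.
Proof.
move=> ev EM.
have e : elem (fun x : R => sn x ^+ k)%R by apply: elem_exp; exact: elem_sn.
have e0 (x : R) : (0 <= sn x ^+ k)%R by rewrite exprn_even_ge0.
have mW := measurable_weight m.
have E1 := integral_weight_prod m e eone eone e0 one0 one0.
have E2 := integral_weight_prod m eone e eone one0 e0 one0.
have E3 := integral_weight_prod m eone eone e one0 one0 e0.
rewrite !mass1 EM in E1 E2 E3.
have mp a b c : elem a -> elem b -> elem c ->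
    measurable_fun (cube : set (B * B * B)) (fun x => (weight m x * prod3 a b c x)%R%:E).
  move=> ea eb ec; apply: measurable_funTS; apply/measurable_EFinP.
  by apply: measurable_funM => //; exact: measurable_prod3.
have p0 a b c : (forall x, 0 <= a x)%R -> (forall x, 0 <= b x)%R -> (forall x, 0 <= c x)%R ->
    forall x, cube x -> 0 <= (weight m x * prod3 a b c x)%R%:E.
  by move=> a0 b0 c0 x _; rewrite lee_fin mulr_ge0 ?weight_ge0// /prod3 !mulr_ge0.
transitivity (\int[leb3]_(x in cube) ((weight m x * prod3 (fun x => sn x ^+ k)%R one one x)%:E +
   (weight m x * prod3 one (fun x => sn x ^+ k)%R one x)%:E +
   (weight m x * prod3 one one (fun x => sn x ^+ k)%R x)%:E)).
  apply: eq_integral => x _; rewrite -!EFinD; congr EFin; rewrite /prod3 /one.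
  ring.
have mC := @measurable_cube R.
rewrite ge0_integralD//; [|by move=> x cx; rewrite adde_ge0// p0|
  by apply: emeasurable_funD; exact: mp|by apply: p0|exact: mp].
rewrite ge0_integralD//; [|exact: p0|exact: mp|exact: p0|exact: mp].
rewrite E1 E2 E3 -!EFinD; congr EFin; ring.
Qed.

End Moments3.

(** * Interpolation of powers and distances on the torus *)

Section KernelSmall.
Context {R : realType}.
Local Notation R3 := (R * R * R)%type.
Local Notation R4 := (R * R * R * R)%type.

(** For x <= l = e^(1/(p-a)) the first term dominates, beyond l the second
    one does. *)
Lemma interpolation (a p b e : R) : a < p -> p < b -> 0 < e ->
  exists2 C, 0 <= C & forall x : R, 0 < x -> x `^ p <= e * x `^ a + C * x `^ b.
Proof.
move=> ap pb e0; pose l : R := e `^ (p - a)^-1.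
have l0 : 0 < l by exact: powR_gt0.
have pa : 0 < p - a by rewrite subr_gt0.
have le : l `^ (p - a) = e by rewrite /l -powRrM mulVf ?gt_eqF// powRr1// ltW.
exists (l `^ (p - b)); first exact: powR_ge0.
move=> x x0; have xn : (x == 0) = false by rewrite gt_eqF.
have [xl|lx] := leP x l.
- apply: (@le_trans _ _ (e * x `^ a)); last by rewrite lerDl mulr_ge0 ?powR_ge0.
  have -> : p = (p - a) + a by rewrite subrK.
  rewrite powRD ?xn ?implybT// ler_wpM2r ?powR_ge0// -le.
  by apply: ge0_ler_powR; rewrite ?nnegrE ?(ltW l0) ?(ltW x0) ?(ltW pa).
- apply: (@le_trans _ _ (l `^ (p - b) * x `^ b)); last first.
    by rewrite lerDr mulr_ge0 ?powR_ge0 ?(ltW e0).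
  have {1}-> : p = (p - b) + b by rewrite subrK.
  rewrite powRD ?xn ?implybT// ler_wpM2r ?powR_ge0//.
  rewrite -[p - b]opprB !powRN lef_pV2 ?posrE ?powR_gt0//.
  by rewrite ge0_ler_powR ?nnegrE ?subr_ge0 ?ltW.
Qed.

(** The power 1 + 2s lies strictly between 2 and 4: only the second and the
    fourth moments of the kernel have to be computed. *)
Lemma interpolation_2_4 (s e : R) : 2^-1 < s < 1 -> 0 < e ->
  exists2 C, 0 <= C & forall x : R, 0 <= x -> x * (x `^ s) ^+ 2 <= e * x ^+ 2 + C * x ^+ 4.
Proof.
move=> /andP[s1 s2] e0.
have [C C0 H] := @interpolation 2 (1 + s * 2) 4 e ltac:(lra) ltac:(lra) e0.
exists C => // x; rewrite le_eqVlt => /predU1P[<-|x0].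
  by rewrite mul0r !expr0n !mulr0 addr0.
have := H x x0; rewrite powRD; last by rewrite (gt_eqF x0) implybT.
by rewrite powRr1 ?(ltW x0)// powRrM !powR_mulrn ?powR_ge0 ?(ltW x0).
Qed.

Lemma interpolation_0_2 (s e : R) : 2^-1 < s < 1 -> 0 < e ->
  exists2 C, 0 <= C & forall x : R, 0 <= x -> (x `^ s) ^+ 2 <= e + C * x ^+ 2.
Proof.
move=> /andP[s1 s2] e0.
have [C C0 H] := @interpolation 0 (s * 2) 2 e ltac:(lra) ltac:(lra) e0.
exists C => // x; rewrite le_eqVlt => /predU1P[<-|x0].
  by rewrite powR0 ?gt_eqF ?expr0n ?mulr0 ?addr0 ?(ltW e0)//; lra.
have := H x x0.
by rewrite powRr0 mulr1 powRrM !powR_mulrn ?powR_ge0 ?(ltW x0).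
Qed.

(** On [0, 1/2], from tan z >= z for z = pi y at most pi / 2, in the
    form z cos z <= sin z given by the mean value theorem. *)
Lemma le_sn (y : R) : 0 <= y <= 2^-1 -> y <= 2 * sn y.
Proof.
move=> /andP[y0 y1].
have [->|yn0] := eqVneq y 0; first by rewrite /sn mulr0 addr0 sin0 mulr0.
have {yn0}y0 : 0 < y by rewrite lt_neqAle eq_sym yn0.
have pi2 := @pi_ge2 R; have pi4 : pi < 4 :> R by have := @pihalf_lt2 R; lra.
have pi0 := @pi_gt0 R.
have z0 : 0 < pi * y by rewrite mulr_gt0.
have z2 : pi * y <= pi / 2 by rewrite ler_pM2l.
have S0 : 0 <= sin (pi * y) by apply: sin_ge0_pi; rewrite (ltW z0)/=; lra.
have C0 : 0 <= cos (pi * y) by apply: cos_ge0_pihalf; apply/andP; split; lra.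
have key : pi * y * cos (pi * y) <= sin (pi * y).
  have [c /[!in_itv]/= /andP[c0 cz] E] : exists2 c, c \in `]0, pi * y[%R &
      sin (pi * y) - sin 0 = cos c * (pi * y - 0).
    have cs : {within `[0, pi * y], continuous (@sin R)}.
      by apply: continuous_subspaceT => x; exact: continuous_sin.
    exact: (@MVT _ (@sin R) (@cos R) 0 (pi * y) z0 (fun x _ => is_derive_sin x) cs).
  move: E; rewrite sin0 !subr0 => ->; rewrite mulrC ler_wpM2r ?(ltW z0)//.
  by rewrite ltW// ltr_cos// in_itv/=; apply/andP; split; lra.
rewrite /sn addr0; have := cos2Dsin2 (pi * y).
move: (cos _) (sin _) C0 S0 key => c d c0 d0 key cd.
have k2 : (pi * y) ^+ 2 * c ^+ 2 <= d ^+ 2.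
  by rewrite -exprMn lerXn2r ?nnegrE ?mulr_ge0 ?(ltW pi0) ?(ltW y0).
rewrite -ler_sqr ?nnegrE ?mulr_ge0 ?(ltW y0)// exprMn.
have py : 2 * y <= pi * y by rewrite ler_wpM2r// ltW.
have pz : pi * y <= 2 by lra.
move: (pi * y) z0 key k2 py pz {z2} => z z0 key k2 py pz.
have : (2 * y) ^+ 2 <= z ^+ 2 by rewrite lerXn2r ?nnegrE ?mulr_ge0 ?(ltW y0) ?(ltW z0).
have : z ^+ 2 <= 4 by nra.
have := sqr_ge0 d; nra.
Qed.

Lemma periodic_rep (x : R) : 0 <= x <= 1 -> exists n : bool, `|x - n%:R| <= 2 * `|sn x|.
Proof.
move=> /andP[x0 x1]; have [xh|xh] := leP x 2^-1.
- exists false; rewrite subr0 ger0_norm//; apply: le_trans (@le_sn x _) _.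
    by rewrite x0.
  by rewrite ler_pM2l// ler_norm.
- exists true; rewrite ler0_norm ?subr_le0// opprB.
  apply: le_trans (@le_sn (1 - x) _) _; first by apply/andP; split; lra.
  rewrite ler_pM2l// (le_trans (ler_norm _))// /sn !addr0 mulrBr mulr1 sinB sinpi cospi.
  by rewrite mul0r sub0r mulN1r opprK.
Qed.

Lemma increment_periodic (f : R4 -> R) (x : R3) q (n1 n2 n3 : bool) : torus_function f ->
  increment f (x.1.1 - n1%:R, x.1.2 - n2%:R, x.2 - n3%:R) q = increment f x q.
Proof.
move=> [f1 f2]; case: x => [[a b] c]; case: q => [[[x y] z] t].
rewrite /increment /=; congr (_ - _).
have s1 a' b' c' (n : bool) : f (a' - n%:R, b', c', t) = f (a', b', c', t).
  by case: n; rewrite ?subr0//; have [<- _] := f1 (a' - 1) b' c' t; rewrite subrK.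
have s2 a' b' c' (n : bool) : f (a', b' - n%:R, c', t) = f (a', b', c', t).
  by case: n; rewrite ?subr0//; have [_ <-] := f1 a' (b' - 1) c' t; rewrite subrK.
have s3 a' b' c' (n : bool) : f (a', b', c' - n%:R, t) = f (a', b', c', t).
  by case: n; rewrite ?subr0// -(f2 _ _ (c' - 1)) subrK.
transitivity (f (x + a - n1%:R, y + b - n2%:R, z + c - n3%:R, t)).
  rewrite -[LHS]/(f (x + (a - n1%:R), y + (b - n2%:R), z + (c - n3%:R), t)).
  by rewrite !addrA.
by rewrite s1 s2 s3.
Qed.

(** Each coordinate in [0, 1] is replaced by the nearer of its translates by 0
    and -1; increments of functions on the torus do not change. *)
Lemma cube_rep (x : R3) : cube x -> exists2 x' : R3, enorm x' <= 2 * sumsn x &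
  forall (f : R4 -> R) q, torus_function f -> increment f x' q = increment f x q.
Proof.
move=> [[]] /=; rewrite !in_itv/= => /periodic_rep[n1 h1] /periodic_rep[n2 h2] /periodic_rep[n3 h3].
exists (x.1.1 - n1%:R, x.1.2 - n2%:R, x.2 - n3%:R); last first.
  by move=> f q; exact: increment_periodic.
rewrite /enorm /sumsn /= !mulrDr.
move: (x.1.1 - n1%:R) (x.1.2 - n2%:R) (x.2 - n3%:R) h1 h2 h3 => a b c.
move: (2 * `|sn x.1.1|) (2 * `|sn x.1.2|) (2 * `|sn x.2|) => A B' C ha hb hc.
have A0 := le_trans (normr_ge0 _) ha; have B0 := le_trans (normr_ge0 _) hb.
have C0 := le_trans (normr_ge0 _) hc.
have sq (y Y : R) : `|y| <= Y -> y ^+ 2 <= Y ^+ 2.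
  by move=> yY; rewrite -[y ^+ 2]real_normK ?num_real// lerXn2r ?nnegrE// (le_trans _ yY).
rewrite -[leRHS]ger0_norm ?addr_ge0// -sqrtr_sqr ler_wsqrtr//.
have := sq _ _ ha; have := sq _ _ hb; have := sq _ _ hc.
have := mulr_ge0 A0 B0; have := mulr_ge0 A0 C0; have := mulr_ge0 B0 C0.
nra.
Qed.

End KernelSmall.

(** * Smallness of the kernel averages *)

Section KernelLimits.
Context {R : realType}.
Local Notation B := (measurableTypeR R).
Local Notation R3 := (R * R * R)%type.

(** The partial derivative in the first variable of [weight] at level m + 1. *)
Definition dker1 m : R3 -> R := fun x =>
  prod3 (derive1 (kap m.+1)) (kap m.+1) (kap m.+1) x / mass m.+1 ^+ 3.
Definition dker2 m : R3 -> R := fun x =>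
  prod3 (kap m.+1) (derive1 (kap m.+1)) (kap m.+1) x / mass m.+1 ^+ 3.
Definition dker3 m : R3 -> R := fun x =>
  prod3 (kap m.+1) (kap m.+1) (derive1 (kap m.+1)) x / mass m.+1 ^+ 3.

(** One of the factors cos of the derivative of the power is dropped, and the
    power at level m remains: differentiation costs a factor m |sin (pi s)|. *)
Lemma derive1_kap_bound m (s : R) :
  `|derive1 (kap m.+1) s| <= 2 * pi * m.+1%:R * (`|sn s| * kap m s).
Proof.
rewrite derive1_kap normrN normrM (ger0_norm (kap_ge0 m s)).
rewrite [in leRHS]mulrA ler_wpM2r ?kap_ge0// normrM ger0_norm; last first.
  by rewrite !mulr_ge0// pi_ge0.
rewrite ler_wpM2l ?mulr_ge0 ?pi_ge0// normrM /sn addr0 ler_piMl//.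
by rewrite ler_norml cos_geN1 cos_le1.
Qed.

Definition kconst m : R := 16 * pi * m.+1%:R.

Lemma kconst_ge0 m : 0 <= kconst m.
Proof. by rewrite /kconst !mulr_ge0// pi_ge0. Qed.

Lemma dker_bound_aux m (a b c : R -> R) (x : R3) :
  (forall s, `|a s| <= 2 * pi * m.+1%:R * (`|sn s| * kap m s)) ->
  (forall s, `|b s| <= kap m s) -> (forall s, `|c s| <= kap m s) ->
  forall x1 x2 x3, `|a x1 * b x2 * c x3| / mass m.+1 ^+ 3 <=
    kconst m * (kap m x1 * kap m x2 * kap m x3 / mass m ^+ 3 * `|sn x1|).
Proof.
move=> ha hb hc x1 x2 x3.
have h3 : 0 < mass m.+1 ^+ 3 :> R by rewrite exprn_gt0// mass_gt0.
have h3' : 0 < mass m ^+ 3 :> R by rewrite exprn_gt0// mass_gt0.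
have mm : (mass m.+1 ^+ 3)^-1 <= 8 * (mass m ^+ 3)^-1 :> R.
  rewrite ler_pdivlMr// mulrC ler_pdivrMr// (_ : 8 = 2 ^+ 3); last by ring.
  rewrite -exprMn lerXn2r ?nnegrE ?mulr_ge0 ?(ltW (mass_gt0 _))//.
  exact: mass_half.
have k1 := kap_ge0 m x1; have k2 := kap_ge0 m x2; have k3 := kap_ge0 m x3.
set A := kap m x1 in k1 *; set Bb := kap m x2 in k2 *; set C := kap m x3 in k3 *.
have num : `|a x1 * b x2 * c x3| <= 2 * pi * m.+1%:R * (`|sn x1| * A) * Bb * C.
  rewrite !normrM; apply: ler_pM => //.
  by apply: ler_pM => //; exact: ha.
apply: (le_trans (ler_pM _ _ num mm)) => //.
  by rewrite invr_ge0 ltW.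
by rewrite le_eqVlt /kconst; apply/orP; left; apply/eqP; ring.
Qed.

Lemma kap_norm_le m (s : R) : `|kap m.+1 s| <= kap m s.
Proof. by rewrite ger0_norm ?kap_ge0// kap_le. Qed.

(** The gradient of the kernel at level m + 1 is at most of order
    m |xi| times the kernel at level m. *)
Lemma dker_bound m x :
  [/\ `|dker1 m x| <= kconst m * (weight m x * sumsn x),
      `|dker2 m x| <= kconst m * (weight m x * sumsn x) &
      `|dker3 m x| <= kconst m * (weight m x * sumsn x)].
Proof.
have h3 : 0 < mass m.+1 ^+ 3 :> R by rewrite exprn_gt0// mass_gt0.
have n1 := normr_ge0 (sn x.1.1); have n2 := normr_ge0 (sn x.1.2).
have n3 := normr_ge0 (sn x.2).
have mono (y : R) : 0 <= y -> y <= sumsn x -> kconst m * (weight m x * y) <= kconst m * (weight m x * sumsn x).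
  by move=> y0 yx; rewrite ler_wpM2l ?kconst_ge0// ler_wpM2l ?weight_ge0.
have D := @dker_bound_aux m _ _ _ x (@derive1_kap_bound m) (@kap_norm_le m) (@kap_norm_le m).
have inv : `|(mass m.+1 ^+ 3)^-1| = (mass m.+1 ^+ 3)^-1 :> R.
  by rewrite ger0_norm// invr_ge0 ltW.
split.
- apply: le_trans (mono `|sn x.1.1| _ _) => //; last by rewrite /sumsn; lra.
  by rewrite /dker1 normrM inv; exact: D.
- apply: le_trans (mono `|sn x.1.2| _ _) => //; last by rewrite /sumsn; lra.
  rewrite /dker2 normrM inv; have := D x.1.2 x.1.1 x.2.
  by congr (`|_| / _ <= _ * (_ / _ * _)); rewrite /prod3; ring.
- apply: le_trans (mono `|sn x.2| _ _) => //; last by rewrite /sumsn; lra.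
  rewrite /dker3 normrM inv; have := D x.2 x.1.1 x.1.2.
  by congr (`|_| / _ <= _ * (_ / _ * _)); rewrite /prod3; ring.
Qed.

Lemma sumsn_sq x : sumsn x ^+ 2 <= 3 * (sn x.1.1 ^+ 2 + sn x.1.2 ^+ 2 + sn x.2 ^+ 2) :> R.
Proof.
rewrite /sumsn -(real_normK (num_real (sn x.1.1))) -(real_normK (num_real (sn x.1.2)))
  -(real_normK (num_real (sn x.2))).
move: `|_| `|_| `|_| => a b c.
have := sqr_ge0 (a - b); have := sqr_ge0 (b - c); have := sqr_ge0 (a - c); nra.
Qed.

Lemma sumsn_4 x : sumsn x ^+ 4 <= 27 * (sn x.1.1 ^+ 4 + sn x.1.2 ^+ 4 + sn x.2 ^+ 4) :> R.
Proof.
have q0 := sumsn_sq x.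
have : (sumsn x ^+ 2) ^+ 2 <= (3 * (sn x.1.1 ^+ 2 + sn x.1.2 ^+ 2 + sn x.2 ^+ 2)) ^+ 2.
  by rewrite lerXn2r ?nnegrE ?mulr_ge0 ?addr_ge0 ?sqr_ge0.
rewrite -exprM => /le_trans; apply.
have E (y : R) : y ^+ 4 = (y ^+ 2) ^+ 2 by rewrite -exprM.
rewrite !E; move: (_ ^+ 2) (sn x.1.2 ^+ 2) (sn x.2 ^+ 2) => a b c.
have := sqr_ge0 (a - b); have := sqr_ge0 (b - c); have := sqr_ge0 (a - c); nra.
Qed.

Lemma sumsn_ge0 (x : R3) : 0 <= sumsn x.
Proof. by rewrite /sumsn !addr_ge0. Qed.

Local Open Scope ereal_scope.

Let W2 m : \int[leb3]_(x in @cube R) (weight m x * (sn x.1.1 ^+ 2 + sn x.1.2 ^+ 2 + sn x.2 ^+ 2))%:E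
  = (3 / (2 * m%:R + 2))%R%:E.
Proof.
apply: weight_sum => //; rewrite moment2 mulrAC divff ?mul1r//.
by rewrite gt_eqF// mass_gt0.
Qed.

Let W4 m : \int[leb3]_(x in @cube R) (weight m x * (sn x.1.1 ^+ 4 + sn x.1.2 ^+ 4 + sn x.2 ^+ 4))%:E
  = (3 * (3 / ((2 * m%:R + 2) * (2 * m%:R + 4))))%R%:E.
Proof.
apply: weight_sum => //; rewrite moment4.
have m0 : (0 <= m%:R :> R)%R by [].
have n2 : (2 * m%:R + 2 != 0 :> R)%R by rewrite gt_eqF//; lra.
have n4 : (2 * m%:R + 4 != 0 :> R)%R by rewrite gt_eqF//; lra.
have nm : (mass m != 0 :> R)%R by rewrite gt_eqF// mass_gt0.
by field; rewrite n2 n4 nm.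
Qed.

Let measE (f : R3 -> R) : measurable_fun (setT : set (B * B * B)) f ->
  measurable_fun (cube : set (B * B * B)) (fun x => (f x)%:E).
Proof. by move=> mf; apply: measurable_funTS; exact/measurable_EFinP. Qed.

Let msum m k : measurable_fun (setT : set (B * B * B))
  (fun x => weight m x * (sn x.1.1 ^+ k + sn x.1.2 ^+ k + sn x.2 ^+ k))%R.
Proof.
have ms : measurable_fun (setT : set B) (fun x : R => sn x ^+ k)%R.
  by apply: elem_measurable; apply: elem_exp; exact: elem_sn.
apply: measurable_funM; first exact: measurable_weight.
apply: measurable_funD; [apply: measurable_funD|].
- by apply: (measurableT_comp ms); exact: measurableT_comp.
- by apply: (measurableT_comp ms); exact: measurableT_comp.
- exact: (measurableT_comp ms).
Qed.

(** After interpolation, m x^(1+2s) <= m (e x^2 + C x^4), and the second and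
    fourth moments are of order 1/m and 1/m^2. *)
Lemma derivative_kernel_small (s M : R) : (2^-1 < s < 1)%R -> (0 <= M)%R ->
  forall e, (0 < e)%R -> exists m0, forall m, (m0 <= m)%N ->
  \int[leb3]_(x in @cube R)
    (kconst m * (weight m x * sumsn x) * (M * ((2 * sumsn x) `^ s) ^+ 2))%:E <= e%:E.
Proof.
move=> s12 M0 e e0.
pose c : R := ((2 `^ s) ^+ 2)%R; have c0 : (0 <= c)%R by rewrite sqr_ge0.
pose P : R := (16 * pi * M * c)%R; have P0 : (0 <= P)%R by rewrite !mulr_ge0// pi_ge0.
(* with this d the second moment contributes at most e / 2; large m does the same for the fourth *)
pose d : R := (e / (9 * (P + 1)))%R.
have d0 : (0 < d)%R by rewrite divr_gt0// mulr_gt0// ltr_wpDl.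
have [C C0 HC] := interpolation_2_4 s12 d0.
exists (Num.bound (P * C * 243 / e)%R) => m mm.
have mP : (P * C * 243 / e < m%:R)%R.
  apply: lt_le_trans (archi_boundP _) _; last by rewrite ler_nat.
  by rewrite divr_ge0 ?(ltW e0)// mulr_ge0// mulr_ge0.
have m0 : (0 <= m%:R :> R)%R by [].
pose Z : R := (P * m.+1%:R)%R; have Z0 : (0 <= Z)%R by rewrite mulr_ge0.
pose f2 (x : R3) := (weight m x * (sn x.1.1 ^+ 2 + sn x.1.2 ^+ 2 + sn x.2 ^+ 2))%R.
pose f4 (x : R3) := (weight m x * (sn x.1.1 ^+ 4 + sn x.1.2 ^+ 4 + sn x.2 ^+ 4))%R.
have f20 x : (0 <= f2 x)%R by rewrite mulr_ge0 ?weight_ge0// !addr_ge0// sqr_ge0.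
have f40 x : (0 <= f4 x)%R by rewrite mulr_ge0 ?weight_ge0// !addr_ge0// exprn_even_ge0.
apply: (@le_trans _ _ (\int[leb3]_(x in @cube R)
    ((Z * d * 3)%:E * (f2 x)%:E + (Z * C * 27)%:E * (f4 x)%:E))).
  apply: ge0_le_integral_any => x _.
    rewrite lee_fin; apply: mulr_ge0; last by apply: mulr_ge0 => //; exact: sqr_ge0.
    apply: mulr_ge0; first exact: kconst_ge0.
    by apply: mulr_ge0; [exact: weight_ge0|exact: sumsn_ge0].
  rewrite -!EFinM -EFinD lee_fin.
  rewrite powRM ?sumsn_ge0// exprMn -/c.
  have Hx := HC _ (sumsn_ge0 x).
  have -> : (kconst m * (weight m x * sumsn x) * (M * (c * (sumsn x `^ s) ^+ 2)) =
      Z * weight m x * (sumsn x * (sumsn x `^ s) ^+ 2))%R.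
    by rewrite /Z /P /kconst; ring.
  have Zw : (0 <= Z * weight m x)%R by rewrite mulr_ge0// weight_ge0.
  apply: (le_trans (ler_wpM2l Zw Hx)).
  have h2 := ler_wpM2l (mulr_ge0 Zw (ltW d0)) (sumsn_sq x).
  have h4 := ler_wpM2l (mulr_ge0 Zw C0) (sumsn_4 x).
  have -> : (Z * weight m x * (d * sumsn x ^+ 2 + C * sumsn x ^+ 4) =
    Z * weight m x * d * sumsn x ^+ 2 + Z * weight m x * C * sumsn x ^+ 4)%R by ring.
  apply: (le_trans (lerD h2 h4)).
  by rewrite le_eqVlt /f2 /f4; apply/orP; left; apply/eqP; ring.
have mC := @measurable_cube R.
have k1 : (0 <= Z * d * 3)%R by rewrite mulr_ge0// mulr_ge0// ltW.
have k2 : (0 <= Z * C * 27)%R by rewrite mulr_ge0// mulr_ge0.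
rewrite ge0_integralD//; first last.
- by apply: emeasurable_funM => //; apply: measE; exact: msum.
- by move=> x _; rewrite -EFinM lee_fin; apply: mulr_ge0.
- by apply: emeasurable_funM => //; apply: measE; exact: msum.
- by move=> x _; rewrite -EFinM lee_fin; apply: mulr_ge0.
rewrite ge0_integralZl_EFin//; first last.
- by apply: measE; exact: msum.
- by move=> x _; rewrite lee_fin.
rewrite ge0_integralZl_EFin//; first last.
- by apply: measE; exact: msum.
- by move=> x _; rewrite lee_fin.
rewrite W2 W4 -!EFinM -EFinD lee_fin.
have n2 : (0 < 2 * m%:R + 2 :> R)%R by lra.
have n4 : (0 < 2 * m%:R + 4 :> R)%R by lra.
rewrite (_ : _ + _ = P * d * (9 / 2) + P * C * 243 / 2 / (2 * m%:R + 4))%R; last first.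
  by rewrite /Z -[m.+1%:R]natr1; field; rewrite !gt_eqF//; lra.
have h1 : (P * d * (9 / 2) <= e / 2)%R.
  rewrite /d (_ : (P * _ * _ = (e / 2) * (P / (P + 1)))%R); last first.
    by field; rewrite gt_eqF// ltr_wpDl.
  rewrite ler_piMr ?divr_ge0 ?(ltW e0)// ler_pdivrMr ?ltr_wpDl// mul1r lerDl//.
have h2 : (P * C * 243 / 2 / (2 * m%:R + 4) <= e / 2)%R.
  rewrite ler_pdivrMr//; move: mP; rewrite ltr_pdivrMr// => mP.
  have : (0 <= e * m%:R)%R by rewrite mulr_ge0// ltW.
  move: (P * C * 243)%R mP => q; nra.
lra.
Qed.

(** After interpolation, x^(2s) <= e + C x^2, and the second moment is of order
    1/m. *)
Lemma kernel_small (s M : R) : (2^-1 < s < 1)%R -> (0 <= M)%R ->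
  forall e, (0 < e)%R -> exists m0, forall m, (m0 <= m)%N ->
  \int[leb3]_(x in @cube R) (weight m.+1 x * (M * ((2 * sumsn x) `^ s) ^+ 2))%:E <= e%:E.
Proof.
move=> s12 M0 e e0.
pose c : R := ((2 `^ s) ^+ 2)%R; have c0 : (0 <= c)%R by rewrite sqr_ge0.
pose P : R := (M * c)%R; have P0 : (0 <= P)%R by rewrite !mulr_ge0.
(* with this d the constant term contributes at most e / 2; large m does the same for the second moment *)
pose d : R := (e / (2 * (P + 1)))%R.
have d0 : (0 < d)%R by rewrite divr_gt0// mulr_gt0// ltr_wpDl.
have [C C0 HC] := interpolation_0_2 s12 d0.
exists (Num.bound (P * C * 9 / e)%R) => m mm.
have mP : (P * C * 9 / e < m%:R)%R.
  apply: lt_le_trans (archi_boundP _) _; last by rewrite ler_nat.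
  by rewrite divr_ge0 ?(ltW e0)// mulr_ge0// mulr_ge0.
have m0 : (0 <= m%:R :> R)%R by [].
pose f2 (x : R3) := (weight m.+1 x * (sn x.1.1 ^+ 2 + sn x.1.2 ^+ 2 + sn x.2 ^+ 2))%R.
have f20 x : (0 <= f2 x)%R by rewrite mulr_ge0 ?weight_ge0// !addr_ge0// sqr_ge0.
apply: (@le_trans _ _ (\int[leb3]_(x in @cube R)
    ((P * d)%:E * (weight m.+1 x)%:E + (P * C * 3)%:E * (f2 x)%:E))).
  apply: ge0_le_integral_any => x _.
    rewrite lee_fin; apply: mulr_ge0; first exact: weight_ge0.
    by apply: mulr_ge0 => //; exact: sqr_ge0.
  rewrite -!EFinM -EFinD lee_fin.
  rewrite powRM ?sumsn_ge0// exprMn -/c.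
  have Hx := HC _ (sumsn_ge0 x).
  have -> : (weight m.+1 x * (M * (c * (sumsn x `^ s) ^+ 2)) =
      P * weight m.+1 x * (sumsn x `^ s) ^+ 2)%R by rewrite /P; ring.
  have Zw : (0 <= P * weight m.+1 x)%R by rewrite mulr_ge0// weight_ge0.
  apply: (le_trans (ler_wpM2l Zw Hx)).
  have h2 := ler_wpM2l (mulr_ge0 Zw C0) (sumsn_sq x).
  have -> : (P * weight m.+1 x * (d + C * sumsn x ^+ 2) =
    P * weight m.+1 x * d + P * weight m.+1 x * C * sumsn x ^+ 2)%R by ring.
  apply: (le_trans (lerD (lexx _) h2)).
  by rewrite le_eqVlt /f2; apply/orP; left; apply/eqP; ring.
have mC := @measurable_cube R.
have k1 : (0 <= P * d)%R by rewrite mulr_ge0// ltW.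
have k2 : (0 <= P * C * 3)%R by rewrite mulr_ge0// mulr_ge0.
rewrite ge0_integralD//; first last.
- by apply: emeasurable_funM => //; apply: measE; exact: msum.
- by move=> x _; rewrite -EFinM lee_fin; apply: mulr_ge0 => //; exact: weight_ge0.
- by apply: emeasurable_funM => //; apply: measE; exact: measurable_weight.
- by move=> x _; rewrite -EFinM lee_fin; apply: mulr_ge0 => //; exact: weight_ge0.
rewrite ge0_integralZl_EFin//; first last.
- by apply: measE; exact: measurable_weight.
- by move=> x _; rewrite lee_fin weight_ge0.
rewrite ge0_integralZl_EFin//; first last.
- by apply: measE; exact: msum.
- by move=> x _; rewrite lee_fin.
rewrite W2 weight_mass mule1 -!EFinM -EFinD lee_fin -[m.+1%:R]natr1.
have h1 : (P * d <= e / 2)%R.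
  rewrite /d (_ : (P * _ = (e / 2) * (P / (P + 1)))%R); last first.
    by field; rewrite gt_eqF// ltr_wpDl.
  rewrite ler_piMr ?divr_ge0 ?(ltW e0)// ler_pdivrMr ?ltr_wpDl// mul1r lerDl//.
have h2 : (P * C * 3 * (3 / (2 * (m%:R + 1) + 2)) <= e / 2)%R.
  rewrite mulrA ler_pdivrMr; last lra.
  move: mP; rewrite ltr_pdivrMr// => mP.
  have : (0 <= e * m%:R)%R by rewrite mulr_ge0// ltW.
  have -> : (P * C * 3 * 3 = P * C * 9)%R by ring.
  move: (P * C * 9)%R mP => q; nra.
lra.
Qed.

End KernelLimits.

(** * The energy identity for a finite rank kernel *)

Section EnergyIdentity.
Context {R : realType} d (X : measurableType d) (mu : {measure set X -> \bar R}).
Variables (D : set X).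
Hypotheses (mD : measurable D) (muD : (mu D < +oo)%E).
Local Notation In f := (mu.-integrable D (EFin \o f)).
Local Notation "'I[' f ]" := (\int[mu]_(x in D) f x) (at level 8).

Definition sq_integrable (f : X -> R) :=
  measurable_fun D f /\ In (fun x => f x ^+ 2).

Lemma integrable_cst_fin (c : R) : In (fun=> c).
Proof.
apply/integrableP; split; first by apply/measurable_EFinP.
rewrite (eq_integral (fun=> `|c|%:E))// integral_cst// lte_mul_pinfty// lee_fin.
Qed.

Lemma sq_integrableM f g : sq_integrable f -> sq_integrable g ->
  In (fun x => f x * g x).
Proof.
move=> [mf f2] [mg g2].
apply: (@le_integrable _ _ _ mu D mD _ (fun x => (f x ^+ 2)%:E + (g x ^+ 2)%:E)%E) => //.
- by apply/measurable_EFinP; exact: measurable_funM.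
- move=> x _ /=; rewrite lee_fin [leRHS]ger0_norm ?addr_ge0 ?sqr_ge0// normrM.
  rewrite -(real_normK (num_real (f x))) -(real_normK (num_real (g x))).
  move: (normr_ge0 (f x)) (normr_ge0 (g x)); move: `|f x| `|g x| => a b a0 b0.
  by have := sqr_ge0 (a - b); nra.
- exact: integrableD.
Qed.

Lemma sq_integrable_cst c : sq_integrable (fun=> c).
Proof. by split => //; exact: integrable_cst_fin. Qed.

Lemma sq_integrable_int f : sq_integrable f -> In f.
Proof.
move=> hf; have := sq_integrableM hf (sq_integrable_cst 1).
by congr (mu.-integrable D _); apply/funext => x /=; rewrite mulr1.
Qed.

Lemma integrable_lin (J : finType) (c : J -> R) (F : J -> X -> R) :
  (forall j, In (F j)) -> In (fun x => \sum_j c j * F j x).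
Proof.
move=> iF.
apply: (eq_integrable mD (fun x => \sum_(j <- index_enum J) (c j * F j x)%:E)%E).
  by move=> x _; rewrite /= sumEFin.
apply: integrable_sum => // j _.
have := integrableZl mD (c j) (iF j).
by congr (mu.-integrable D _).
Qed.

(** Finite linear combinations are all the linearity that is needed: the
    kernel has finite rank, so no Fubini theorem enters the identity. *)
Lemma Rintegral_lin (J : finType) (c : J -> R) (F : J -> X -> R) :
  (forall j, In (F j)) -> I[fun x => \sum_j c j * F j x] = \sum_j c j * I[F j].
Proof.
move=> iF; rewrite /Rintegral.
rewrite (eq_integral (fun x => \sum_(j <- index_enum J) (c j * F j x)%:E)%E); last first.
  by move=> x _; rewrite sumEFin.
have iZ j : mu.-integrable D (EFin \o (fun x => c j * F j x)).
  have := integrableZl mD (c j) (iF j).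
  by congr (mu.-integrable D _).
rewrite integral_sum//=.
rewrite (eq_bigr (fun j => (c j * I[F j])%:E)) ?sumEFin// => j _.
by rewrite -RintegralZl// /Rintegral fineK//; exact: (integrable_fin_num mD (iZ j)).
Qed.

Lemma Rintegral_lin3 (c1 c2 c3 : R) (f1 f2 f3 : X -> R) : In f1 -> In f2 -> In f3 ->
  In (fun x => c1 * f1 x + c2 * f2 x + c3 * f3 x) /\
  I[fun x => c1 * f1 x + c2 * f2 x + c3 * f3 x] = c1 * I[f1] + c2 * I[f2] + c3 * I[f3].
Proof.
move=> i1 i2 i3.
have iZ c (f : X -> R) : In f -> In (fun x => c * f x).
  move=> jf; have := integrableZl mD c jf.
  by congr (mu.-integrable D _).
have i12 : In (fun x => c1 * f1 x + c2 * f2 x) by exact: (integrableD mD (iZ _ _ i1) (iZ _ _ i2)).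
split; first exact: (integrableD mD i12 (iZ _ _ i3)).
by rewrite RintegralD ?RintegralD ?RintegralZl//; exact: iZ.
Qed.

Section Double.
Context (J : finType) (a g : J -> X -> R) (q : X -> R) (kappa : R) (C : J -> R).
Hypotheses (ma : forall j, measurable_fun D (a j)).
Hypotheses (bnda : forall j x, D x -> `|a j x| <= C j).
Hypotheses (q2 : sq_integrable q) (ig : forall j, In (g j)).
Hypotheses (iqg : forall j, In (fun x => q x * g j x)).
Hypotheses (hk : forall x, D x -> \sum_j g j x * I[a j] = kappa).

(** Expanding the square for fixed x, the inner integral is a combination of
    integrals of a_j, q a_j and q^2 a_j.  The term in q(x)^2 carries the sum
    kappa, so that the products q^2 g_j, which are not integrable
    in general, never appear by themselves. *)
Lemma double_sq :
  I[fun x => I[fun y => (q x - q y) ^+ 2 * \sum_j g j x * a j y]] =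
  kappa * I[fun x => q x ^+ 2]
  - 2 * (\sum_j I[fun x => q x * a j x] * I[fun x => q x * g j x])
  + \sum_j I[fun x => q x ^+ 2 * a j x] * I[g j].
Proof.
have iq := sq_integrable_int q2.
have i0 j : In (a j).
  have := integrable_bounded_mul mD (integrable_cst_fin 1) (ma j) (@bnda j).
  by congr (mu.-integrable D _); apply/funext => x /=; rewrite mul1r.
have i1 j : In (fun x => q x * a j x) := integrable_bounded_mul mD iq (ma j) (@bnda j).
have i2 j : In (fun x => q x ^+ 2 * a j x) := integrable_bounded_mul mD q2.2 (ma j) (@bnda j).
pose A j := I[a j]; pose U j := I[fun x => q x * a j x].
pose Q j := I[fun x => q x ^+ 2 * a j x].
have inner x : D x ->
    I[fun y => (q x - q y) ^+ 2 * \sum_j g j x * a j y] =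
    kappa * q x ^+ 2 + - 2 * (\sum_j U j * (q x * g j x)) + 1 * (\sum_j Q j * g j x).
  move=> Dx.
  pose F j y := q x ^+ 2 * a j y + - 2 * q x * (q y * a j y) + 1 * (q y ^+ 2 * a j y).
  have iF j := Rintegral_lin3 (q x ^+ 2) (- 2 * q x) 1 (i0 j) (i1 j) (i2 j).
  rewrite (_ : (fun y => _) = (fun y => \sum_j g j x * F j y)); last first.
    apply/funext => y; rewrite mulr_sumr; apply: eq_bigr => j _.
    by rewrite /F; ring.
  rewrite Rintegral_lin; last by move=> j; exact: (iF j).1.
  rewrite -(hk Dx) mulr_suml !mulr_sumr -!big_split/=; apply: eq_bigr => j _.
  by rewrite (iF j).2 /U /Q; ring.
rewrite (@eq_Rintegral _ _ _ mu D (fun x => kappa * q x ^+ 2 +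
   - 2 * (\sum_j U j * (q x * g j x)) + 1 * (\sum_j Q j * g j x))); last first.
  by move=> x; rewrite inE => /inner.
have iU : In (fun x => \sum_j U j * (q x * g j x)) by exact: integrable_lin.
have iQ : In (fun x => \sum_j Q j * g j x) by exact: integrable_lin.
by rewrite (Rintegral_lin3 _ _ _ q2.2 iU iQ).2 !Rintegral_lin// mul1r mulNr.
Qed.

End Double.

Section Identity.
Context (J : finType) (a b1 b2 b3 : J -> X -> R) (u v w p : X -> R) (Omega : R).
Context (C : J -> R).
Hypotheses (ma : forall j, measurable_fun D (a j)).
Hypotheses (mb1 : forall j, measurable_fun D (b1 j)).
Hypotheses (mb2 : forall j, measurable_fun D (b2 j)).
Hypotheses (mb3 : forall j, measurable_fun D (b3 j)).
Hypotheses (ka : forall j x, D x -> `|a j x| <= C j).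
Hypotheses (kb1 : forall j x, D x -> `|b1 j x| <= C j).
Hypotheses (kb2 : forall j x, D x -> `|b2 j x| <= C j).
Hypotheses (kb3 : forall j x, D x -> `|b3 j x| <= C j).
Hypotheses (u2 : sq_integrable u) (v2 : sq_integrable v) (w2 : sq_integrable w).
Hypothesis (ip : In p).
Hypotheses (anti1 : forall x y, \sum_j b1 j x * a j y = - \sum_j a j x * b1 j y).
Hypotheses (anti2 : forall x y, \sum_j b2 j x * a j y = - \sum_j a j x * b2 j y).
Hypotheses (anti3 : forall x y, \sum_j b3 j x * a j y = - \sum_j a j x * b3 j y).
Hypotheses (mean1 : forall j, I[b1 j] = 0) (mean2 : forall j, I[b2 j] = 0).
Hypotheses (mean3 : forall j, I[b3 j] = 0).
Let g j x := u x * b1 j x + v x * b2 j x + w x * b3 j x.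
Hypotheses (div0 : forall j, I[g j] = 0) (pz0 : forall j, I[fun x => p x * b3 j x] = 0).

Lemma integrable_mulb (b : J -> X -> R) (f : X -> R) j :
  (forall j, measurable_fun D (b j)) -> (forall j x, D x -> `|b j x| <= C j) ->
  In f -> In (fun x => f x * b j x).
Proof. by move=> mb kb jf; apply: (integrable_bounded_mul mD jf (mb j) (@kb j)). Qed.

Lemma integrable_transport (q : X -> R) : sq_integrable q ->
  forall j, In (fun x => q x * g j x).
Proof.
move=> q2 j.
have h1 := integrable_mulb j mb1 kb1 (sq_integrableM q2 u2).
have h2 := integrable_mulb j mb2 kb2 (sq_integrableM q2 v2).
have h3 := integrable_mulb j mb3 kb3 (sq_integrableM q2 w2).
have := (Rintegral_lin3 1 1 1 h1 h2 h3).1.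
by congr (mu.-integrable D _); apply/funext => x; rewrite /= /g; congr EFin; ring.
Qed.

Let ig j : In (g j).
Proof.
have := integrable_transport (sq_integrable_cst 1) j.
by congr (mu.-integrable D _); apply/funext => x; rewrite /= mul1r.
Qed.

(** The antisymmetry transfers the weights from b to a in the average of a
    kernel against f. *)
Let sum_mean (b : J -> X -> R) x :
  (forall x y, \sum_j b j x * a j y = - \sum_j a j x * b j y) ->
  (forall j, measurable_fun D (b j)) -> (forall j x, D x -> `|b j x| <= C j) ->
  (forall f, In f -> I[fun y => f y * \sum_j b j x * a j y] =
     - \sum_j a j x * I[fun y => f y * b j y]) /\
  (forall f, In f -> I[fun y => f y * \sum_j b j x * a j y] =
     \sum_j b j x * I[fun y => f y * a j y]).
Proof.
move=> anti mb kb; split => f jf.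
  transitivity I[fun y => \sum_j - a j x * (f y * b j y)].
    congr (Rintegral _ _ _); apply/funext => y; rewrite anti mulrN mulr_sumr -sumrN.
    by apply: eq_bigr => j _; ring.
  rewrite Rintegral_lin; last by move=> j; exact: integrable_mulb.
  by rewrite -sumrN; apply: eq_bigr => j _; rewrite mulNr.
transitivity I[fun y => \sum_j b j x * (f y * a j y)].
  congr (Rintegral _ _ _); apply/funext => y; rewrite mulr_sumr.
  by apply: eq_bigr => j _; ring.
by rewrite Rintegral_lin// => j; exact: integrable_mulb.
Qed.

Let sum_int (b : J -> X -> R) x :
  (forall x y, \sum_j b j x * a j y = - \sum_j a j x * b j y) ->
  (forall j, measurable_fun D (b j)) -> (forall j x, D x -> `|b j x| <= C j) ->
  (forall j, I[b j] = 0) -> \sum_j b j x * I[a j] = 0.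
Proof.
move=> anti mb kb b0.
have [h1 h2] := sum_mean x anti mb kb.
have := h1 _ (integrable_cst_fin 1); rewrite h2; last exact: integrable_cst_fin.
have E (f : X -> R) : I[fun y => 1 * f y] = I[f].
  by congr (Rintegral _ _ _); apply/funext => y; rewrite mul1r.
under eq_bigr do rewrite E; move=> ->.
by rewrite big1 ?oppr0// => j _; rewrite E b0 mulr0.
Qed.

(** The constant function 1 in [sum_mean]: this removes the cubic term from
    the flux. *)
Let gmean x : \sum_j g j x * I[a j] = 0.
Proof.
transitivity (u x * (\sum_j b1 j x * I[a j]) + v x * (\sum_j b2 j x * I[a j])
  + w x * (\sum_j b3 j x * I[a j])).
  by rewrite !mulr_sumr -!big_split/=; apply: eq_bigr => j _; rewrite /g; ring.
by rewrite !sum_int// !mulr0 !addr0.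
Qed.

(** The sum over j is the velocity at x applied to the gradient in x of the
    kernel. *)
Definition flux (q : X -> R) : R :=
  I[fun x => I[fun y => (q x - q y) ^+ 2 * \sum_j g j x * a j y]].

(** By [double_sq] only the terms U_j int q g_j survive, since g_j has mean 0. *)
Lemma flux_transport q : sq_integrable q ->
  2 * (\sum_j I[fun x => q x * a j x] * I[fun x => q x * g j x]) = - flux q.
Proof.
move=> q2; rewrite /flux (@double_sq _ _ _ _ 0 C)//; last exact: integrable_transport.
rewrite mul0r sub0r opprD opprK [X in _ - X]big1 ?subr0// => j _.
by rewrite div0 mulr0.
Qed.

(** By antisymmetry, sum_j (U_j b1_j + V_j b2_j + W_j b3_j) is at each x minus
    the combination of the a_j (x) with weights int g_j = 0.  Integrated
    against p, the third group vanishes because p b3_j has mean 0. *)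
Lemma pressure_work :
  \sum_j (I[fun x => u x * a j x] * I[fun x => p x * b1 j x]
        + I[fun x => v x * a j x] * I[fun x => p x * b2 j x]) = 0.
Proof.
pose U j := I[fun x => u x * a j x]; pose V j := I[fun x => v x * a j x].
pose W j := I[fun x => w x * a j x].
have iu := sq_integrable_int u2; have iv := sq_integrable_int v2.
have iw := sq_integrable_int w2.
have pt x : (\sum_j U j * b1 j x) + (\sum_j V j * b2 j x) + (\sum_j W j * b3 j x) = 0.
  have s1 := sum_mean x anti1 mb1 kb1.
  have s2 := sum_mean x anti2 mb2 kb2.
  have s3 := sum_mean x anti3 mb3 kb3.
  have E (b : J -> X -> R) (L : J -> R) : \sum_j L j * b j x = \sum_j b j x * L j.
    by apply: eq_bigr => j _; rewrite mulrC.
  rewrite (E b1 U) (E b2 V) (E b3 W) -s1.2// -s2.2// -s3.2// s1.1// s2.1// s3.1//.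
  rewrite -!opprD -!big_split/= big1 ?oppr0// => j _.
  rewrite -!mulrDr.
  have h1 := integrable_mulb j mb1 kb1 iu.
  have h2 := integrable_mulb j mb2 kb2 iv.
  have h3 := integrable_mulb j mb3 kb3 iw.
  have := (Rintegral_lin3 1 1 1 h1 h2 h3).2; rewrite !mul1r => <-.
  rewrite -[RHS](mulr0 (a j x)) -(div0 j); congr (_ * _).
  by apply: eq_Rintegral => y _; rewrite /g; ring.
have i1 j := integrable_mulb j mb1 kb1 ip.
have i2 j := integrable_mulb j mb2 kb2 ip.
have i3 j := integrable_mulb j mb3 kb3 ip.
have j1 := integrable_lin U i1; have j2 := integrable_lin V i2.
have j3 := integrable_lin W i3.
have := (Rintegral_lin3 1 1 1 j1 j2 j3).2.
rewrite (@eq_Rintegral _ _ _ mu D (fun=> 0)); last first.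
  move=> x _; rewrite !mul1r; transitivity (p x *
    ((\sum_j U j * b1 j x) + (\sum_j V j * b2 j x) + (\sum_j W j * b3 j x))); last first.
    by rewrite pt mulr0.
  rewrite !mulrDr !mulr_sumr.
  by congr (_ + _ + _); apply: eq_bigr => j _; ring.
rewrite ?mul1r !Rintegral_lin// [X in _ + X]big1 ?addr0; last first.
  by move=> j _; rewrite pz0 mulr0.
by move=> e; rewrite big_split/= -[LHS]e /Rintegral integral0.
Qed.

(** The Coriolis terms U_j Omega V_j and - V_j Omega U_j cancel for each j. *)
Lemma energy_identity :
  2 * (\sum_j (I[fun x => u x * a j x] *
          I[fun x => u x * g j x + Omega * v x * a j x + p x * b1 j x]
        + I[fun x => v x * a j x] *
          I[fun x => v x * g j x - Omega * u x * a j x + p x * b2 j x])) =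
  - (flux u + flux v).
Proof.
have iu := sq_integrable_int u2; have iv := sq_integrable_int v2.
rewrite opprD -!flux_transport// -mulrDr -big_split/=; congr (2 * _).
rewrite -[RHS]addr0 -[X in _ = _ + X]pressure_work -big_split/=; apply: eq_bigr => j _.
have h1 := (Rintegral_lin3 1 Omega 1 (integrable_transport u2 j)
  (integrable_mulb j ma ka iv) (integrable_mulb j mb1 kb1 ip)).2.
have h2 := (Rintegral_lin3 1 (- Omega) 1 (integrable_transport v2 j)
  (integrable_mulb j ma ka iu) (integrable_mulb j mb2 kb2 ip)).2.
have -> : I[fun x => u x * g j x + Omega * v x * a j x + p x * b1 j x] =
  I[fun x => u x * g j x] + Omega * I[fun x => v x * a j x] + I[fun x => p x * b1 j x].
  rewrite !mul1r in h1; rewrite -h1; apply: eq_Rintegral => x _; ring.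
have -> : I[fun x => v x * g j x - Omega * u x * a j x + p x * b2 j x] =
  I[fun x => v x * g j x] - Omega * I[fun x => u x * a j x] + I[fun x => p x * b2 j x].
  rewrite !mul1r mulNr in h2; rewrite -h2; apply: eq_Rintegral => x _; ring.
by ring.
Qed.

End Identity.

(** The case g = a of [double_sq]; kappa is the mean of the kernel. *)
Lemma kernel_variance (J : finType) (a : J -> X -> R) (q : X -> R) (kappa : R) (C : J -> R) :
  (forall j, measurable_fun D (a j)) -> (forall j x, D x -> `|a j x| <= C j) ->
  sq_integrable q -> (forall x, D x -> \sum_j a j x * I[a j] = kappa) ->
  I[fun x => I[fun y => (q x - q y) ^+ 2 * \sum_j a j x * a j y]] =
  2 * (kappa * I[fun x => q x ^+ 2] - \sum_j I[fun x => q x * a j x] ^+ 2).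
Proof.
move=> ma ka q2 hk.
have i0 j : In (a j).
  have := integrable_bounded_mul mD (integrable_cst_fin 1) (ma j) (@ka j).
  by congr (mu.-integrable D _); apply/funext => x /=; rewrite mul1r.
have i1 j : In (fun x => q x * a j x) :=
  integrable_bounded_mul mD (sq_integrable_int q2) (ma j) (@ka j).
have i2 j : In (fun x => q x ^+ 2 * a j x) := integrable_bounded_mul mD q2.2 (ma j) (@ka j).
rewrite (@double_sq _ _ _ _ kappa C)//.
have -> : \sum_j I[fun x => q x ^+ 2 * a j x] * I[a j] = kappa * I[fun x => q x ^+ 2].
  transitivity I[fun x => \sum_j I[a j] * (q x ^+ 2 * a j x)].
    by rewrite Rintegral_lin//; apply: eq_bigr => j _; rewrite mulrC.
  rewrite -RintegralZl//; last exact: q2.2.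
  apply: eq_Rintegral => x; rewrite inE => Dx.
  by rewrite -(hk _ Dx) mulr_suml; apply: eq_bigr => j _; ring.
under [X in _ - 2 * X]eq_bigr do rewrite -expr2.
by ring.
Qed.

End EnergyIdentity.

(** * The modes of the product kernel *)

Section Modes.
Context {R : realType}.
Local Notation B := (measurableTypeR R).
Local Notation R3 := (R * R * R)%type.
Local Notation leb := (@lebesgue_measure R).

Lemma sum_prod3 (I : finType) (F1 F2 F3 : I -> R) :
  \sum_(j : I * I * I) F1 j.1.1 * F2 j.1.2 * F3 j.2 =
  (\sum_i F1 i) * (\sum_i F2 i) * (\sum_i F3 i).
Proof.
rewrite -(pair_bigA _ (fun i k => F1 i.1 * F2 i.2 * F3 k))/=.
under eq_bigr do rewrite -mulr_sumr.
rewrite -mulr_suml; congr (_ * _).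
rewrite -(pair_bigA _ (fun i k => F1 i * F2 k))/=.
by under eq_bigr do rewrite -mulr_sumr; rewrite -mulr_suml.
Qed.

Definition modes m : Type := ({ffun 'I_m.+1 -> 'I_3} * {ffun 'I_m.+1 -> 'I_3} * {ffun 'I_m.+1 -> 'I_3})%type.
HB.instance Definition _ m := Finite.on (modes m).

Definition mode m (j : modes m) : R3 -> R := prod3 (mono j.1.1) (mono j.1.2) (mono j.2).
Definition mode1 m (j : modes m) : R3 -> R :=
  prod3 (derive1 (mono j.1.1)) (mono j.1.2) (mono j.2).
Definition mode2 m (j : modes m) : R3 -> R :=
  prod3 (mono j.1.1) (derive1 (mono j.1.2)) (mono j.2).
Definition mode3 m (j : modes m) : R3 -> R :=
  prod3 (mono j.1.1) (mono j.1.2) (derive1 (mono j.2)).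

(** The factor by which the kernel of the modes exceeds the kernel [weight] of
    mass 1. *)
Definition scale m : R := (2 ^+ m.+1 * mass m.+1) ^+ 3.

Lemma scale_gt0 m : 0 < scale m.
Proof. by rewrite exprn_gt0// mulr_gt0 ?mass_gt0// exprn_gt0. Qed.

Let sum_modes m (F G : {ffun 'I_m.+1 -> 'I_3} -> R -> R) F' G' F'' G'' x y :
  \sum_(j : modes m) prod3 (F j.1.1) (F' j.1.2) (F'' j.2) x *
    prod3 (G j.1.1) (G' j.1.2) (G'' j.2) y =
  (\sum_t F t x.1.1 * G t y.1.1) * (\sum_t F' t x.1.2 * G' t y.1.2) *
  (\sum_t F'' t x.2 * G'' t y.2).
Proof. by rewrite -sum_prod3; apply: eq_bigr => j _; rewrite /prod3; ring. Qed.

Let nm m : mass m.+1 != 0 :> R. Proof. by rewrite gt_eqF// mass_gt0. Qed.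

Lemma mode_sum m x y :
  \sum_(j : modes m) mode j x * mode j y = scale m * weight m.+1 (x - y).
Proof. by rewrite sum_modes !mono_sum /scale /weight /prod3/=; field; exact: nm. Qed.

Lemma mode1_sum m x y :
  \sum_(j : modes m) mode1 j x * mode j y = scale m * dker1 m (x - y).
Proof.
by rewrite (sum_modes (fun t => derive1 (@mono R m.+1 t)) (@mono R m.+1) (@mono R m.+1) (@mono R m.+1) (@mono R m.+1) (@mono R m.+1)) !mono_sum derive1_mono_l /scale /dker1 /prod3/=; field; exact: nm.
Qed.

Lemma mode2_sum m x y :
  \sum_(j : modes m) mode2 j x * mode j y = scale m * dker2 m (x - y).
Proof.
by rewrite (sum_modes (@mono R m.+1) (@mono R m.+1) (fun t => derive1 (@mono R m.+1 t)) (@mono R m.+1) (@mono R m.+1) (@mono R m.+1)) !mono_sum derive1_mono_l /scale /dker2 /prod3/=; field; exact: nm.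
Qed.

Lemma mode3_sum m x y :
  \sum_(j : modes m) mode3 j x * mode j y = scale m * dker3 m (x - y).
Proof.
by rewrite (sum_modes (@mono R m.+1) (@mono R m.+1) (@mono R m.+1) (@mono R m.+1) (fun t => derive1 (@mono R m.+1 t)) (@mono R m.+1)) !mono_sum derive1_mono_l /scale /dker3 /prod3/=; field; exact: nm.
Qed.

Lemma mode1_anti m x y : \sum_(j : modes m) mode1 j x * mode j y = - \sum_(j : modes m) mode j x * mode1 j y.
Proof. by rewrite (sum_modes (fun t => derive1 (@mono R m.+1 t)) (@mono R m.+1) (@mono R m.+1) (@mono R m.+1) (@mono R m.+1) (@mono R m.+1))
  (sum_modes (@mono R m.+1) (fun t => derive1 (@mono R m.+1 t)) (@mono R m.+1) (@mono R m.+1) (@mono R m.+1) (@mono R m.+1)) !mono_sum derive1_mono_l derive1_mono_r !mulNr opprK. Qed.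

Lemma mode2_anti m x y : \sum_(j : modes m) mode2 j x * mode j y = - \sum_(j : modes m) mode j x * mode2 j y.
Proof. by rewrite (sum_modes (@mono R m.+1) (@mono R m.+1) (fun t => derive1 (@mono R m.+1 t)) (@mono R m.+1) (@mono R m.+1) (@mono R m.+1))
  (sum_modes (@mono R m.+1) (@mono R m.+1) (@mono R m.+1) (fun t => derive1 (@mono R m.+1 t)) (@mono R m.+1) (@mono R m.+1)) !mono_sum derive1_mono_l derive1_mono_r mulrN mulNr opprK. Qed.

Lemma mode3_anti m x y : \sum_(j : modes m) mode3 j x * mode j y = - \sum_(j : modes m) mode j x * mode3 j y.
Proof. by rewrite (sum_modes (@mono R m.+1) (@mono R m.+1) (@mono R m.+1) (@mono R m.+1) (fun t => derive1 (@mono R m.+1 t)) (@mono R m.+1))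
  (sum_modes (@mono R m.+1) (@mono R m.+1) (@mono R m.+1) (@mono R m.+1) (@mono R m.+1) (fun t => derive1 (@mono R m.+1 t))) !mono_sum derive1_mono_l derive1_mono_r mulrN opprK. Qed.

Let em m (t : {ffun 'I_m -> 'I_3}) : elem (mono t : R -> R). Proof. exact: elem_mono. Qed.
Let edm m (t : {ffun 'I_m -> 'I_3}) : elem (derive1 (mono t : R -> R)).
Proof. by apply: elem_derive1. Qed.

Lemma measurable_mode m (j : modes m) : measurable_fun (setT : set (B * B * B)) (mode j).
Proof. exact: measurable_prod3. Qed.
Lemma measurable_mode1 m (j : modes m) : measurable_fun (setT : set (B * B * B)) (mode1 j).
Proof. exact: measurable_prod3. Qed.
Lemma measurable_mode2 m (j : modes m) : measurable_fun (setT : set (B * B * B)) (mode2 j).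
Proof. exact: measurable_prod3. Qed.
Lemma measurable_mode3 m (j : modes m) : measurable_fun (setT : set (B * B * B)) (mode3 j).
Proof. exact: measurable_prod3. Qed.

Lemma prod3_bounded (a b c : R -> R) : elem a -> elem b -> elem c ->
  exists C, forall x, cube x -> `|prod3 a b c x| <= C.
Proof.
move=> ea eb ec.
have [Ca Ca0 Ha] := @elem_bounded _ _ 0 1 ea.
have [Cb Cb0 Hb] := @elem_bounded _ _ 0 1 eb.
have [Cc Cc0 Hc] := @elem_bounded _ _ 0 1 ec.
exists (Ca * Cb * Cc) => -[[x y] z] [[/=]]; rewrite !in_itv/= => h1 h2 h3.
rewrite /prod3 !normrM; apply: ler_pM => //; last exact: Hc.
by apply: ler_pM => //; [exact: Ha|exact: Hb].
Qed.

Lemma mode_bounded m : exists C : modes m -> R, [/\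
  forall j x, cube x -> `|mode j x| <= C j, forall j x, cube x -> `|mode1 j x| <= C j,
  forall j x, cube x -> `|mode2 j x| <= C j & forall j x, cube x -> `|mode3 j x| <= C j].
Proof.
suff /choice[C HC] : forall j : modes m, exists c : R, [/\
  forall x, cube x -> `|mode j x| <= c, forall x, cube x -> `|mode1 j x| <= c,
  forall x, cube x -> `|mode2 j x| <= c & forall x, cube x -> `|mode3 j x| <= c].
  by exists C; split => j; have [] := HC j.
move=> j.
have [C0 H0] := prod3_bounded (em j.1.1) (em j.1.2) (em j.2).
have [C1 H1] := prod3_bounded (edm j.1.1) (em j.1.2) (em j.2).
have [C2 H2] := prod3_bounded (em j.1.1) (edm j.1.2) (em j.2).
have [C3 H3] := prod3_bounded (em j.1.1) (em j.1.2) (edm j.2).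
exists (Num.max (Num.max C0 C1) (Num.max C2 C3)); split => x hx; rewrite !le_max.
- by rewrite H0.
- by rewrite H1 ?orbT.
- by rewrite H2 ?orbT.
- by rewrite H3 ?orbT.
Qed.

Let mI : measurable (`[0%R, 1%R] : set B). Proof. exact: measurable_itv. Qed.
Let m2 : measurable (`[0%R, 1%R] `*` `[0%R, 1%R] : set (B * B)).
Proof. exact: measurableX. Qed.

Let square_measure : leb2 (`[0%R, 1%R] `*` `[0%R, 1%R] : set (B * B)) = 1%E.
Proof.
have -> : leb2 (`[0%R, 1%R] `*` `[0%R, 1%R] : set (B * B)) =
    (leb `[0%R, 1%R] * leb `[0%R, 1%R])%E by exact: product_measure1E.
by rewrite lebesgue_measure_itv/= lte_fin ltr01 oppr0 adde0 mule1.
Qed.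

Lemma cube_measure_fin : (leb3 (@cube R) < +oo)%E.
Proof.
have -> : leb3 (@cube R) = (leb2 (`[0%R, 1%R] `*` `[0%R, 1%R]) * leb `[0%R, 1%R])%E.
  exact: product_measure1E.
by rewrite square_measure lebesgue_measure_itv/= lte_fin ltr01 oppr0 adde0 mule1 ltry.
Qed.

Lemma Rintegral_prod3 (a b c : R -> R) : elem a -> elem b -> elem c ->
  \int[leb3]_(x in @cube R) prod3 a b c x =
  (\int[leb]_(x in `[0, 1]) a x) * (\int[leb]_(x in `[0, 1]) b x) *
  (\int[leb]_(x in `[0, 1]) c x).
Proof.
move=> ea eb ec.
have [C HC] := prod3_bounded ea eb ec.
have mC := @measurable_cube R.
have i3 : leb3.-integrable (@cube R) (EFin \o prod3 a b c).
  have := integrable_bounded_mul mC (integrable_cst_fin mC cube_measure_fin 1)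
    (measurable_funTS (measurable_prod3 ea eb ec)) HC.
  by congr (leb3.-integrable _ _); apply/funext => x /=; rewrite mul1r.
have i2 : leb2.-integrable (`[0, 1] `*` `[0, 1]) (EFin \o (fun z : R * R => a z.1 * b z.2)).
  have [Ca Ca0 Ha] := @elem_bounded _ _ 0 1 ea.
  have [Cb Cb0 Hb] := @elem_bounded _ _ 0 1 eb.
  have fin2 : (leb2 (`[0%R, 1%R] `*` `[0%R, 1%R] : set (B * B)) < +oo)%E.
    by rewrite square_measure ltry.
  have mab : measurable_fun (`[0, 1] `*` `[0, 1] : set (B * B)) (fun z => a z.1 * b z.2).
    apply: measurable_funTS; apply: measurable_funM.
    + exact: (measurableT_comp (elem_measurable ea)).
    + exact: (measurableT_comp (elem_measurable eb)).
  have kab z : (`[0, 1] `*` `[0, 1]) z -> `|a z.1 * b z.2| <= Ca * Cb.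
    move=> [/=]; rewrite !in_itv/= => h1 h2; rewrite normrM; apply: ler_pM => //; [exact: Ha|exact: Hb].
  have := integrable_bounded_mul m2 (integrable_cst_fin m2 fin2 1) mab kab.
  by congr (leb2.-integrable _ _); apply/funext => x /=; rewrite mul1r.
have [_ _] := fubini_setX m2 mI i3; rewrite /cube => ->.
have [_ _ e2] := fubini_setX mI mI i2.
have ia := @elem_integrable _ _ 0 1 ea; have ib := @elem_integrable _ _ 0 1 eb.
have ic := @elem_integrable _ _ 0 1 ec.
have e2' : \int[leb2]_(z in `[0, 1] `*` `[0, 1]) (a z.1 * b z.2) =
   (\int[leb]_(x in `[0, 1]) a x) * (\int[leb]_(x in `[0, 1]) b x).
  rewrite [LHS]e2/= -RintegralZl//.
  by apply: eq_Rintegral => y _; rewrite RintegralZr.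
rewrite -e2' -RintegralZl//; apply: eq_Rintegral => y _.
by rewrite -RintegralZr.
Qed.

(** The integral of a derivative over a period. *)
Lemma mono_mean0 m (t : {ffun 'I_m -> 'I_3}) : \int[leb]_(x in `[0, 1]) derive1 (mono t : R -> R) x = 0.
Proof.
rewrite elem_FTC// -{1}[1]add0r mono_periodic subrr//.
Qed.

Lemma mode_mean0 m (j : modes m) : [/\ \int[leb3]_(x in @cube R) mode1 j x = 0,
  \int[leb3]_(x in @cube R) mode2 j x = 0 & \int[leb3]_(x in @cube R) mode3 j x = 0].
Proof. by split; rewrite Rintegral_prod3// mono_mean0 ?mulr0 ?mul0r. Qed.

Lemma weight_even m x : weight m (- x) = weight m x :> R.
Proof. by rewrite /weight /prod3/= !kap_even. Qed.

Lemma weight_periodic m : forall a b c : R, [/\ weight m (a + 1, b, c) = weight m (a, b, c),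
  weight m (a, b + 1, c) = weight m (a, b, c) & weight m (a, b, c + 1) = weight m (a, b, c)].
Proof. by move=> a b c; rewrite /weight /prod3/= !kap_periodic. Qed.

Lemma weight_mass_shift m (x : R3) : (\int[leb3]_(y in @cube R) (weight m (x - y))%:E = 1)%E.
Proof.
rewrite -(weight_mass m) -(@ge0_integral_cube_shift _ (- x) (EFin \o weight m)); first last.
- by move=> a b c; have [h1 h2 h3] := weight_periodic m a b c; rewrite /= h1 h2 h3.
- by move=> y; rewrite lee_fin weight_ge0.
- by apply/measurable_EFinP; exact: measurable_weight.
by apply: eq_integral => y _; rewrite /= -weight_even opprB.
Qed.

(** The mean in y of the kernel of the modes does not depend on x, by
    translation invariance. *)
Lemma mode_mean m x : \sum_(j : modes m) mode j x * \int[leb3]_(y in @cube R) mode j y = scale m.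
Proof.
have mC := @measurable_cube R.
have [C [HC _ _ _]] := mode_bounded m.
have i0 (j : modes m) : leb3.-integrable (@cube R) (EFin \o mode j).
  have := integrable_bounded_mul mC (integrable_cst_fin mC cube_measure_fin 1)
    (measurable_funTS (measurable_mode j)) (HC j).
  by congr (leb3.-integrable _ _); apply/funext => y /=; rewrite mul1r.
rewrite -Rintegral_lin//.
transitivity (fine (\int[leb3]_(y in @cube R) ((scale m)%:E * (weight m.+1 (x - y))%:E)%E)%E).
  by congr fine; apply: eq_integral => y _; rewrite -EFinM -mode_sum.
rewrite ge0_integralZl_EFin ?weight_mass_shift ?mule1//.
- by move=> y _; rewrite lee_fin weight_ge0.
- apply: measurable_funTS; apply/measurable_EFinP.
  apply: (measurableT_comp (@measurable_weight R m.+1)).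
  have ms (f : B * B * B -> R) (c : R) : measurable_fun setT f -> measurable_fun setT (fun y => c - f y).
    by move=> mf; apply: measurable_funB.
  apply: measurable_fun_pair; first apply: measurable_fun_pair.
  + by apply: (ms (fun y => y.1.1)); exact: measurableT_comp.
  + by apply: (ms (fun y => y.1.2)); exact: measurableT_comp.
  + by apply: (ms (fun y => y.2)); exact: measurable_snd.
- exact: ltW (scale_gt0 m).
Qed.

End Modes.

(** * The momentum equations tested on the modes *)

Section SpatialAverages.
Context {R : realType}.
Local Notation B := (measurableTypeR R).
Local Notation R3 := (R * R * R)%type.
Local Notation R4 := (R * R * R * R)%type.
Local Notation leb := (@lebesgue_measure R).
Variable T : R.
Hypothesis T0 : 0 < T.
Local Notation I := (`]0, T[%classic : set B).
Local Notation Q := (cylinder T).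

Let mI : measurable I. Proof. exact: measurable_itv. Qed.
Let mC := @measurable_cube R.
Let mQ := @measurable_cylinder R T.

(** Tests with [time_kernel] recover the values at Lebesgue points. *)
Lemma weakd0 (G : R -> R) : leb.-integrable I (EFin \o G) -> weakd T (fun=> 0) G ->
  {ae leb, forall t, I t -> G t = 0}.
Proof.
move=> IG wG.
have pts : {ae leb, forall x, lebesgue_pt (G \_ I) x}.
  exact: lebesgue_differentiation (integrable_locally mI IG).
have aef : Filter (almost_everywhere leb) by exact: ae_filter_ringOfSetsType.
apply: filterS pts => s ps; rewrite /= in_itv/= => sT.
have lim := approx_point T0 IG sT ps.
have zero : \forall n \near \oo, \int[leb]_(r in I) (G r * time_kernel n s r) = 0.
  have Ts : 0 < T - s by rewrite subr_gt0; case/andP: sT.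
  near=> n.
  have hs : s + n.+1%:R^-1 < T.
    by rewrite -ltrBrDl; near: n; exact: (near_infty_natSinv_lt (PosNum Ts)).
  rewrite -[RHS](wG _ (elem_time_kernel n s)); last first.
    exists s, (s + n.+1%:R^-1); split => //; first by case/andP: sT.
    move=> t; apply: contraNT; rewrite negb_and -!ltNge => /orP h; apply/eqP.
    exact: time_kernel_out.
  by apply: eq_Rintegral => t _; rewrite mul0r add0r.
exact: (cvg_unique _ lim (cvg_near_cst _ zero)).
Unshelve. all: by end_near. Qed.

(** The integral over the torus at time t, in which the test functions that
    are products separate space from time. *)
Definition cmean (F : R4 -> R) (t : R) : R := \int[leb3]_(x in cube) F (x, t).

Lemma cmean_facts (F : R4 -> R) : leb4.-integrable Q (EFin \o F) ->
  {ae leb, forall t, I t -> leb3.-integrable cube (EFin \o slice F t)} /\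
  leb.-integrable I (EFin \o cmean F).
Proof. by move=> iF; have [h1 h2 _] := fubini_setX mC mI iF. Qed.

Lemma cmean_time (F : R4 -> R) (k : R -> R) (C : R) : leb4.-integrable Q (EFin \o F) ->
  measurable_fun (setT : set B) k -> (forall t, I t -> `|k t| <= C) ->
  [/\ leb4.-integrable Q (EFin \o (fun q => F q * k q.2)),
      leb.-integrable I (EFin \o (fun t => cmean F t * k t)) &
      \int[leb4]_(q in Q) (F q * k q.2) = \int[leb]_(t in I) (cmean F t * k t)].
Proof.
move=> iF mk kC.
have i4 : leb4.-integrable Q (EFin \o (fun q => F q * k q.2)).
  apply: (integrable_bounded_mul mQ iF (C := C)).
    by apply: measurable_funTS; exact: measurableT_comp.
  by move=> q [_ qt]; exact: kC.
have [aeF iM] := cmean_facts iF.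
have i1 : leb.-integrable I (EFin \o (fun t => cmean F t * k t)).
  by apply: (integrable_bounded_mul mI iM (C := C)) => //; exact: measurable_funTS.
split => //.
have [_ i2 ->] := fubini_setX mC mI i4.
congr fine; apply: ae_eq_integral => //.
- exact: measurable_int i2.
- exact: measurable_int i1.
- have aef : Filter (almost_everywhere leb) by exact: ae_filter_ringOfSetsType.
  apply: filterS aeF => t iFt It.
  by rewrite /= /cmean -RintegralZr// iFt.
Qed.

Lemma cmean_pair (F1 F2 : R4 -> R) (k1 k2 : R -> R) :
  leb4.-integrable Q (EFin \o F1) -> leb4.-integrable Q (EFin \o F2) ->
  elem k1 -> elem k2 ->
  \int[leb4]_(q in Q) (F1 q * k1 q.2 + F2 q * k2 q.2) =
  \int[leb]_(t in I) (cmean F1 t * k1 t + cmean F2 t * k2 t).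
Proof.
move=> i1 i2 e1 e2.
have bnd k : elem k -> exists C, forall t, I t -> `|k t| <= C.
  move=> ek; have [C _ HC] := @elem_bounded _ _ 0 T ek.
  by exists C => t; rewrite /= in_itv/= => /andP[t0 tT]; apply: HC; rewrite !ltW.
have [C1 H1] := bnd _ e1; have [C2 H2] := bnd _ e2.
have [a1 b1 c1] := cmean_time i1 (elem_measurable e1) H1.
have [a2 b2 c2] := cmean_time i2 (elem_measurable e2) H2.
by rewrite RintegralD// c1 c2 -RintegralD.
Qed.

Section Solution.
Variables (Omega : R) (u v w p : R4 -> R).
Hypotheses (u2 : sq_integrable leb4 Q u) (v2 : sq_integrable leb4 Q v)
  (w2 : sq_integrable leb4 Q w) (ip : leb4.-integrable Q (EFin \o p)).
Hypothesis eqx : forall f, test_function T f ->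
    \int[leb4]_(q in cylinder T)
      (u q * dt f q
       + u q * (u q * dx f q + v q * dy f q + w q * dz f q)
       + Omega * v q * f q + p q * dx f q) = 0.
Hypothesis eqy : forall f, test_function T f ->
    \int[leb4]_(q in cylinder T)
      (v q * dt f q
       + v q * (u q * dx f q + v q * dy f q + w q * dz f q)
       - Omega * u q * f q + p q * dy f q) = 0.
Hypothesis eqz : forall f, test_function T f ->
    \int[leb4]_(q in cylinder T) (p q * dz f q) = 0.
Hypothesis eqd : forall f, test_function T f ->
    \int[leb4]_(q in cylinder T)
      (u q * dx f q + v q * dy f q + w q * dz f q) = 0.

Section Mode.
Variables (m : nat).
Local Notation modes := (modes m).
Implicit Types j : modes.

Definition transport j q := u q * mode1 j q.1 + v q * mode2 j q.1 + w q * mode3 j q.1.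
(** The x-momentum equation tested on the mode says that [force1] has as spatial
    integral the weak time derivative of the coefficient of u; [force2] plays
    this role for v. *)
Definition force1 j q :=
  u q * transport j q + Omega * v q * mode j q.1 + p q * mode1 j q.1.
Definition force2 j q :=
  v q * transport j q - Omega * u q * mode j q.1 + p q * mode2 j q.1.

Lemma cylinder_measure_fin : (leb4 Q < +oo)%E.
Proof.
have -> : leb4 Q = (leb3 (@cube R) * leb I)%E by exact: product_measure1E.
by rewrite lte_mul_pinfty// ?ge0_fin_numE ?cube_measure_fin// lebesgue_measure_itv/=
  lte_fin T0 -EFinB ltry.
Qed.

Let mfst (f : R3 -> R) : measurable_fun (setT : set (B * B * B)) f ->
  measurable_fun (Q : set (B * B * B * B)) (fun q => f q.1).
Proof. by move=> mf; apply: measurable_funTS; exact: measurableT_comp. Qed.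

Lemma space_bounded (f : R4 -> R) (a : R3 -> R) C : leb4.-integrable Q (EFin \o f) ->
  measurable_fun (setT : set (B * B * B)) a -> (forall x, cube x -> `|a x| <= C) ->
  leb4.-integrable Q (EFin \o (fun q => f q * a q.1)).
Proof.
move=> jf ma aC; apply: (integrable_bounded_mul mQ jf (mfst ma) (C := C)).
by move=> q [qc _]; exact: aC.
Qed.

Lemma force_integrable j : [/\ leb4.-integrable Q (EFin \o transport j),
  leb4.-integrable Q (EFin \o force1 j) & leb4.-integrable Q (EFin \o force2 j)].
Proof.
have [C [K0 K1 K2 K3]] := @mode_bounded R m.
have iu := sq_integrable_int mQ cylinder_measure_fin u2.
have iv := sq_integrable_int mQ cylinder_measure_fin v2.
have tr q (q2 : sq_integrable leb4 Q q) :
    leb4.-integrable Q (EFin \o (fun x => q x * transport j x)).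
  apply: (@integrable_transport _ _ _ leb4 Q mQ modes (fun j q => mode1 j q.1)
    (fun j q => mode2 j q.1) (fun j q => mode3 j q.1) u v w C) => //.
  - by move=> i; apply: mfst; exact: measurable_mode1.
  - by move=> i; apply: mfst; exact: measurable_mode2.
  - by move=> i; apply: mfst; exact: measurable_mode3.
  - by move=> i x [cx _]; exact: K1.
  - by move=> i x [cx _]; exact: K2.
  - by move=> i x [cx _]; exact: K3.
have pb (b : R3 -> R) (f : R4 -> R) : leb4.-integrable Q (EFin \o f) ->
  measurable_fun (setT : set (B * B * B)) b ->
  (forall x, cube x -> `|b x| <= C j) -> leb4.-integrable Q (EFin \o (fun q => f q * b q.1)).
  by move=> jf mb kb; exact: (space_bounded jf mb kb).
split.
- have := tr _ (sq_integrable_cst mQ cylinder_measure_fin 1).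
  by congr (leb4.-integrable _ _); apply/funext => q; rewrite /= mul1r.
- have h1 := pb _ _ iv (measurable_mode j) (K0 j).
  have h2 := pb _ _ ip (measurable_mode1 j) (K1 j).
  have := (Rintegral_lin3 mQ 1 Omega 1 (tr _ u2) h1 h2).1.
  by congr (leb4.-integrable _ _); apply/funext => q; rewrite /= /force1; congr EFin; ring.
- have h1 := pb _ _ iu (measurable_mode j) (K0 j).
  have h2 := pb _ _ ip (measurable_mode2 j) (K2 j).
  have := (Rintegral_lin3 mQ 1 (- Omega) 1 (tr _ v2) h1 h2).1.
  by congr (leb4.-integrable _ _); apply/funext => q; rewrite /= /force2; congr EFin; ring.
Qed.

Lemma mode_integrable (f : R4 -> R) j : leb4.-integrable Q (EFin \o f) ->
  leb4.-integrable Q (EFin \o (fun q => f q * mode j q.1)) /\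
  leb4.-integrable Q (EFin \o (fun q => f q * mode3 j q.1)).
Proof.
have [C [K0 K1 K2 K3]] := @mode_bounded R m.
move=> jf; split.
  exact: (space_bounded jf (measurable_mode j) (K0 j)).
exact: (space_bounded jf (measurable_mode3 j) (K3 j)).
Qed.

Section Test.
Variables (j : modes) (psi : R -> R).
Hypotheses (epsi : elem psi)
  (spsi : exists l r, [/\ 0 < l, r < T & forall t, psi t != 0 -> l <= t <= r]).

Let f := tensor (mono j.1.1) (mono j.1.2) (mono j.2) psi.
Let em k (t : {ffun 'I_k -> 'I_3}) : elem (mono t : R -> R). Proof. exact: elem_mono. Qed.

Let tf : test_function T f.
Proof. by apply: test_tensor => //; exact: mono_periodic. Qed.

Let fE q : [/\ f q = mode j q.1 * psi q.2, dt f q = mode j q.1 * derive1 psi q.2,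
  dx f q = mode1 j q.1 * psi q.2, dy f q = mode2 j q.1 * psi q.2 &
  dz f q = mode3 j q.1 * psi q.2].
Proof. by rewrite /f dt_tensor// dx_tensor// dy_tensor// dz_tensor. Qed.

Lemma tested_x : \int[leb4]_(q in Q)
  (u q * mode j q.1 * derive1 psi q.2 + force1 j q * psi q.2) = 0.
Proof.
rewrite -[RHS](eqx tf); apply: eq_Rintegral => q _.
by have [-> -> -> -> ->] := fE q; rewrite /force1 /transport; ring.
Qed.

Lemma tested_y : \int[leb4]_(q in Q)
  (v q * mode j q.1 * derive1 psi q.2 + force2 j q * psi q.2) = 0.
Proof.
rewrite -[RHS](eqy tf); apply: eq_Rintegral => q _.
by have [-> -> -> -> ->] := fE q; rewrite /force2 /transport; ring.
Qed.

Lemma tested_z : \int[leb4]_(q in Q) (0 * derive1 psi q.2 + p q * mode3 j q.1 * psi q.2) = 0.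
Proof.
rewrite -[RHS](eqz tf); apply: eq_Rintegral => q _.
by have [_ _ _ _ ->] := fE q; ring.
Qed.

Lemma tested_d : \int[leb4]_(q in Q) (0 * derive1 psi q.2 + transport j q * psi q.2) = 0.
Proof.
rewrite -[RHS](eqd tf); apply: eq_Rintegral => q _.
by have [_ _ -> -> ->] := fE q; rewrite /transport; ring.
Qed.

End Test.

Let i0 : leb4.-integrable Q (EFin \o (fun=> 0)).
Proof. exact: integrable_cst_fin mQ cylinder_measure_fin 0. Qed.

Let cmean0 : cmean (fun=> 0) = (fun=> 0).
Proof. by apply/funext => t; rewrite /cmean /Rintegral integral0. Qed.

Lemma weakd_x j : weakd T (cmean (fun q => u q * mode j q.1)) (cmean (force1 j)).
Proof.
move=> psi epsi spsi; have [_ i1 _] := force_integrable j.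
have [i2 _] := mode_integrable j (sq_integrable_int mQ cylinder_measure_fin u2).
by rewrite -cmean_pair ?tested_x//; exact: elem_derive1.
Qed.

Lemma weakd_y j : weakd T (cmean (fun q => v q * mode j q.1)) (cmean (force2 j)).
Proof.
move=> psi epsi spsi; have [_ _ i1] := force_integrable j.
have [i2 _] := mode_integrable j (sq_integrable_int mQ cylinder_measure_fin v2).
by rewrite -cmean_pair ?tested_y//; exact: elem_derive1.
Qed.

(** The time test function is arbitrary, so the constraints hold at almost every
    time, simultaneously for the finitely many modes. *)
Lemma slice_constraints : {ae leb, forall t, I t -> forall j,
  cmean (transport j) t = 0 /\ cmean (fun q => p q * mode3 j q.1) t = 0}.
Proof.
have aef : Filter (almost_everywhere leb) by exact: ae_filter_ringOfSetsType.
suff H j : {ae leb, forall t, I t ->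
    cmean (transport j) t = 0 /\ cmean (fun q => p q * mode3 j q.1) t = 0}.
  by apply: filterS (filter_forall aef H) => t h It j; exact: h.
have [i1 _ _] := force_integrable j.
have [_ i2] := mode_integrable j ip.
have h1 : {ae leb, forall t, I t -> cmean (transport j) t = 0}.
  apply: weakd0; first exact: (cmean_facts i1).2.
  move=> psi epsi spsi; rewrite -[RHS](tested_d j epsi spsi).
  by rewrite [RHS](cmean_pair i0 i1 (elem_derive1 epsi) epsi) cmean0.
have h2 : {ae leb, forall t, I t -> cmean (fun q => p q * mode3 j q.1) t = 0}.
  apply: weakd0; first exact: (cmean_facts i2).2.
  move=> psi epsi spsi; rewrite -[RHS](tested_z j epsi spsi).
  by rewrite [RHS](cmean_pair i0 i2 (elem_derive1 epsi) epsi) cmean0.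
by apply: filterS2 h1 h2 => t a b It; split; [exact: a|exact: b].
Qed.

End Mode.
End Solution.
End SpatialAverages.

(** * Averages of increments against even kernels *)

Section KernelAverages.
Context {R : realType}.
Local Notation B := (measurableTypeR R).
Local Notation R3 := (R * R * R)%type.
Local Notation R4 := (R * R * R * R)%type.
Local Notation leb := (@lebesgue_measure R).

Definition periodic3 (k : R3 -> R) := forall a b c, [/\ k (a + 1, b, c) = k (a, b, c),
  k (a, b + 1, c) = k (a, b, c) & k (a, b, c + 1) = k (a, b, c)].

(** The properties of a kernel on the torus that allow the substitution
    y = x + xi and the change of sign of xi. *)
Definition even_kernel (k : R3 -> R) :=
  [/\ measurable_fun (setT : set (B * B * B)) k, forall x, 0 <= k x,
      forall x, k (- x) = k x & periodic3 k].

Lemma even_kernel_weight m : even_kernel (weight m).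
Proof.
split; [exact: measurable_weight|exact: weight_ge0|exact: weight_even|
  exact: weight_periodic].
Qed.

Lemma measurable_sumsn : measurable_fun (setT : set (B * B * B)) (@sumsn R).
Proof.
have ms : measurable_fun (setT : set B) (fun x : R => `|sn x|).
  apply: measurableT_comp; first exact: normr_measurable.
  by apply: elem_measurable; exact: elem_sn.
apply: measurable_funD; [apply: measurable_funD|].
- by apply: (measurableT_comp ms); exact: measurableT_comp.
- by apply: (measurableT_comp ms); exact: measurableT_comp.
- exact: (measurableT_comp ms).
Qed.

Lemma even_kernel_deriv m : even_kernel (fun x => kconst m * (weight m x * sumsn x)).
Proof.
have snN (s : R) : `|sn (- s)| = `|sn s| by rewrite /sn !addr0 mulrN sinN normrN.
have snD (s : R) : `|sn (s + 1)| = `|sn s|.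
  by rewrite /sn !addr0 mulrDr mulr1 sinDpi normrN.
split.
- apply: measurable_funM => //; apply: measurable_funM; first exact: measurable_weight.
  exact: measurable_sumsn.
- by move=> x; rewrite mulr_ge0 ?kconst_ge0// mulr_ge0 ?weight_ge0 ?sumsn_ge0.
- by move=> x; rewrite weight_even /sumsn/= !snN.
- move=> a b c; have [h1 h2 h3] := weight_periodic m a b c.
  by rewrite h1 h2 h3 /sumsn/= !snD.
Qed.

Local Open Scope ereal_scope.

Lemma measurable_reflect (x : R3) : measurable_fun (setT : set (B * B * B))
  ((fun y => (x - y)%R) : B * B * B -> B * B * B).
Proof.
have ms (f : B * B * B -> R) (c : R) : measurable_fun setT f -> measurable_fun setT (fun y => c - f y)%R.
  by move=> mf; apply: measurable_funB.
apply: measurable_fun_pair; first apply: measurable_fun_pair.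
- by apply: (ms (fun y => y.1.1)); exact: measurableT_comp.
- by apply: (ms (fun y => y.1.2)); exact: measurableT_comp.
- by apply: (ms (fun y => y.2)); exact: measurable_snd.
Qed.

(** Substitutes y = x + xi on the torus in the inner integral. *)
Lemma double_bound (N q k : R3 -> R) (K : R3 -> R3 -> R) :
  even_kernel k -> (forall x, 0 <= N x)%R ->
  measurable_fun (setT : set (B * B * B)) q -> periodic3 q ->
  (forall x y, `|K x y| <= N x * k (x - y))%R ->
  `|\int[leb3]_(x in @cube R) \int[leb3]_(y in @cube R) ((q x - q y) ^+ 2 * K x y)|%R%:E <=
  \int[leb3]_(x in @cube R) \int[leb3]_(xi in @cube R)
     (k xi * (N x * (q (x + xi) - q x) ^+ 2))%R%:E.
Proof.
move=> [mk k0 kN kp] N0 mq qp HK.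
apply: Rintegral_le_any => x _.
apply: (@le_trans _ _ (\int[leb3]_(y in @cube R) ((q x - q y) ^+ 2 * (N x * k (x - y)))%R%:E)).
  apply: Rintegral_le_any => y _.
  rewrite lee_fin normrM ger0_norm ?sqr_ge0// ler_wpM2l ?sqr_ge0//.
pose h (y : R3) := ((q x - q y) ^+ 2 * (N x * k (x - y)))%R%:E.
rewrite -(@ge0_integral_cube_shift _ x h); first last.
- have E (y : R3) : k (x - y)%R = k (y.1.1 - x.1.1, y.1.2 - x.1.2, y.2 - x.2)%R.
    by rewrite -kN opprB.
  move=> a b c; rewrite /h; have [-> -> ->] := qp a b c; rewrite !E/=.
  have [h1 h2 h3] := kp (a - x.1.1)%R (b - x.1.2)%R (c - x.2)%R.
  by split; rewrite addrAC ?h1 ?h2 ?h3.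
- by move=> y; rewrite lee_fin mulr_ge0 ?sqr_ge0// mulr_ge0.
- apply/measurable_EFinP; apply: measurable_funM.
    by apply: measurable_funX; apply: measurable_funB.
  apply: measurable_funM => //.
  exact: (measurableT_comp mk (measurable_reflect x)).
apply: ge0_le_integral_any => xi _.
  by rewrite lee_fin mulr_ge0 ?sqr_ge0// mulr_ge0.
rewrite /h lee_fin (_ : (x - (xi + x) = - xi)%R) ?kN; last by rewrite opprD addrCA subrr addr0.
by rewrite le_eqVlt; apply/orP; left; apply/eqP; rewrite (addrC xi); ring.
Qed.

Section Average.
Variables (T s W M : R) (N q : R4 -> R) (k : R3 -> R).
Hypotheses (W0 : (0 <= W)%R) (M0 : (0 <= M)%R).
Hypotheses (s0 : (0 <= s)%R) (mN : meas4 N) (N0 : (forall z, 0 <= N z)%R) (mq : meas4 q).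
Hypothesis tq : torus_function q.
Hypothesis ek : even_kernel k.
Hypothesis NW : \int[leb4]_(z in cylinder T) ((N z) ^+ 2)%:E <= W%:E.
Hypothesis qM : forall h, \int[leb4]_(z in cylinder T) ((increment q h z) ^+ 4)%:E <=
  (M * (enorm h `^ s) ^+ 4)%:E.

Let F (z : R3 * R4) : \bar R := (k z.1 * (N z.2 * increment q z.1 z.2 ^+ 2))%R%:E.

Let F0 z : 0 <= F z.
Proof. by have [_ k0 _ _] := ek; rewrite lee_fin mulr_ge0// mulr_ge0 ?sqr_ge0. Qed.

Let mF : measurable_fun (setT : set ((B * B * B) * (B * B * B * B))) F.
Proof.
have [mk _ _ _] := ek.
apply/measurable_EFinP; apply: measurable_funM; first exact: measurableT_comp.
apply: measurable_funM; first exact: (measurableT_comp mN).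
by apply: measurable_funX; exact: measurable_increment2.
Qed.

Definition kernel_avg (t : R) : \bar R := \int[leb3]_(x in @cube R)
  \int[leb3]_(xi in @cube R) (k xi * (N (x, t) * increment q xi (x, t) ^+ 2))%R%:E.

Lemma measurable_kernel_avg : measurable_fun (setT : set B) kernel_avg.
Proof.
have mC := @measurable_cube R.
have m1 := measurable_tonelli2 leb3 mC mF F0.
have n1 z : 0 <= \int[leb3]_(xi in @cube R) F (xi, z) by exact: integral_ge0.
exact: (measurable_tonelli2 leb3 mC m1 n1).
Qed.

Lemma kernel_avg_ge0 t : 0 <= kernel_avg t.
Proof. by apply: integral_ge0 => x _; apply: integral_ge0 => xi _; exact: (F0 (xi, (x, t))). Qed.

(** By Tonelli the increment is fixed first.  It is replaced by its shortest
    representative modulo integers, to which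
    [quadratic_increment_bound] applies. *)
Lemma integral_kernel_avg : \int[leb]_(t in `]0%R, T[) kernel_avg t <=
  \int[leb3]_(xi in @cube R) (k xi * ((W + 2 * M) * ((2 * sumsn xi) `^ s) ^+ 2))%R%:E.
Proof.
have mC := @measurable_cube R; have mQ := @measurable_cylinder R T.
have m1 := measurable_tonelli2 leb3 mC mF F0.
have n1 z : 0 <= \int[leb3]_(xi in @cube R) F (xi, z) by exact: integral_ge0.
have -> : \int[leb]_(t in `]0%R, T[) kernel_avg t =
    \int[leb4]_(z in cylinder T) \int[leb3]_(xi in @cube R) F (xi, z).
  by rewrite (integral_cylinder T m1 n1).
rewrite -(tonelli_swap leb3 leb4 mC mQ mF F0).
have [mk k0 _ _] := ek.
apply: ge0_le_integral_any => xi cxi; first exact: integral_ge0.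
have [x' x's Hx'] := cube_rep cxi.
have mi : meas4 (fun z => N z * increment q x' z ^+ 2)%R.
  by apply: meas4M => //; apply: meas4X; exact: meas4_inc.
have -> : \int[leb4]_(z in cylinder T) F (xi, z) =
  (k xi)%:E * \int[leb4]_(z in cylinder T) (N z * increment q x' z ^+ 2)%R%:E.
  rewrite -ge0_integralZl_EFin//.
  - by apply: eq_integral => z _; rewrite /F/= -Hx'.
  - by move=> z _; rewrite lee_fin mulr_ge0 ?sqr_ge0.
  - by apply: measurable_funTS; exact: meas4_EFin.
rewrite EFinM lee_wpmul2l ?lee_fin//.
have B1 := quadratic_increment_bound mN mq mq W0 M0 M0 NW (qM x') (qM x').
apply: (@le_trans _ _ ((W + M + M) * (enorm x' `^ s) ^+ 2)%R%:E).
  apply: le_trans B1; apply: ge0_le_integral_any => z _.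
    by rewrite lee_fin mulr_ge0 ?sqr_ge0.
  by rewrite lee_fin ger0_norm// ler_wpM2l// lerDl sqr_ge0.
rewrite lee_fin (_ : (W + M + M = W + 2 * M)%R); last by ring.
rewrite ler_wpM2l ?addr_ge0 ?mulr_ge0// lerXn2r ?nnegrE ?powR_ge0//.
by rewrite ge0_ler_powR// nnegrE ?sqrtr_ge0// mulr_ge0 ?sumsn_ge0.
Qed.

End Average.

Lemma even_kernel_scale c (k : R3 -> R) : (0 <= c)%R -> even_kernel k ->
  even_kernel (fun x => c * k x)%R.
Proof.
move=> c0 [mk k0 kN kp]; split.
- exact: measurable_funM.
- by move=> x; rewrite mulr_ge0.
- by move=> x; rewrite kN.
- by move=> x y z; have [-> -> ->] := kp x y z.
Qed.

(** A constant in front of the kernel is carried through, so that the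
    normalisation of the modes disappears at the end. *)
Lemma kernel_avg_scaled (T s W M c e : R) (N q : R4 -> R) (k : R3 -> R) :
  (0 <= W)%R -> (0 <= M)%R -> (0 <= s)%R -> (0 <= c)%R ->
  meas4 N -> (forall z, 0 <= N z)%R -> meas4 q -> torus_function q -> even_kernel k ->
  \int[leb4]_(z in cylinder T) ((N z) ^+ 2)%:E <= W%:E ->
  (forall h, \int[leb4]_(z in cylinder T) ((increment q h z) ^+ 4)%:E <=
    (M * (enorm h `^ s) ^+ 4)%:E) ->
  \int[leb3]_(xi in @cube R) (k xi * ((W + 2 * M) * ((2 * sumsn xi) `^ s) ^+ 2))%R%:E <= e%:E ->
  \int[leb]_(t in `]0%R, T[) kernel_avg N q (fun x => c * k x)%R t <= (c * e)%:E.
Proof.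
move=> W0 M0 s0 c0 mN N0 mq tq ek NW qM ke.
apply: le_trans (integral_kernel_avg W0 M0 s0 mN N0 mq tq (even_kernel_scale c0 ek) NW qM) _.
have [mk k0 _ _] := ek.
have X0 (x : R3) : (0 <= k x * ((W + 2 * M) * ((2 * sumsn x) `^ s) ^+ 2))%R.
  apply: mulr_ge0 => //; apply: mulr_ge0; last exact: sqr_ge0.
  by apply: addr_ge0 => //; exact: mulr_ge0.
rewrite EFinM; apply: le_trans (lee_wpmul2l _ ke); last by rewrite lee_fin.
have mC := @measurable_cube R.
rewrite -ge0_integralZl_EFin//.
- apply: ge0_le_integral_any => x _; first by rewrite lee_fin -mulrA; exact: mulr_ge0 (X0 x).
  by rewrite -EFinM lee_fin -mulrA.
- by move=> x _; rewrite lee_fin; exact: X0.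
- have mp : measurable_fun (setT : set (B * B * B)) (fun x => (2 * sumsn x) `^ s)%R.
    apply: (measurableT_comp (measurable_powR s)).
    by apply: measurable_funM; [exact: measurable_cst|exact: measurable_sumsn].
  apply: measurable_funTS; apply/measurable_EFinP.
  apply: (measurable_funM mk); apply: measurable_funM; first exact: measurable_cst.
  exact: measurable_funX.
Qed.

End KernelAverages.

(** * Almost everywhere constant functions, pressure and norms *)

Section Auxiliary.
Context {R : realType}.
Local Notation B := (measurableTypeR R).
Local Notation R3 := (R * R * R)%type.
Local Notation R4 := (R * R * R * R)%type.
Local Notation leb := (@lebesgue_measure R).

(** A constant c' with int |E - c'| small is close to the mean of E, so E is
    close to its mean in L^1, arbitrarily so. *)
Lemma ae_constant (T : R) (E : R -> R) : 0 < T ->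
  leb.-integrable (`]0, T[%classic : set B) (EFin \o E) ->
  (forall e, 0 < e -> exists c,
    (\int[leb]_(t in `]0%R, T[) `|E t - c|%:E <= e%:E)%E) ->
  exists c, {ae leb, forall t, (`]0, T[%classic : set B) t -> E t = c}.
Proof.
move=> T0 iE H.
have mI : measurable (`]0, T[%classic : set B) by exact: measurable_itv.
have lI : leb (`]0, T[%classic : set B) = T%:E.
  by rewrite lebesgue_measure_itv/= lte_fin T0 -EFinB subr0.
have fI : (leb (`]0%R, T[%classic : set B) < +oo)%E by rewrite lI ltry.
have ic c := integrable_cst_fin mI fI c.
have id c : leb.-integrable (`]0, T[%classic : set B) (EFin \o (fun t => E t - c)).
  exact: (integrableB mI iE (ic c)).
have Rc c : \int[leb]_(t in `]0, T[) (c : R) = c * T.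
  transitivity (c * fine (leb (`]0, T[%classic : set B))); first exact: Rintegral_cst.
  by rewrite lI.
pose c := (\int[leb]_(t in `]0, T[) E t) / T.
have mabs : measurable_fun (`]0, T[%classic : set B) (fun t => (E t - c)%:E).
  exact: measurable_int (id c).
have mabs' : measurable_fun (`]0, T[%classic : set B) (fun t => `|E t - c|%:E).
  by apply/measurable_EFinP; apply: measurableT_comp => //; apply/measurable_EFinP.
exists c.
suff z : (\int[leb]_(t in `]0%R, T[) `|(E t - c)%:E| = 0)%E.
  have := (ae_eq_integral_abs leb mI mabs).1 z.
  have aef : Filter (almost_everywhere leb) by exact: ae_filter_ringOfSetsType.
  apply: filterS => t h It; have /= := h It.
  by move=> [] /eqP; rewrite subr_eq0 => /eqP.
apply/eqP; rewrite eq_le; apply/andP; split; last by apply: integral_ge0 => t _; rewrite lee_fin.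
apply/lee_addgt0Pr => e e0; rewrite add0e.
have e2 : 0 < e / 2 by rewrite divr_gt0.
have [d Hd] := H _ e2.
have dc : `|d - c| * T <= e / 2.
  rewrite -lee_fin; apply: le_trans Hd.
  apply: (@le_trans _ _ (`|\int[leb]_(t in `]0, T[) (E t - d)|%:E)); last first.
    by apply: Rintegral_le_any.
  rewrite lee_fin RintegralB// Rc /c.
  rewrite (_ : d - _ = - ((\int[leb]_(t in `]0, T[) E t) - d * T) / T); last first.
    by field; rewrite gt_eqF.
  by rewrite normrM normrN normfV (gtr0_norm T0) divfK// gt_eqF.
apply: (@le_trans _ _ (\int[leb]_(t in `]0%R, T[) (`|E t - d|%:E + `|d - c|%:E))%E).
  apply: ge0_le_integral_any => t _; first by rewrite lee_fin.
  by rewrite lee_fin (_ : E t - c = (E t - d) + (d - c)) ?ler_normD//; ring.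
have md : measurable_fun (`]0, T[%classic : set B) (fun t => `|E t - d|%:E).
  apply/measurable_EFinP; apply: measurableT_comp => //; apply/measurable_EFinP.
  exact: measurable_int (id d).
rewrite ge0_integralD// ?lee_fin//.
rewrite (_ : \int[leb]_(t in `]0%R, T[) `|d - c|%:E = `|d - c|%:E * T%:E)%E; last first.
  by rewrite -lI; exact: integral_cst.
apply: (@le_trans _ _ ((e / 2)%:E + (e / 2)%:E)%E).
  by apply: leeD => //; rewrite -EFinM lee_fin.
by rewrite -EFinD lee_fin -splitr.
Qed.

Local Open Scope ereal_scope.

(** An essential bound on the L^1 norms of the slices is integrated over the
    bounded time interval. *)
Lemma pressure_integrable (T : R) (p : R4 -> R) : (0 < T)%R -> measurable_on T p ->
  bochner_norm T +oo (torus_norm 1%:E) p < +oo ->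
  leb4.-integrable (cylinder T) (EFin \o time_cut T p).
Proof.
move=> T0 mp; rewrite /bochner_norm unlock.
have mp4 : meas4 (time_cut T p) := meas4_time_cut mp.
have l0 : 0 < leb [set: B].
  apply: (@lt_le_trans _ _ (leb (`]0%R, 1%R[ : set B))).
    by rewrite lebesgue_measure_itv/= lte_fin ltr01 oppr0 adde0 lte_fin.
  by apply: le_measure; rewrite ?inE//; exact: measurable_itv.
rewrite /= l0.
set F := (fun t => torus_norm 1%:E (slice p t)) \_ `]0%R, T[.
move=> Foo.
have mI : measurable (`]0%R, T[%classic : set B) by exact: measurable_itv.
have tn t : `]0%R, T[%classic t -> torus_norm 1%:E (slice p t) =
    \int[leb3]_(x in @cube R) `|time_cut T p (x, t)|%:E.
  move=> It; rewrite /torus_norm Lnorm1 [RHS]integral_mkcond; apply: eq_integral => x _.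
  rewrite !patchE; case: ifPn => [|_] /=; last by rewrite normr0.
  by rewrite /slice time_cutE//=; move: It; rewrite /= in_itv/=.
have [M [M0 HM]] : exists M : R, (0 <= M)%R /\ (\forall t \ae leb, `|F t| <= M%:E).
  have ge : 0 <= ess_sup leb (abse \o F) by apply: ess_sup_gee => //; apply/nearW => t /=.
  exists (fine (ess_sup leb (abse \o F))); split; first exact: fine_ge0.
  rewrite fineK ?ge0_fin_numE//.
  exact: (@ess_sup_ge _ _ _ leb (abse \o F)).
apply/integrableP; split; first by apply: measurable_funTS; apply/measurable_EFinP.
have mabs : measurable_fun (setT : set (B * B * B * B)) (fun q => `|time_cut T p q|%:E).
  by apply: meas4_EFin; exact: meas4_norm.
rewrite /= (integral_cylinder T mabs); last by move=> q; rewrite lee_fin.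
have mC := @measurable_cube R.
apply: (@le_lt_trans _ _ (\int[leb]_(t in `]0%R, T[) M%:E)); last first.
  have lI : leb (`]0%R, T[%classic : set B) = T%:E.
    by rewrite lebesgue_measure_itv/= lte_fin T0 -EFinB subr0.
  rewrite (_ : \int[leb]_(t in `]0%R, T[) M%:E = M%:E * T%:E); last first.
    by rewrite -lI; exact: integral_cst.
  by rewrite -EFinM ltry.
apply: ae_ge0_le_integral => //.
- by move=> t _; apply: integral_ge0 => x _; rewrite lee_fin.
- apply: measurable_funTS.
  by apply: (measurable_tonelli2 leb3 mC mabs) => q; rewrite lee_fin.
- have aef : Filter (almost_everywhere leb) by exact: ae_filter_ringOfSetsType.
  apply: filterS HM => t ht It; rewrite -tn//.
  by move: ht; rewrite /F patchE mem_set// => /(le_trans _); apply; exact: lee_abs.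
Qed.

Lemma torus_norm2_sq (f : R3 -> R) :
  torus_norm 2%:E f ^+ 2 = \int[leb3]_(x in @cube R) ((f x) ^+ 2)%:E.
Proof.
rewrite -Lnorm2_pow -/(torus_norm 2%:E f).
have := Lnorm_ge0 leb3 2%:E ((EFin \o f) \_ cube); rewrite -/(torus_norm 2%:E f).
case: (torus_norm _ f) => [r| |]//=.
- by rewrite lee_fin => r0; rewrite powR_mulrn // EFin_expe.
- by rewrite gt_eqF// => _.
Qed.

Lemma bounded_sq_integrable (T W : R) (f : R4 -> R) : meas4 f ->
  \int[leb4]_(q in cylinder T) ((f q) ^+ 2)%:E <= W%:E ->
  sq_integrable leb4 (cylinder T) f.
Proof.
move=> mf fW; split; first exact: measurable_funTS.
apply/integrableP; split; first by apply: measurable_funTS; apply: meas4_EFin; exact: meas4X.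
apply: le_lt_trans (ltry W); apply: le_trans fW.
by apply: ge0_le_integral_any => q _ //=; rewrite lee_fin ger0_norm ?sqr_ge0.
Qed.

End Auxiliary.

(** * Conservation of the energy *)

Section EnergyConservation.
Context {R : realType}.
Local Notation B := (measurableTypeR R).
Local Notation R3 := (R * R * R)%type.
Local Notation R4 := (R * R * R * R)%type.
Local Notation leb := (@lebesgue_measure R).
Variable T : R.
Hypothesis T0 : 0 < T.
Local Notation I := (`]0, T[%classic : set B).
Local Notation Q := (cylinder T).
Variables (Omega : R) (u v w p : R4 -> R) (s W M : R).
Hypotheses (s12 : 2^-1 < s < 1) (W0 : 0 <= W) (M0 : 0 <= M).
Hypotheses (mu : meas4 u) (mv : meas4 v) (mw : meas4 w).
Hypotheses (tu : torus_function u) (tv : torus_function v).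
Hypothesis uW : (\int[leb4]_(q in Q) ((u q) ^+ 2)%:E <= W%:E)%E.
Hypothesis vW : (\int[leb4]_(q in Q) ((v q) ^+ 2)%:E <= W%:E)%E.
Hypothesis wW : (\int[leb4]_(q in Q) ((w q) ^+ 2)%:E <= W%:E)%E.
Hypothesis uM : forall h, (\int[leb4]_(q in Q) ((increment u h q) ^+ 4)%:E <=
  (M * (enorm h `^ s) ^+ 4)%:E)%E.
Hypothesis vM : forall h, (\int[leb4]_(q in Q) ((increment v h q) ^+ 4)%:E <=
  (M * (enorm h `^ s) ^+ 4)%:E)%E.
Hypothesis ip : leb4.-integrable Q (EFin \o p).
Hypothesis eqx : forall f, test_function T f ->
    \int[leb4]_(q in cylinder T)
      (u q * dt f q
       + u q * (u q * dx f q + v q * dy f q + w q * dz f q)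
       + Omega * v q * f q + p q * dx f q) = 0.
Hypothesis eqy : forall f, test_function T f ->
    \int[leb4]_(q in cylinder T)
      (v q * dt f q
       + v q * (u q * dx f q + v q * dy f q + w q * dz f q)
       - Omega * u q * f q + p q * dy f q) = 0.
Hypothesis eqz : forall f, test_function T f ->
    \int[leb4]_(q in cylinder T) (p q * dz f q) = 0.
Hypothesis eqd : forall f, test_function T f ->
    \int[leb4]_(q in cylinder T)
      (u q * dx f q + v q * dy f q + w q * dz f q) = 0.

Let mI : measurable I. Proof. exact: measurable_itv. Qed.
Let mC := @measurable_cube R.
Let mQ := @measurable_cylinder R T.
Let aef : Filter (almost_everywhere leb). Proof. exact: ae_filter_ringOfSetsType. Qed.
Let u2 := bounded_sq_integrable mu uW.
Let v2 := bounded_sq_integrable mv vW.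
Let w2 := bounded_sq_integrable mw wW.
Let lQ := cylinder_measure_fin T0.

Let mslice (f : R4 -> R) t : meas4 f -> measurable_fun (setT : set (B * B * B)) (slice f t).
Proof. by move=> mf; apply: (meas4_comp mf); exact: measurable_fun_pair. Qed.

Lemma ae_slice_sq (f : R4 -> R) : meas4 f -> sq_integrable leb4 Q f ->
  {ae leb, forall t, I t -> sq_integrable leb3 (@cube R) (slice f t)}.
Proof.
move=> mf f2; have [h _] := cmean_facts f2.2.
apply: filterS h => t ht It; split; first by apply: measurable_funTS; exact: mslice.
exact: ht.
Qed.

Section Level.
Variable m : nat.

Definition mode_flux (q : R4 -> R) (t : R) : R :=
  flux leb3 (@cube R) (@mode R m) (@mode1 R m) (@mode2 R m) (@mode3 R m)
    (slice u t) (slice v t) (slice w t) (slice q t).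

Definition mode_work (t : R) : R := \sum_(j : modes m)
  (cmean (fun q => u q * mode j q.1) t * cmean (force1 Omega u v w p j) t +
   cmean (fun q => v q * mode j q.1) t * cmean (force2 Omega u v w p j) t).

Definition mode_energy (t : R) : R := \sum_(j : modes m)
  (cmean (fun q => u q * mode j q.1) t ^+ 2 + cmean (fun q => v q * mode j q.1) t ^+ 2).

(** The abstract identity on almost every time slice. *)
Lemma ae_mode_work : {ae leb, forall t, I t ->
  2 * mode_work t = - (mode_flux u t + mode_flux v t)}.
Proof.
have [C [K0 K1 K2 K3]] := @mode_bounded R m.
have ha := ae_slice_sq mu u2; have hb := ae_slice_sq mv v2; have hc := ae_slice_sq mw w2.
have hp := (cmean_facts ip).1.
have hd := slice_constraints T0 Omega u2 v2 w2 ip eqz eqd m.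
have H := @filterI _ _ aef _ _ (@filterI _ _ aef _ _ ha hb) (@filterI _ _ aef _ _ hc (@filterI _ _ aef _ _ hp hd)).
apply: (@filterS _ _ aef _ _ _ H) => t [[h1 h2] [h3 [h4 h5]]] It.
apply: (energy_identity mC cube_measure_fin Omega (C := C)) => //.
- by move=> j; apply: measurable_funTS; exact: measurable_mode.
- by move=> j; apply: measurable_funTS; exact: measurable_mode1.
- by move=> j; apply: measurable_funTS; exact: measurable_mode2.
- by move=> j; apply: measurable_funTS; exact: measurable_mode3.
- exact: h1.
- exact: h2.
- exact: h3.
- exact: h4.
- exact: mode1_anti.
- exact: mode2_anti.
- exact: mode3_anti.
- by move=> j; case: (@mode_mean0 R m j).
- by move=> j; case: (@mode_mean0 R m j).
- by move=> j; case: (@mode_mean0 R m j).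
- by move=> j; exact: (h5 It j).1.
- by move=> j; exact: (h5 It j).2.
Qed.

(** Sums the identities of [weak_square] over the modes: the truncated energy is a
    constant minus the tail of the total work, and the latter is minus the
    flux. *)
Lemma mode_balance (g : R -> \bar R) :
  measurable_fun I g -> (forall t, 0 <= g t)%E ->
  {ae leb, forall t, I t -> (`|mode_flux u t + mode_flux v t|%:E <= g t)%E} ->
  exists c, {ae leb, forall r, I r ->
    (`|mode_energy r - c|%:E <= \int[leb]_(t in `]0%R, T[) g t)%E}.
Proof.
move=> mg g0 fg.
have iu := sq_integrable_int mQ lQ u2; have iv := sq_integrable_int mQ lQ v2.
have FI (j : modes m) := force_integrable T0 Omega u2 v2 w2 ip j.
pose U (j : modes m) := cmean (fun q => u q * mode j q.1).
pose V (j : modes m) := cmean (fun q => v q * mode j q.1).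
pose G (j : modes m) := cmean (force1 Omega u v w p j).
pose H (j : modes m) := cmean (force2 Omega u v w p j).
have SU (j : modes m) : exists Ac : (R -> R) * R,
    [/\ {ae leb, forall r, I r -> U j r = Ac.1 r},
    leb.-integrable I (EFin \o (fun r => Ac.1 r * G j r)) &
    {ae leb, forall r, I r -> U j r ^+ 2 = Ac.2 - 2 * tail T (fun t => Ac.1 t * G j t) r}].
  have [_ i1 _] := FI j.
  have [A [c [h1 h2 h3]]] := weak_square T0 (cmean_facts (mode_integrable j iu).1).2
    (cmean_facts i1).2 (weakd_x T0 u2 v2 w2 ip eqx j).
  by exists (A, c).
have SV (j : modes m) : exists Ac : (R -> R) * R,
    [/\ {ae leb, forall r, I r -> V j r = Ac.1 r},
    leb.-integrable I (EFin \o (fun r => Ac.1 r * H j r)) &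
    {ae leb, forall r, I r -> V j r ^+ 2 = Ac.2 - 2 * tail T (fun t => Ac.1 t * H j t) r}].
  have [_ _ i1] := FI j.
  have [A [c [h1 h2 h3]]] := weak_square T0 (cmean_facts (mode_integrable j iv).1).2
    (cmean_facts i1).2 (weakd_y T0 u2 v2 w2 ip eqy j).
  by exists (A, c).
have [A HA] := choice SU; have [A' HA'] := choice SV.
pose F t := \sum_(j : modes m) 2 * ((A j).1 t * G j t + (A' j).1 t * H j t).
have iAG (j : modes m) : leb.-integrable I
    (EFin \o (fun t => (A j).1 t * G j t + (A' j).1 t * H j t)).
  have [_ h1 _] := HA j; have [_ h2 _] := HA' j.
  exact: (integrableD mI h1 h2).
have iF : leb.-integrable I (EFin \o F) := integrable_lin mI (fun=> 2) iAG.
have fF : {ae leb, forall t, I t -> (`|F t|%:E <= g t)%E}.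
  have h1 := filter_forall aef (fun j => (let: And3 h _ _ := HA j in h)).
  have h2 := filter_forall aef (fun j => (let: And3 h _ _ := HA' j in h)).
  have HH := @filterI _ _ aef _ _ (@filterI _ _ aef _ _ h1 h2) (@filterI _ _ aef _ _ ae_mode_work fg).
  apply: (@filterS _ _ aef _ _ _ HH) => t [[k1 k2] [k3 k4]] It.
  have -> : F t = 2 * mode_work t.
    rewrite /F /mode_work mulr_sumr; apply: eq_bigr => j _.
    by rewrite -(k1 j It) -(k2 j It).
  by rewrite k3// normrN; exact: k4.
exists (\sum_(j : modes m) ((A j).2 + (A' j).2)).
have h1 := filter_forall aef (fun j => (let: And3 _ _ h := HA j in h)).
have h2 := filter_forall aef (fun j => (let: And3 _ _ h := HA' j in h)).
apply: filterS2 h1 h2 => r k1 k2 Ir.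
have /andP[r0 rT] : 0 < r < T by move: Ir; rewrite /= in_itv.
have mr : measurable (`]r, T[ : set B) by exact: measurable_itv.
have rI : (`]r, T[ : set B) `<=` I by apply: subset_itvr; rewrite bnd_simp ltW.
have E : mode_energy r - \sum_(j : modes m) ((A j).2 + (A' j).2) = - tail T F r.
  have -> : mode_energy r = \sum_(j : modes m) (U j r ^+ 2 + V j r ^+ 2) by [].
  rewrite [tail T F r](Rintegral_lin mr (fun=> 2)); last first.
    by move=> j; exact: (integrableS mI mr rI (iAG j)).
  rewrite -!sumrN -big_split/=; apply: eq_bigr => j _.
  have [_ i1 _] := HA j; have [_ i2 _] := HA' j.
  have j1 := integrableS mI mr rI i1; have j2 := integrableS mI mr rI i2.
  rewrite (RintegralD mr j1 j2) (k1 j Ir) (k2 j Ir) -![\int[leb]_(x in `]r, T[) _]/(tail T _ r).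
  by move: (tail _ _ _) (tail _ _ _) (A j).2 (A' j).2 => a b c d; ring.
rewrite E normrN.
apply: (@le_trans _ _ (\int[leb]_(t in `]r, T[) `|F t|%:E)%E).
  exact: Rintegral_le_any.
have mF : measurable_fun I (fun t => `|F t|%:E).
  apply/measurable_EFinP; apply: measurableT_comp => //; apply/measurable_EFinP.
  exact: measurable_int iF.
apply: (@le_trans _ _ (\int[leb]_(t in `]0%R, T[) `|F t|%:E)%E).
  by apply: ge0_subset_integral => // t _; rewrite lee_fin.
by apply: ae_ge0_le_integral => // t _; rewrite lee_fin.
Qed.

Let periodic3_slice (q : R4 -> R) t : torus_function q -> periodic3 (slice q t).
Proof. by move=> [h1 h2] a b c; have [e1 e2] := h1 a b c t; rewrite /slice e1 e2 h2. Qed.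

Let wt0 : even_kernel (fun x : R3 => kconst m * (weight m x * sumsn x)).
Proof. exact: even_kernel_deriv. Qed.

Definition speed (z : R4) : R := `|u z| + `|v z| + `|w z|.

(** The kernel of the flux is the velocity applied to the gradient of the product
    kernel, bounded by [dker_bound]. *)
Lemma mode_flux_le (q : R4 -> R) t : meas4 q -> torus_function q ->
  (`|mode_flux q t|%:E <=
   kernel_avg speed q (fun x => scale m * (kconst m * (weight m x * sumsn x)))%R t)%E.
Proof.
move=> mq tq.
apply: (@double_bound _ (slice speed t) (slice q t)
  (fun x => scale m * (kconst m * (weight m x * sumsn x)))
  (fun x y => \sum_(j : modes m) (slice u t x * mode1 j x + slice v t x * mode2 j x +
     slice w t x * mode3 j x) * mode j y)).
- exact: even_kernel_scale (ltW (scale_gt0 m)) wt0.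
- by move=> x; rewrite /slice /speed !addr_ge0.
- exact: mslice.
- exact: periodic3_slice.
- move=> x y.
  have -> : \sum_(j : modes m) (slice u t x * mode1 j x + slice v t x * mode2 j x +
     slice w t x * mode3 j x) * mode j y =
     scale m * (slice u t x * dker1 m (x - y) + slice v t x * dker2 m (x - y)
       + slice w t x * dker3 m (x - y)).
    transitivity (slice u t x * (\sum_(j : modes m) mode1 j x * mode j y) +
      slice v t x * (\sum_(j : modes m) mode2 j x * mode j y) +
      slice w t x * (\sum_(j : modes m) mode3 j x * mode j y)).
      by rewrite !mulr_sumr -!big_split/=; apply: eq_bigr => j _; ring.
    by rewrite mode1_sum mode2_sum mode3_sum; ring.
  rewrite normrM (gtr0_norm (scale_gt0 m)) [leRHS](_ : _ = scale m *
    (slice speed t x * (kconst m * (weight m (x - y) * sumsn (x - y))))); last exact: mulrCA.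
  rewrite ler_wpM2l ?(ltW (scale_gt0 m))//.
  have [d1 d2 d3] := dker_bound m (x - y).
  rewrite /slice /speed !mulrDl.
  apply: le_trans (ler_normD _ _) _; apply: lerD; last by rewrite normrM ler_wpM2l.
  by apply: le_trans (ler_normD _ _) _; apply: lerD; rewrite normrM ler_wpM2l.
Qed.

(** The difference between the energy and its truncation is half of an
    average of squared increments, by [kernel_variance]. *)
Lemma mode_variance_le (q : R4 -> R) : meas4 q -> torus_function q ->
  sq_integrable leb4 Q q ->
  {ae leb, forall t, I t -> (`|scale m * cmean (fun z => q z ^+ 2) t -
     \sum_(j : modes m) cmean (fun z => q z * mode j z.1) t ^+ 2|%:E <=
   kernel_avg (fun=> 1%R) q (fun x => scale m * weight m.+1 x)%R t)%E}.
Proof.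
move=> mq tq q2.
have [C [K0 _ _ _]] := @mode_bounded R m.
apply: filterS (ae_slice_sq mq q2) => t q2t It.
have E := kernel_variance mC cube_measure_fin
  (fun j => measurable_funTS (@measurable_mode R m j)) K0 (q2t It)
  (fun x _ => @mode_mean R m x).
have D := @double_bound _ (fun=> 1) (slice q t) (fun x => scale m * weight m.+1 x)
  (fun x y => \sum_(j : modes m) mode j x * mode j y)
  (even_kernel_scale (ltW (scale_gt0 m)) (@even_kernel_weight R m.+1))
  (fun=> ler01) (mslice t mq) (periodic3_slice t tq).
apply: le_trans (D _); last first.
  move=> x y; rewrite mode_sum mul1r ger0_norm// mulr_ge0 ?weight_ge0//.
  exact: ltW (scale_gt0 m).
rewrite lee_fin [in leRHS]E normrM ger0_norm//.
by rewrite ler_peMl// ler1n.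
Qed.

End Level.

Lemma speed_sq : (\int[leb4]_(z in Q) ((speed z) ^+ 2)%:E <= (9 * W)%:E)%E.
Proof.
apply: (@le_trans _ _ (\int[leb4]_(z in Q)
  (3%:E * ((u z ^+ 2)%:E + (v z ^+ 2)%:E + (w z ^+ 2)%:E)))%E).
  apply: ge0_le_integral_any => z _; first by rewrite lee_fin sqr_ge0.
  rewrite -!EFinD -EFinM lee_fin /speed -(real_normK (num_real (u z)))
    -(real_normK (num_real (v z))) -(real_normK (num_real (w z))).
  move: `|u z| `|v z| `|w z| => a b c.
  have := sqr_ge0 (a - b); have := sqr_ge0 (b - c); have := sqr_ge0 (a - c); nra.
have msq (f : R4 -> R) : meas4 f -> measurable_fun (Q : set (B * B * B * B)) (fun z => (f z ^+ 2)%:E).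
  by move=> mf; apply: measurable_funTS; apply: meas4_EFin; exact: meas4X.
have nn (f : R4 -> R) z : (0 <= (f z ^+ 2)%:E)%E by rewrite lee_fin sqr_ge0.
rewrite ge0_integralZl_EFin//; first last.
- by apply: emeasurable_funD; [apply: emeasurable_funD|]; exact: msq.
- by move=> z _; rewrite !adde_ge0.
rewrite ge0_integralD//; first last.
- exact: msq.
- by apply: emeasurable_funD; exact: msq.
- by move=> z _; rewrite adde_ge0.
rewrite ge0_integralD//; [|exact: msq|exact: msq].
apply: (@le_trans _ _ (3%:E * (W%:E + W%:E + W%:E))%E).
  by rewrite lee_wpmul2l// leeD// leeD.
by rewrite -!EFinD -EFinM lee_fin le_eqVlt; apply/orP; left; apply/eqP; ring.
Qed.

(** At a level m such that both kernel averages are small, the energy is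
    within a small error, integrated in time, of the truncated energy, which is
    uniformly close to a constant.  All bounds carry the factor
    [scale m], which is divided out at the end. *)
Lemma energy_constant : exists c, {ae leb, forall t, I t ->
  cmean (fun z => u z ^+ 2) t + cmean (fun z => v z ^+ 2) t = c}.
Proof.
have iu := (cmean_facts u2.2).2; have iv := (cmean_facts v2.2).2.
set E := fun t => cmean (fun z => u z ^+ 2) t + cmean (fun z => v z ^+ 2) t.
have iE : leb.-integrable I (EFin \o E) by exact: (integrableD mI iu iv).
apply: (ae_constant T0 iE) => e e0.
have s0 : 0 <= s by case/andP: s12 => h _; rewrite ltW// (lt_trans _ h)// invr_gt0.
have T2 : 0 < 2 + 2 * T by rewrite ltr_wpDr// mulr_ge0// ltW.
(* the error is 2 e1 from the variances and 2 e1 T from the flux *)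
pose e1 := e / (2 + 2 * T); have e10 : 0 < e1 by rewrite divr_gt0.
pose W1 := fine (leb4 Q); have W10 : 0 <= W1 by rewrite fine_ge0.
have oneW : (\int[leb4]_(z in Q) ((1 : R) ^+ 2)%:E <= W1%:E)%E.
  rewrite expr1n; rewrite (_ : (\int[leb4]_(z in Q) (1 : R)%:E = leb4 Q)%E); last first.
    by rewrite -[RHS]mul1e; exact: integral_cst.
  by rewrite /W1 fineK// ge0_fin_numE.
have W9 : 0 <= 9 * W by rewrite mulr_ge0.
have MM1 : 0 <= 9 * W + 2 * M by rewrite addr_ge0// mulr_ge0.
have MM2 : 0 <= W1 + 2 * M by rewrite addr_ge0// mulr_ge0.
have [m1 H1] := derivative_kernel_small s12 MM1 e10.
have [m2 H2] := kernel_small s12 MM2 e10.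
pose m := maxn m1 m2.
have {}H1 := H1 m (leq_maxl _ _); have {}H2 := H2 m (leq_maxr _ _).
have sc0 := scale_gt0 m : 0 < scale m :> R.
have m1' : meas4 (fun=> 1 : R) by exact: measurable_cst.
have mS : meas4 speed.
  by apply: meas4D; [apply: meas4D|]; exact: meas4_norm.
have S0 z : 0 <= speed z by rewrite /speed !addr_ge0.
pose kd (x : R3) := kconst m * (weight m x * sumsn x).
have ekd : even_kernel kd by exact: even_kernel_deriv.
have ekw := @even_kernel_weight R m.+1.
pose ku t := kernel_avg speed u (fun x => scale m * kd x) t.
pose kv t := kernel_avg speed v (fun x => scale m * kd x) t.
pose du t := kernel_avg (fun=> 1) u (fun x => scale m * weight m.+1 x) t.
pose dv t := kernel_avg (fun=> 1) v (fun x => scale m * weight m.+1 x) t.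
have Bku : (\int[leb]_(t in `]0%R, T[) ku t <= (scale m * e1)%:E)%E.
  exact: (kernel_avg_scaled W9 M0 s0 (ltW sc0) mS S0 mu tu ekd speed_sq uM H1).
have Bkv : (\int[leb]_(t in `]0%R, T[) kv t <= (scale m * e1)%:E)%E.
  exact: (kernel_avg_scaled W9 M0 s0 (ltW sc0) mS S0 mv tv ekd speed_sq vM H1).
have Bdu : (\int[leb]_(t in `]0%R, T[) du t <= (scale m * e1)%:E)%E.
  exact: (kernel_avg_scaled W10 M0 s0 (ltW sc0) m1' (fun=> ler01) mu tu ekw oneW uM H2).
have Bdv : (\int[leb]_(t in `]0%R, T[) dv t <= (scale m * e1)%:E)%E.
  exact: (kernel_avg_scaled W10 M0 s0 (ltW sc0) m1' (fun=> ler01) mv tv ekw oneW vM H2).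
have esd := even_kernel_scale (ltW sc0) ekd.
have esw := even_kernel_scale (ltW sc0) ekw.
have mku : measurable_fun I ku by apply: measurable_funTS; exact: measurable_kernel_avg.
have mkv : measurable_fun I kv by apply: measurable_funTS; exact: measurable_kernel_avg.
have mdu : measurable_fun I du by apply: measurable_funTS; exact: measurable_kernel_avg.
have mdv : measurable_fun I dv by apply: measurable_funTS; exact: measurable_kernel_avg.
have ku0 t : (0 <= ku t)%E by exact: kernel_avg_ge0.
have kv0 t : (0 <= kv t)%E by exact: kernel_avg_ge0.
have du0 t : (0 <= du t)%E by exact: kernel_avg_ge0.
have dv0 t : (0 <= dv t)%E by exact: kernel_avg_ge0.
have Fl t : (`|mode_flux m u t + mode_flux m v t|%:E <= ku t + kv t)%E.
  apply: le_trans (leeD (mode_flux_le m t mu tu) (mode_flux_le m t mv tv)).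
  by rewrite -EFinD lee_fin ler_normD.
have Vu : {ae leb, forall t, I t -> (`|scale m * cmean (fun z => u z ^+ 2) t -
  \sum_(j : modes m) cmean (fun z => u z * mode j z.1) t ^+ 2|%:E <= du t)%E}.
  exact: mode_variance_le mu tu u2.
have Vv : {ae leb, forall t, I t -> (`|scale m * cmean (fun z => v z ^+ 2) t -
  \sum_(j : modes m) cmean (fun z => v z * mode j z.1) t ^+ 2|%:E <= dv t)%E}.
  exact: mode_variance_le mv tv v2.
clearbody ku kv du dv.
have mk : measurable_fun I (fun t => ku t + kv t)%E := emeasurable_funD mku mkv.
have [c Hc] := @mode_balance m _ mk (fun t => adde_ge0 (ku0 t) (kv0 t)) (aeW leb (fun t _ => Fl t)).
have Bk : (\int[leb]_(t in `]0%R, T[) (ku t + kv t) <= (2 * (scale m * e1))%:E)%E.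
  rewrite ge0_integralD//; apply: le_trans (leeD Bku Bkv) _.
  by rewrite -EFinD lee_fin le_eqVlt; apply/orP; left; apply/eqP; ring.
exists (c / scale m).
have id0 : leb.-integrable I (EFin \o (fun t => scale m * E t - c)).
  have lI : (leb I < +oo)%E by rewrite lebesgue_measure_itv/= lte_fin T0 -EFinB ltry.
  exact: (integrableB mI (integrableZl mI (scale m) iE) (integrable_cst_fin mI lI c)).
have mabs : measurable_fun I (fun t => `|scale m * E t - c|%:E).
  apply/measurable_EFinP; apply: measurableT_comp => //; apply/measurable_EFinP.
  exact: measurable_int id0.
have key : (\int[leb]_(t in `]0%R, T[) `|scale m * E t - c|%:E <= (scale m * e)%:E)%E.
  pose K := (2 * (scale m * e1)).
  have K0 : 0 <= K by rewrite mulr_ge0// mulr_ge0// ltW.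
  apply: (@le_trans _ _ (\int[leb]_(t in `]0%R, T[) (du t + dv t + K%:E))%E).
    apply: ae_ge0_le_integral => //.
    - by move=> t _; rewrite !adde_ge0.
    - by apply: emeasurable_funD => //; exact: (emeasurable_funD mdu mdv).
    - have HH := @filterI _ _ aef _ _ Hc (@filterI _ _ aef _ _ Vu Vv).
      apply: (@filterS _ _ aef _ _ _ HH) => t [k1 [k2 k3]] It.
      apply: le_trans (leeD (leeD (k2 It) (k3 It)) (le_trans (k1 It) Bk)).
      have tri (k a b f g d : R) :
          `|k * (a + b) - d| <= `|k * a - f| + `|k * b - g| + `|f + g - d|.
        rewrite (_ : k * (a + b) - d = (k * a - f) + (k * b - g) + (f + g - d)); last by ring.
        by apply: le_trans (ler_normD _ _) _; rewrite lerD// ler_normD.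
      by rewrite -!EFinD lee_fin /mode_energy big_split; exact: tri.
  rewrite ge0_integralD//; first last.
  - exact: (emeasurable_funD mdu mdv).
  - by move=> t _; exact: adde_ge0.
  rewrite ge0_integralD//.
  rewrite (_ : (\int[leb]_(t in `]0%R, T[) K%:E = K%:E * T%:E)%E); last first.
    rewrite (_ : T%:E = leb I); first exact: integral_cst.
    by rewrite lebesgue_measure_itv/= lte_fin T0 -EFinB subr0.
  apply: le_trans (leeD (leeD Bdu Bdv) (lexx _)) _.
  rewrite -EFinM -!EFinD lee_fin le_eqVlt; apply/orP; left; apply/eqP.
  by rewrite /K /e1; field; rewrite gt_eqF.
rewrite (_ : (\int[leb]_(t in `]0%R, T[) `|E t - c / scale m|%:E =
  \int[leb]_(t in `]0%R, T[) ((scale m)^-1%:E * `|scale m * E t - c|%:E))%E); last first.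
  apply: eq_integral => t _; rewrite -EFinM; congr EFin.
  rewrite -[(scale m)^-1 in RHS]gtr0_norm ?invr_gt0// -normrM; congr `|_|.
  by field; rewrite gt_eqF.
have is0 : 0 <= (scale m : R)^-1 by rewrite invr_ge0; exact: ltW.
rewrite ge0_integralZl_EFin//.
apply: le_trans (lee_wpmul2l _ key) _; first by rewrite lee_fin.
by rewrite -EFinM lee_fin mulKf// gt_eqF.
Qed.

End EnergyConservation.

(** * The theorem *)

Theorem proposition3p1 (R : realType) (Omega T alpha : R)
    (u v w p : R * R * R * R -> R)
    (T_gt0 : 0 < T) (alpha_gt : 2^-1 < alpha)
    (sol : type_I_weak_solution Omega T u v w p)
    (sym : z_symmetric T u v w p)
    (u_besov : (bochner_norm T 4%:E (besov_norm alpha 4%:E) u < +oo)%E)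
    (v_besov : (bochner_norm T 4%:E (besov_norm alpha 4%:E) v < +oo)%E) :
  (forall rho : R * R * R -> R, radial_mollifier rho ->
     is_defect rho T u v w (fun _ => 0)) /\
  conserves_energy T u v.
Proof.
have [tu tv tw tp] := sol_periodic sol.
have [mu mv mw mp] := sol_measurable sol.
have [u2 v2 w2] := sol_L2 sol.
have [Mu Mu0 [_ uM]] := nikolskii alpha_gt mu tu u_besov.
have [Mv Mv0 [_ vM]] := nikolskii alpha_gt mv tv v_besov.
have [Wu Wu0 uW] := cylinder_L2 u2.
have [Wv Wv0 vW] := cylinder_L2 v2.
have [Ww Ww0 wW] := cylinder_L2 w2.
have mu' := meas4_time_cut mu; have mv' := meas4_time_cut mv; have mw' := meas4_time_cut mw.
have tu' := torus_time_cut T tu; have tv' := torus_time_cut T tv.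
have tw' := torus_time_cut T tw.
have [s1 s2] : 2^-1 < nik_exp alpha /\ nik_exp alpha < 1.
  rewrite /nik_exp lt_min gt_min alpha_gt /=; split; first lra.
  by apply/orP; right; lra.
split.
  move=> rho hrho f tf.
  have H := defect_zero s1 mu' mv' mw' tu' tv' tw' uM vM Mu0 Mv0 Wu0 Wv0 Ww0 uW vW wW hrho tf.
  have E : (fun eps => \int[leb4]_(q in cylinder T) (defect_density rho u v w eps q * f q)) =
      (fun eps => \int[leb4]_(q in cylinder T) (defect_density rho
        (time_cut T u) (time_cut T v) (time_cut T w) eps q * f q)).
    apply/funext => eps; apply: eq_Rintegral => q; rewrite inE => hq.
    congr (_ * _); apply: eq_Rintegral => xi _.
    by rewrite !(cylinder_inc_cut _ xi hq).
  by rewrite [X in X @ _ --> _]E.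
have cut g q : cylinder T q -> g q = time_cut T g q.
  by move=> hq; rewrite cylinder_time_cut.
have ip := pressure_integrable T_gt0 mp (sol_LooL1 sol).
pose W := Wu + Wv + Ww; pose M := Mu + Mv.
have W0 : 0 <= W by rewrite !addr_ge0.
have M0 : 0 <= M by rewrite addr_ge0.
have uW' : (\int[leb4]_(q in cylinder T) ((time_cut T u q) ^+ 2)%:E <= W%:E)%E.
  by apply: le_trans uW _; rewrite lee_fin /W; lra.
have vW' : (\int[leb4]_(q in cylinder T) ((time_cut T v q) ^+ 2)%:E <= W%:E)%E.
  by apply: le_trans vW _; rewrite lee_fin /W; lra.
have wW' : (\int[leb4]_(q in cylinder T) ((time_cut T w q) ^+ 2)%:E <= W%:E)%E.
  by apply: le_trans wW _; rewrite lee_fin /W; lra.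
have e4 h : 0 <= (enorm h `^ nik_exp alpha) ^+ 4 :> R by rewrite exprn_ge0// powR_ge0.
have uM' h : (\int[leb4]_(q in cylinder T) ((increment (time_cut T u) h q) ^+ 4)%:E <=
    (M * (enorm h `^ nik_exp alpha) ^+ 4)%:E)%E.
  by apply: le_trans (uM h) _; rewrite lee_fin ler_wpM2r// lerDl.
have vM' h : (\int[leb4]_(q in cylinder T) ((increment (time_cut T v) h q) ^+ 4)%:E <=
    (M * (enorm h `^ nik_exp alpha) ^+ 4)%:E)%E.
  by apply: le_trans (vM h) _; rewrite lee_fin ler_wpM2r// lerDr.
have s12 : 2^-1 < nik_exp alpha < 1 by rewrite s1 s2.
have eqx f : test_function T f -> \int[leb4]_(q in cylinder T)
    (time_cut T u q * dt f q + time_cut T u q *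
      (time_cut T u q * dx f q + time_cut T v q * dy f q + time_cut T w q * dz f q)
       + Omega * time_cut T v q * f q + time_cut T p q * dx f q) = 0.
  move=> tf; rewrite -[RHS](sol_momentum_x sol tf); apply: eq_Rintegral => q.
  by rewrite inE => hq; rewrite -!cut.
have eqy f : test_function T f -> \int[leb4]_(q in cylinder T)
    (time_cut T v q * dt f q + time_cut T v q *
      (time_cut T u q * dx f q + time_cut T v q * dy f q + time_cut T w q * dz f q)
       - Omega * time_cut T u q * f q + time_cut T p q * dy f q) = 0.
  move=> tf; rewrite -[RHS](sol_momentum_y sol tf); apply: eq_Rintegral => q.
  by rewrite inE => hq; rewrite -!cut.
have eqz f : test_function T f ->
    \int[leb4]_(q in cylinder T) (time_cut T p q * dz f q) = 0.
  move=> tf; rewrite -[RHS](sol_momentum_z sol tf); apply: eq_Rintegral => q.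
  by rewrite inE => hq; rewrite -!cut.
have eqd f : test_function T f -> \int[leb4]_(q in cylinder T)
    (time_cut T u q * dx f q + time_cut T v q * dy f q + time_cut T w q * dz f q) = 0.
  move=> tf; rewrite -[RHS](sol_divergence sol tf); apply: eq_Rintegral => q.
  by rewrite inE => hq; rewrite -!cut.
have [c Ec] := energy_constant T_gt0 s12 W0 M0 mu' mv' mw' tu' tv'
  uW' vW' wW' uM' vM' ip eqx eqy eqz eqd.
have su := (cmean_facts (bounded_sq_integrable mu' uW').2).1.
have sv := (cmean_facts (bounded_sq_integrable mv' vW').2).1.
have mC := @measurable_cube R.
have aef : Filter (almost_everywhere (@lebesgue_measure R)).
  exact: ae_filter_ringOfSetsType.
have H := @filterI _ _ aef _ _ Ec (@filterI _ _ aef _ _ su sv).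
have sq f t : 0 < t < T ->
    leb3.-integrable cube (EFin \o slice (fun q => time_cut T f q ^+ 2) t) ->
    (torus_norm 2%:E (slice f t) ^+ 2 = (cmean (fun q => time_cut T f q ^+ 2) t)%:E)%E.
  move=> tT fi; rewrite torus_norm2_sq /cmean /Rintegral fineK; last first.
    exact: (integrable_fin_num mC fi).
  by apply: eq_integral => x _; rewrite time_cutE.
have {}H : {ae @lebesgue_measure R, forall t, 0 < t < T -> energy u v t = c%:E}.
  apply: (@filterS _ _ aef _ _ _ H) => t [h1 [h2 h3]] tT.
  have It : (`]0, T[%classic : set (measurableTypeR R)) t by rewrite /= in_itv.
  by rewrite /energy !sq// ?(h2 It) ?(h3 It)// -EFinD h1.
exists (~` [set t | 0 < t < T -> energy u v t = c%:E]); first exact: H.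
move=> t1 t2 tT1 tT2 /contrapT n1 /contrapT n2.
by rewrite n1// n2.
Qed.
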